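(* Let $Z$ be a centered Gaussian process with continuous covariance function $\kappa(t,s)$, let $X_t=\int_0^tZ_u\,du$ be the integrated process, and let $X^n$ denote the associated $n$-fold conditional process. Then the family $\{(X^n_{T_n+\varepsilon t})_{t\in[0,1]}\}_\varepsilon$ satisfies a large deviation principle on $C([0,1])$ as $\varepsilon\to0$, with inverse speed $\varepsilon^2$ and good rate function $$J_n(h)=\begin{cases}\frac12\|h-x_n\|^2_{\bar{\mathscr H}_n}&\text{if }h_0=x_n\text{ and }h-x_n\in\bar{\mathscr H}_n,\\+\infty&\text{otherwise,}\end{cases}$$ where $\bar{\mathscr H}_n$ is the reproducing kernel Hilbert space associated to the covariance function $$\bar k_n(t,s)=a_n^2\,ts,\qquad a_n^2=\kappa(T_n,T_n)-\sum_{j=1}^n\frac{d_{j-1}(T_j)^2}{k_{j-1}(T_j,T_j)},$$ and $d_{j-1}(T)$ is defined recursively by $d_0(T)=\int_0^T\kappa(T_n,u)\,du$ and, for $i=1,\dots,n-1$, $$d_i(T)=d_{i-1}(T)-\alpha_i(T)\,d_{i-1}(T_i).$$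
   Context: The integrated process $X=(X_t)_{t\ge0}$ is a continuous centered Gaussian process with covariance $k(t,s)=\int_0^t\int_0^s\kappa(u,v)\,du\,dv$. Fix $n\ge1$, times $0<T_1<\dots<T_n$ and real numbers $x_1,\dots,x_n$. Set $X^0=X$, $k_0=k$ and, for $j=1,\dots,n$, $$\alpha_j(t)=\frac{k_{j-1}(t,T_j)}{k_{j-1}(T_j,T_j)},\qquad X^j_t=X^{j-1}_t-\alpha_j(t)(X^{j-1}_{T_j}-x_j),\qquad k_j(t,s)=k_{j-1}(t,s)-\alpha_j(t)k_{j-1}(s,T_j),$$ where it is assumed that $k_{j-1}(T_j,T_j)>0$. Then $k_j$ is the covariance function of $X^j$, and $X^n$ (the $n$-fold conditional process) has the law of $X$ conditioned on $X_{T_1}=x_1,\dots,X_{T_n}=x_n$. $C([0,1])$ is the space of continuous real paths on $[0,1]$ with the sup-norm; $x_n$ also denotes the constant path. A family $\{U^\varepsilon\}_\varepsilon$ of $C([0,1])$-valued random variables satisfies a large deviation principle with inverse speed $\gamma_\varepsilon^2$ and good rate function $I$ if $\gamma_\varepsilon\to0$, the set $\{I\le a\}$ is compact for every real $a$, $\liminf_{\varepsilon\to0}\gamma_\varepsilon^2\log\mathbb P(U^\varepsilon\in G)\ge-\inf_GI$ for every open $G$, and $\limsup_{\varepsilon\to0}\gamma_\varepsilon^2\log\mathbb P(U^\varepsilon\in F)\le-\inf_FI$ for every closed $F$. The reproducing kernel Hilbert space of a continuous, symmetric, positive (semi)definite kernel $q$ on $[0,1]^2$ is the completion, inside $C([0,1])$,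 of the paths $h_t=\int_0^1q(t,s)\lambda(ds)$, $\lambda$ a signed Borel measure on $[0,1]$, with $\|h\|^2=\int_0^1\int_0^1q(t,s)\lambda(dt)\lambda(ds)$. *)

(* Defs.v *)
(* Built on MathComp-Analysis, over an arbitrary [R : realType]. *)
From HB Require Import structures.
From mathcomp Require Import all_boot all_order all_algebra.
From mathcomp Require Import all_classical all_reals all_analysis.

Set Implicit Arguments.
Unset Strict Implicit.
Unset Printing Implicit Defensive.

Import Order.TTheory GRing.Theory Num.Theory.
Import numFieldNormedType.Exports.

Local Open Scope classical_set_scope.
Local Open Scope ring_scope.

(* * The space C([0,1]) *)

Notation I01 R := (set_type `[(0 : R), (1 : R)]%classic).

Definition C01 (R : realType) : Type := continuousType (I01 R) R.
HB.instance Definition _ (R : realType) := Choice.on (C01 R).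
(* The sup-norm topology, induced by uniform convergence on [I01 R]. *)
HB.instance Definition _ (R : realType) := PseudoMetric.copy (C01 R)
  (initial_topology
     (fun f : C01 R => (f : I01 R -> R) : arrow_uniform_type (I01 R) R)).

Lemma zero01_subproof (R : realType) : (0 : R) \in `[(0 : R), (1 : R)]%classic.
Proof. by rewrite inE /= in_itv /= lexx ler01. Qed.

Definition zero01 (R : realType) : I01 R := exist _ 0 (zero01_subproof R).

Section C01_constructions.
Context {R : realType}.

Definition mk_C01 (f : I01 R -> R) (cf : continuous f) : C01 R :=
  HB.pack f (isContinuous.Build (I01 R) R f cf).

Lemma sub_cst_continuous (h : C01 R) (c : R) :
  continuous (fun t : I01 R => h t - c).
Proof.
move=> t; have ht : {for t, continuous h} by exact: (@cts_fun _ _ h t).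
exact: (cvgB ht (cvg_cst c)).
Qed.

(* h - c, where c also denotes the constant path *)
Definition sub_cst (h : C01 R) (c : R) : C01 R :=
  mk_C01 (@sub_cst_continuous h c).

Lemma cst01_continuous (c : R) : continuous (fun _ : I01 R => c).
Proof. exact: cst_continuous. Qed.

Lemma restr01_continuous (f : R -> R) :
  {within `[0, 1], continuous f} -> continuous (fun t : I01 R => f (\val t)).
Proof. by move=> /subspace_sigL_continuousP. Qed.

(* The restriction of f to [0,1] if f is continuous there; the zero path is a
   junk value otherwise. *)
Definition to_C01 (f : R -> R) : C01 R :=
  match pselect {within `[0, 1], continuous f} with
  | left cf => mk_C01 (restr01_continuous cf)
  | right _ => mk_C01 (@cst01_continuous 0)
  end.

End C01_constructions.

(* * Large deviation principles *)

(* "U e" only matters for e > 0.  The first clause says that the U e are random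
   variables for the Borel sigma-algebra of E. *)
Definition satisfies_LDP (R : realType) (d : measure_display)
    (Omega : measurableType d) (P : probability Omega R) (E : topologicalType)
    (U : R -> Omega -> E) (gamma : R -> R) (I : E -> \bar R) : Prop :=
  [/\ forall e (G : set E), 0 < e -> open G -> measurable (U e @^-1` G),
      gamma e @[e --> 0^'+] --> 0,
      forall a : R, compact [set h | (I h <= a%:E)%E],
      forall G : set E, open G ->
        (- ereal_inf (I @` G) <=
         limf_einf (fun e => (gamma e ^+ 2)%:E * lne (P (U e @^-1` G))) 0^'+)%E
    & forall F : set E, closed F ->
        (limf_esup (fun e => (gamma e ^+ 2)%:E * lne (P (U e @^-1` F))) 0^'+ <=
         - ereal_inf (I @` F))%E ].

(* * Reproducing kernel Hilbert spaces of kernels on [0,1]^2 *)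

Section rkhs.
Context {R : realType}.
Local Notation signed_measure := (charge (measurableTypeR R) R).

Definition hahn_pos (nu : signed_measure) : set (measurableTypeR R) :=
  sval (cid (Hahn_decomposition nu)).

Definition hahn_neg (nu : signed_measure) : set (measurableTypeR R) :=
  sval (cid (svalP (cid (Hahn_decomposition nu)))).

Lemma hahn_pos_neg (nu : signed_measure) :
  hahn_decomposition nu (hahn_pos nu) (hahn_neg nu).
Proof. exact: svalP (cid (svalP (cid (Hahn_decomposition nu)))). Qed.

(* The integral of f over [0,1] with respect to a signed measure, through its
   Jordan decomposition.  Signed Borel measures on [0,1] are represented by
   charges on R, of which only the restriction to [0,1] is used. *)
Definition integral01 (nu : signed_measure) (f : R -> R) : R :=
  \int[jordan_pos (hahn_pos_neg nu)]_(t in `[0, 1]) f t -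
  \int[jordan_neg (hahn_pos_neg nu)]_(t in `[0, 1]) f t.

Definition potential (q : R -> R -> R) (lam : signed_measure) (t : I01 R) : R :=
  integral01 lam (fun s => q (\val t) s).

Definition energy (q : R -> R -> R) (lam : signed_measure) : R :=
  integral01 lam (fun s => integral01 lam (fun t => q t s)).

(* h belongs to the completion, with squared norm r: h is the uniform limit of
   a sequence of potentials that is Cauchy for the norm of the kernel, and r is
   the limit of the squared norms. *)
Definition is_rkhs_sqnorm (q : R -> R -> R) (h : C01 R) (r : R) : Prop :=
  exists lam : nat -> signed_measure,
    [/\ forall e : R, 0 < e -> exists N : nat, forall m p : nat,
          (N <= m)%N -> (N <= p)%N ->
          energy q (cadd (lam m) (copp (lam p))) < e,
        {uniform, (fun m => potential q (lam m)) @ \oo --> (h : I01 R -> R)}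
      & energy q (lam m) @[m --> \oo] --> r ].

Definition rkhs (q : R -> R -> R) : set (C01 R) :=
  [set h | exists r, is_rkhs_sqnorm q h r].

Definition rkhs_sqnorm (q : R -> R -> R) (h : C01 R) : R :=
  xget 0 [set r | is_rkhs_sqnorm q h r].

Definition rkhs_rate (q : R -> R -> R) (x : R) (h : C01 R) : \bar R :=
  if `[< h (zero01 R) = x /\ rkhs q (sub_cst h x) >]
  then (2^-1 * rkhs_sqnorm q (sub_cst h x))%:E else +oo%E.

End rkhs.

(* * Gaussian processes indexed by [0, +oo[ *)

Section processes.
Context {R : realType} {d : measure_display} {Omega : measurableType d}.
Variable P : probability Omega R.

(* [normal_prob 0 0] is not the Dirac mass at 0 in the library. *)
Definition centered_normal (sigma : R) (A : set R) : \bar R :=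
  if sigma == 0 then \d_(0 : R) A else normal_prob 0 sigma A.

Definition centered_gaussian_process (Z : R -> {RV P >-> R}) : Prop :=
  forall (m : nat) (t c : 'I_m -> R), (forall i, 0 <= t i) ->
    exists sigma : R, forall A : set R, measurable A ->
      P ((fun w => \sum_(i < m) c i * Z (t i) w) @^-1` A) =
      centered_normal sigma A.

Definition has_covariance (Z : R -> {RV P >-> R}) (kappa : R -> R -> R) :
    Prop :=
  forall t s, 0 <= t -> 0 <= s -> covariance P (Z t) (Z s) = (kappa t s)%:E.

Definition jointly_measurable (Z : R -> {RV P >-> R}) : Prop :=
  measurable_fun [set p : measurableTypeR R * Omega | 0 <= p.1]
    (fun p => Z p.1 p.2).

Definition continuous_paths (X : R -> {RV P >-> R}) : Prop :=
  forall w, {within `[0, +oo[, continuous (fun t => X t w)}.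

Definition integrated_process (Z X : R -> {RV P >-> R}) : Prop :=
  forall t, 0 <= t ->
    {ae P, forall w, X t w = \int[lebesgue_measure]_(u in `[0, t]) Z u w}.

End processes.

(* * Successive conditioning.  The times T and values x are sequences of which
     only the terms of index 1, ..., n are used. *)

Section conditioning.
Context {R : realType}.
Variables (kappa : R -> R -> R) (T : nat -> R).

Definition integrated_kernel (t s : R) : R :=
  \int[lebesgue_measure]_(u in `[0, t])
    \int[lebesgue_measure]_(v in `[0, s]) kappa u v.

Fixpoint cond_kernel (j : nat) (t s : R) : R :=
  match j with
  | 0%N => integrated_kernel t s
  | i.+1 => cond_kernel i t s -
      cond_kernel i t (T i.+1) / cond_kernel i (T i.+1) (T i.+1) *
      cond_kernel i s (T i.+1)
  end.

Definition alpha (j : nat) (t : R) : R :=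
  cond_kernel j.-1 t (T j) / cond_kernel j.-1 (T j) (T j).

Fixpoint cond_process (Omega : Type) (X : R -> Omega -> R) (x : nat -> R)
    (j : nat) (t : R) (w : Omega) : R :=
  match j with
  | 0%N => X t w
  | i.+1 => cond_process X x i t w -
      alpha i.+1 t * (cond_process X x i (T i.+1) w - x i.+1)
  end.

Fixpoint dcoef (n i : nat) (t : R) : R :=
  match i with
  | 0%N => \int[lebesgue_measure]_(u in `[0, t]) kappa (T n) u
  | j.+1 => dcoef n j t - alpha j.+1 t * dcoef n j (T j.+1)
  end.

Definition asq (n : nat) : R :=
  kappa (T n) (T n) -
  \sum_(1 <= j < n.+1)
    dcoef n j.-1 (T j) ^+ 2 / cond_kernel j.-1 (T j) (T j).

Definition kbar (n : nat) (t s : R) : R := asq n * (t * s).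

End conditioning.

(* Main.v *)
(* Since [X^n] takes the value [x_n] at [T_n],
     X^n_{T_n + e t} - x_n = (X_{T_n + e t} - X_{T_n})
       - sum_j (alpha_j(T_n + e t) - alpha_j(T_n)) (X^{j-1}_{T_j} - x_j).
   Replacing [X_{T_n + e t} - X_{T_n}] by [e t Z_{T_n}], the increments of
   [alpha_j] by [e t beta_j], with [beta_j] the right derivative at [T_n], and
   the integrals [X^{j-1}_{T_j}] by Riemann sums yields a line [e t D], where
   [D] is a finite combination of values of [Z] and hence exactly normal; its
   variance tends to [a_n^2], by orthogonality of the [X^{j-1}_{T_j}].  The
   error is at most [delta] outside an event of probability
   [C exp (- K / e^2)], for any [K] and [delta]: Markov's inequality applied to
   the integral of [exp (theta (Z_u - Z_p)^2)] controls the paths, so that the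
   normality of [X] itself is never needed.  The explicit normal estimates for
   [e D] then give the large deviation principle with rate [c^2 / (2 a_n^2)] on
   the lines [x_n + c t]; this is the stated rate, because every potential of
   the kernel [v t s] is a multiple of [t]. *)
From HB Require Import structures.
Require Import Defs.
From mathcomp Require Import all_boot all_order all_algebra.
From mathcomp Require Import all_classical all_reals all_analysis.
From mathcomp Require Import measurable_realfun.
From mathcomp Require Import ring lra.

Set Implicit Arguments.
Unset Strict Implicit.
Unset Printing Implicit Defensive.

Import Order.TTheory GRing.Theory Num.Theory.
Import numFieldNormedType.Exports.

Local Open Scope classical_set_scope.
Local Open Scope ring_scope.

(** * Normal laws *)

(** The error bound rests on a separation of scales. For a normal variable of variance at most
    [s^2], exceeding the level [m = 2 s (K + 1) / e] costs [exp (- (K + 1)^2 / e^2)] up to a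
    constant; such errors enter the rescaled path multiplied by [e], hence with size proportional to
    [2 s (K + 1)], free of [e]. So [delta] is reached by making [s] small, through a short time
    interval after [T_n] or a fine Riemann mesh, and the mesh is fixed before [e]. This is why [D]
    depends on [K] and [delta], and why its variance is only close to [a_n^2]. The integral
    representation of [X] holds almost surely at each separate time, and integrability of the paths
    of [Z] has to be proved; both are recovered outside small events. When [a_n^2 = 0] the laws of
    the approximations may be Dirac masses, so no density bound is available: the lower bound then
    comes from the upper tail, and [c^2 / (2 a_n^2)] is read with the inverse of 0 equal to 0. *)

Section normal.
Context {R : realType}.
Local Notation mu := (@lebesgue_measure R).

(** Change of variables is known for the Radon-Nikodym derivative of [normal_prob m s]; the
    derivative and the density agree almost everywhere because they have the same integral over
    every measurable set. *)
Lemma ge0_integral_normal_prob (m s : R) (f : R -> \bar R) :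
  (forall x, 0 <= f x)%E -> measurable_fun [set: R] f ->
  (\int[normal_prob m s]_x f x = \int[mu]_x (f x * (normal_pdf m s x)%:E))%E.
Proof.
move=> f0 mf.
have dom := @normal_prob_dominates R m s.
have mpdf : measurable_fun [set: R] (EFin \o normal_pdf m s).
  by apply/measurable_EFinP; exact: measurable_normal_pdf.
rewrite -(Radon_Nikodym_SigmaFinite.change_of_variables dom)//.
have mfi : measurable_fun [set: R]
    (Radon_Nikodym_SigmaFinite.f (normal_prob m s) mu).
  apply: (measurable_int mu).
  exact: Radon_Nikodym_SigmaFinite.f_integrable.
apply: ae_eq_integral => //.
- exact: emeasurable_funM.
- exact: emeasurable_funM.
- apply: ae_eqe_mul2l; apply: integral_ae_eq => //.
  + exact: Radon_Nikodym_SigmaFinite.f_integrable.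
  + by move=> A _ mA; rewrite -Radon_Nikodym_SigmaFinite.f_integral.
Qed.

(** The exponential factor multiplies the inverse variance by [r], which leaves a normal density of
    deviation [s / sqrt r] and the ratio of the two peaks. Values [r > 1] are allowed and are used
    to compute the variance. *)
Lemma normal_pdf_exp_sqr (s r x : R) : s != 0 -> 0 < r ->
  expR ((1 - r) * x ^+ 2 / (2 * s ^+ 2)) * normal_pdf 0 s x =
  (Num.sqrt r)^-1 * normal_pdf 0 (s / Num.sqrt r) x.
Proof.
move=> s0 r0.
have sr0 : Num.sqrt r != 0 by rewrite gt_eqF// sqrtr_gt0.
have r_neq0 : r != 0 by rewrite gt_eqF.
rewrite !normal_pdfE ?mulf_neq0 ?invr_eq0// /normal_peak /normal_fun.
rewrite mulrCA -expRD [RHS]mulrA; congr (_ * expR _).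
  rewrite exprMn exprVn sqr_sqrtr ?(ltW r0)//.
  have -> : s ^+ 2 / r * pi *+ 2 = (s ^+ 2 * pi *+ 2) / r.
    by field.
  rewrite sqrtrM; last by rewrite mulrn_wge0// mulr_ge0 ?sqr_ge0 ?pi_ge0.
  by rewrite sqrtrV ?(ltW r0)// invfM invrK mulrCA mulVf ?mulr1.
rewrite subr0 exprMn exprVn sqr_sqrtr ?(ltW r0)//.
by field; apply/andP; split.
Qed.

Lemma integral_normal_exp_sqr (s r : R) : s != 0 -> 0 < r ->
  (\int[normal_prob 0 s]_x (expR ((1 - r) * x ^+ 2 / (2 * s ^+ 2)))%:E =
   (Num.sqrt r)^-1%:E)%E.
Proof.
move=> s0 r0; rewrite ge0_integral_normal_prob//; last first.
  apply/measurable_EFinP; apply: measurableT_comp => //.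
  by apply: measurable_funM => //; apply: measurable_funM.
under eq_integral do rewrite -EFinM normal_pdf_exp_sqr// EFinM.
rewrite ge0_integralZl//; first by rewrite integral_normal_pdf mule1.
- by apply/measurable_EFinP; exact: measurable_normal_pdf.
- by move=> x _; rewrite lee_fin normal_pdf_ge0.
Qed.

Lemma integral_normal_expM (s t : R) : s != 0 ->
  (\int[normal_prob 0 s]_x (expR (t * x))%:E =
   (expR (t ^+ 2 * s ^+ 2 / 2))%:E)%E.
Proof.
move=> s0; rewrite ge0_integral_normal_prob//; last first.
  by apply/measurable_EFinP; apply: measurableT_comp => //; apply: measurable_funM.
under eq_integral => x _.
  (* Completing the square moves the mean to [t s^2]. *)
  rewrite -EFinM (_ : expR (t * x) * normal_pdf 0 s x =
    expR (t ^+ 2 * s ^+ 2 / 2) * normal_pdf (t * s ^+ 2) s x); last first.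
    rewrite !normal_pdfE// /normal_fun mulrCA -expRD [RHS]mulrCA -expRD.
    by congr (_ * expR _); field.
  rewrite EFinM; over.
rewrite ge0_integralZl//; first by rewrite integral_normal_pdf mule1.
- by apply/measurable_EFinP; exact: measurable_normal_pdf.
- by move=> x _; rewrite lee_fin normal_pdf_ge0.
Qed.

End normal.

Section centered_normal_law.
Context {R : realType} {d : measure_display} {Omega : measurableType d}.
Variable P : probability Omega R.

Definition normal_law (D : Omega -> R) (s : R) : Prop :=
  measurable_fun [set: Omega] D /\
  forall A : set R, measurable A -> P (D @^-1` A) = centered_normal s A.

Lemma ge0_integral_normal_law (D : Omega -> R) (s : R) (f : R -> \bar R) :
  normal_law D s -> s != 0 ->
  (forall x, 0 <= f x)%E -> measurable_fun [set: R] f ->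
  (\int[P]_w f (D w) = \int[normal_prob 0 s]_x f x)%E.
Proof.
move=> [mD lawD] s0 f0 mf.
have mD' : @measurable_fun _ _ Omega (measurableTypeR R) setT D by exact: mD.
pose D' : {mfun Omega >-> measurableTypeR R} :=
  HB.pack_for {mfun Omega >-> measurableTypeR R} D
  (isMeasurableFun.Build _ _ Omega (measurableTypeR R) D mD').
rewrite -(@ge0_integral_distribution _ _ _ _ _ P D' f mf f0).
apply: eq_measure_integral => A mA _ /=.
by rewrite /distribution /pushforward lawD// /centered_normal (negbTE s0).
Qed.

Lemma normal_law0 (D : Omega -> R) (f : R -> \bar R) :
  normal_law D 0 -> measurable_fun [set: R] f ->
  (\int[P]_w f (D w) = f 0%R)%E.
Proof.
move=> [mD lawD] mf.
have D0 : P [set w | D w <> 0] = 0%E.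
  have := lawD (~` [set 0]) (measurableC (measurable_set1 0)).
  by rewrite /centered_normal eqxx diracE memNset//= => -> //.
rewrite -[RHS]mul1e -[in RHS](@probability_setT _ _ _ P) muleC -integral_cst//.
apply: ae_eq_integral => //.
- exact: measurableT_comp.
- exists [set w | D w <> 0]; split => //.
    rewrite (_ : [set _ | _] = D @^-1` (~` [set 0]))//.
    by rewrite -[X in measurable X]setTI; apply: mD => //; exact: measurableC.
  by move=> w /= + Dw; apply => _; rewrite Dw.
Qed.

End centered_normal_law.

(** * Upper and lower estimates for centered normal laws *)

Section gaussian_tail.
Context {R : realType} {d : measure_display} {Omega : measurableType d}.
Variable P : probability Omega R.

Lemma ge0_markov (f : Omega -> \bar R) (c : R) : 0 < c ->
  measurable_fun [set: Omega] f -> (forall w, 0 <= f w)%E ->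
  (P [set w | c%:E <= f w] <= c^-1%:E * \int[P]_w f w)%E.
Proof.
move=> c0 mf f0.
have mA : measurable [set w | (c%:E <= f w)%E].
  by rewrite -[X in measurable X]setTI; exact: emeasurable_fun_c_infty.
rewrite lee_pdivlMl// -integral_cst//.
apply: (@le_trans _ _ (\int[P]_(w in [set w | (c%:E <= f w)%E]) f w)%E).
  by apply: ge0_le_integral => //=; [move=> w _; rewrite lee_fin ltW|exact: measurable_funTS].
exact: ge0_subset_integral.
Qed.

(** The exact value is known when the deviation is [s]; a larger [s] only lowers the integrand, and
    [sigma = 0] gives 1. The bound is thus uniform over all [sigma] up to [s], degenerate case
    included. *)
Lemma normal_law_exp_sqr (D : Omega -> R) (sigma s r : R) :
  normal_law P D sigma -> sigma ^+ 2 <= s ^+ 2 -> 0 < s -> 0 < r <= 1 ->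
  (\int[P]_w (expR ((1 - r) * D w ^+ 2 / (2 * s ^+ 2)))%:E <=
   (Num.sqrt r)^-1%:E)%E.
Proof.
move=> lawD sigs s0 /andP[r0 r1].
pose g x := (expR ((1 - r) * x ^+ 2 / (2 * s ^+ 2)))%:E : \bar R.
have mg s' : measurable_fun [set: R] (fun x => (expR ((1 - r) * x ^+ 2 / (2 * s' ^+ 2)))%:E).
  apply/measurable_EFinP; apply: measurableT_comp => //.
  by apply: measurable_funM => //; apply: measurable_funM.
have [sigma0|sigma0] := eqVneq sigma 0.
  rewrite sigma0 in lawD; rewrite (normal_law0 lawD (mg s)).
  rewrite expr0n mulr0 mul0r expR0 lee_fin invf_ge1 ?sqrtr_gt0//.
  by rewrite -sqrtr1 ler_sqrt.
rewrite (ge0_integral_normal_law (f:=g) lawD)//; first last.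
- exact: mg.
- by move=> x; rewrite lee_fin expR_ge0.
rewrite -(integral_normal_exp_sqr sigma0 r0).
have sq0 : 0 < sigma ^+ 2 by rewrite exprn_even_gt0.
apply: ge0_le_integral => //=.
- by move=> x _; rewrite lee_fin expR_ge0.
- exact: mg.
- exact: mg.
move=> x _; rewrite lee_fin ler_expR; apply: ler_wpM2l.
  by rewrite mulr_ge0 ?sqr_ge0// subr_ge0.
have ss0 : 0 < s ^+ 2 by rewrite exprn_gt0.
by rewrite lef_pV2 ?posrE; lra.
Qed.

(** Markov's inequality for the exponential of the square. The exponent loses only the factor
    [1 - r], and [r] may be taken as small as the upper bound of the large deviation principle
    requires. *)
Lemma normal_tail (D : Omega -> R) (sigma s r y : R) :
  normal_law P D sigma -> sigma ^+ 2 <= s ^+ 2 -> 0 < s -> 0 < r <= 1 ->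
  0 <= y ->
  (P [set w | (y <= `|D w|)%R] <=
   ((Num.sqrt r)^-1 * expR (- ((1 - r) * y ^+ 2 / (2 * s ^+ 2))))%:E)%E.
Proof.
move=> lawD sigs s0 r01 y0; have /andP[r0 r1] := r01.
pose f w := (expR ((1 - r) * D w ^+ 2 / (2 * s ^+ 2)))%:E : \bar R.
have mf : measurable_fun [set: Omega] f.
  apply/measurable_EFinP; apply: measurableT_comp => //.
  apply: measurable_funM => //; apply: measurable_funM => //.
  by apply: measurable_funX; exact: lawD.1.
have mA : measurable [set w | y <= `|D w| ].
  rewrite -[X in measurable X]setTI; apply: measurable_fun_le => //.
  by apply: measurableT_comp => //; exact: lawD.1.
pose c := expR ((1 - r) * y ^+ 2 / (2 * s ^+ 2)).
apply: (@le_trans _ _ (P [set w | (c%:E <= f w)%E])).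
  apply: le_measure; rewrite ?inE//.
    by rewrite -[X in measurable X]setTI; exact: emeasurable_fun_c_infty.
  move=> w /= yD; rewrite lee_fin ler_expR ler_wpM2r//.
    by rewrite invr_ge0 mulr_ge0// sqr_ge0.
  rewrite ler_wpM2l ?subr_ge0// -[leRHS]real_normK ?num_real//.
  by rewrite ler_sqr ?nnegrE.
apply: (le_trans (@ge0_markov f c _ _ _)) => //; first exact: expR_gt0.
  by move=> w; rewrite lee_fin expR_ge0.
rewrite expRN mulrC EFinM; apply: lee_wpmul2l; first by rewrite lee_fin invr_ge0 expR_ge0.
exact: (normal_law_exp_sqr lawD).
Qed.

(** On the interval the density is at least its value at [|c| + eta], the largest possible modulus
    there. *)
Lemma normal_law_interval (D : Omega -> R) (sigma c eta : R) :
  normal_law P D sigma -> sigma != 0 -> 0 < eta ->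
  ((2 * eta * normal_peak sigma *
     expR (- ((`|c| + eta) ^+ 2 / (2 * sigma ^+ 2))))%:E <=
   P [set w | (`|D w - c| < eta)%R])%E.
Proof.
move=> [mD lawD] sigma0 eta0.
rewrite (_ : [set w | _] = D @^-1` `]c - eta, c + eta[%classic); last first.
  by apply/seteqP; split => w /=; rewrite in_itv/= ltr_distl.
rewrite lawD// /centered_normal (negbTE sigma0) /normal_prob.
have mpdf : measurable_fun [set: R] (EFin \o normal_pdf 0 sigma).
  by apply/measurable_EFinP; exact: measurable_normal_pdf.
set k := normal_peak sigma * expR (- ((`|c| + eta) ^+ 2 / (2 * sigma ^+ 2))).
apply: (@le_trans _ _ (\int[lebesgue_measure]_(x in `](c - eta)%R, (c + eta)%R[) k%:E)%E).
  rewrite integral_cst//= lebesgue_measure_itv/= lte_fin ifT; last by lra.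
  by rewrite -EFinD -EFinM lee_fin /k; lra.
have key (x : R) : `|x - c| < eta -> x ^+ 2 <= (`|c| + eta) ^+ 2.
  move=> xc; rewrite -[leLHS]real_normK ?num_real// ler_sqr ?nnegrE ?addr_ge0 ?(ltW eta0)//.
  by rewrite -[x in `|x|](subrK c) addrC (le_trans (ler_normD _ _))// lerD2l ltW.
have k0 : 0 <= k by rewrite mulr_ge0 ?normal_peak_ge0 ?expR_ge0.
apply: ge0_le_integral => //=.
- by apply: measurable_funTS; exact: mpdf.
move=> x; rewrite in_itv/= => /andP[x1 x2].
rewrite lee_fin normal_pdfE// /k; apply: ler_wpM2l; first exact: normal_peak_ge0.
rewrite /normal_fun ler_expR subr0 mulNr lerN2.
rewrite -mulr_natl; apply: ler_wpM2r.
  by rewrite invr_ge0 mulr_ge0 ?sqr_ge0.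
by apply: key; rewrite ltr_distl x1 x2.
Qed.

End gaussian_tail.

(** * Mean and variance of centered normal laws *)

Section gaussian_moments.
Context {R : realType} {d : measure_display} {Omega : measurableType d}.
Variable P : probability Omega R.

Lemma integrable_sqr_prob (f : Omega -> R) : measurable_fun [set: Omega] f ->
  P.-integrable [set: Omega] (fun w => (f w ^+ 2)%:E) ->
  P.-integrable [set: Omega] (EFin \o f).
Proof.
move=> mf if2.
have i1 : P.-integrable [set: Omega] (EFin \o cst 1).
  exact: finite_measure_integrable_cst.
apply: le_integrable (integrableD _ i1 if2) => //.
  exact/measurable_EFinP.
move=> w _ /=; rewrite lee_fin [leRHS]ger0_norm ?addr_ge0 ?sqr_ge0//.
rewrite -[X in 1 + X]real_normK ?num_real//.
by have := sqr_ge0 (`|f w| - 1 / 2); lra.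
Qed.

Lemma normal_law_expR_sqr (D : Omega -> R) (s u : R) :
  normal_law P D s -> s != 0 -> 0 < u ->
  (\int[P]_w (expR ((1 - u ^+ 2) / (2 * s ^+ 2) * D w ^+ 2))%:E = u^-1%:E)%E.
Proof.
move=> lawD s0 u0.
pose g x := (expR ((1 - u ^+ 2) * x ^+ 2 / (2 * s ^+ 2)))%:E : \bar R.
transitivity (\int[P]_w g (D w))%E.
  by apply: eq_integral => w _; rewrite /g mulrAC.
rewrite (ge0_integral_normal_law (f:=g) lawD)//; last 2 first.
- by move=> x; rewrite lee_fin expR_ge0.
- apply/measurable_EFinP; apply: measurableT_comp => //.
  by apply: measurable_funM => //; apply: measurable_funM.
rewrite integral_normal_exp_sqr ?exprn_gt0//.
by rewrite sqrtr_sqr gtr0_norm.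
Qed.

(* By letting [u] tend to 1 from both sides. *)
Lemma eq1_of_sqr_bound (Q : R) : (forall u, 0 < u -> (1 - u ^+ 2) * Q <= 2 * (u^-1 - 1)) ->
  Q = 1.
Proof.
move=> H.
have H' u : 0 < u -> (1 - u ^+ 2) * (u * Q) <= 2 * (1 - u).
  move=> u0; have := H u u0; rewrite -(ler_pM2l u0).
  by rewrite mulrCA [leRHS]mulrCA mulrBr divff ?gt_eqF// mulr1.
apply/eqP; rewrite eq_le; apply/andP; split.
- rewrite leNgt; apply/negP => Q1.
  (* At [u = 1 - e] the bound, divided by [e], reads [2 Q - 3 e Q + e^2 Q <= 2]. This [e] makes
     [3 e Q = Q - 1], hence [Q + 1 + e^2 Q <= 2], contradicting [Q > 1]. *)
  pose e := (Q - 1) / (3 * Q).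
  have Q0 : 0 < 3 * Q by lra.
  have e0 : 0 < e by rewrite divr_gt0//; lra.
  have eQ : e * Q = (Q - 1) / 3 by rewrite /e; field; rewrite gt_eqF//; lra.
  have e1 : e < 1 by rewrite /e ltr_pdivrMr//; lra.
  have := H' (1 - e) _; rewrite subr_gt0 => /(_ e1).
  rewrite (_ : (1 - _ ^+ 2) * _ = e * ((2 * Q - 3 * (e * Q)) + e * (e * Q))); last by ring.
  rewrite (_ : 2 * (1 - (1 - e)) = e * 2); last by ring.
  rewrite ler_pM2l// eQ => h.
  have : 0 < e * ((Q - 1) / 3) by rewrite mulr_gt0//; lra.
  by lra.
- rewrite leNgt; apply/negP => Q1.
  have [Q0|Q0] := leP Q 0.
    have := H 2 ltac:(lra).
    by lra.
  (* At [u = 1 + e] the bound gives [2 <= 2 Q + 3 e Q + e^2 Q <= 2 Q + 4 e = Q + 1], contradicting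
     [Q < 1]. *)
  pose e := (1 - Q) / 4.
  have e0 : 0 < e by rewrite /e; lra.
  have := H' (1 + e) ltac:(lra).
  rewrite (_ : (1 - _ ^+ 2) * _ = e * - ((2 * Q + 3 * (e * Q)) + e * (e * Q))); last by ring.
  rewrite (_ : 2 * (1 - (1 + e)) = e * (- 2)); last by ring.
  rewrite ler_pM2l// /e => h.
  have e2 : e * (e * Q) <= e * Q.
    by rewrite ler_piMl ?mulr_ge0 ?(ltW e0) ?(ltW Q0)// /e; lra.
  have : e * Q <= e by rewrite ler_piMr//; lra.
  rewrite /e in e2 h * => h2.
  by lra.
Qed.

Lemma normal_law_integrable_sqr (D : Omega -> R) (s : R) : normal_law P D s ->
  P.-integrable [set: Omega] (fun w => (D w ^+ 2)%:E).
Proof.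
move=> lawD; have mD := lawD.1.
have [s0|s0] := eqVneq s 0.
  rewrite s0 in lawD; apply/integrableP; split.
    by apply/measurable_EFinP; exact: measurable_funX.
  have := @normal_law0 _ _ _ _ D (fun x => `|x ^+ 2|%:E) lawD.
  rewrite expr0n normr0/= => ->; first by rewrite ltry.
  by apply/measurable_EFinP; apply: measurableT_comp.
have s2 : 0 < s ^+ 2 by rewrite exprn_even_gt0.
pose k := (1 - 2^-1 ^+ 2) / (2 * s ^+ 2).
have k0 : 0 < k.
  rewrite /k (_ : 1 - 2^-1 ^+ 2 = 3 / 4); last by field.
  by apply: divr_gt0; [rewrite divr_gt0|rewrite mulr_gt0].
have h := normal_law_expR_sqr lawD s0 (ltac:(lra) : (0:R) < 2^-1).
have iE : P.-integrable [set: Omega]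
    (fun w => k^-1%:E * (expR (k * D w ^+ 2))%:E)%E.
  apply: integrableZl => //; apply/integrableP; split.
    apply/measurable_EFinP; apply: measurableT_comp => //.
    by apply: measurable_funM => //; exact: measurable_funX.
  under eq_integral do rewrite gee0_abs ?lee_fin ?expR_ge0//.
  by rewrite h ltry.
apply: le_integrable iE => //.
  by apply/measurable_EFinP; exact: measurable_funX.
move=> w _ /=; rewrite lee_fin ger0_norm ?sqr_ge0//.
rewrite ger0_norm ?mulr_ge0 ?expR_ge0 ?invr_ge0 ?(ltW k0)//.
rewrite -ler_pdivrMl ?invr_gt0// invrK.
by rewrite (le_trans _ (expR_ge1Dx _))// lerDr.
Qed.

(** Integrating [1 + k D^2 <= exp (k D^2)], whose right side has integral [1 / u], bounds the second
    moment for each [u > 0]. Since [k] changes sign at [u = 1], these bounds together determine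
    it. *)
Lemma normal_law_sqr (D : Omega -> R) (s : R) : normal_law P D s ->
  \int[P]_w (D w ^+ 2) = s ^+ 2.
Proof.
move=> lawD; have mD := lawD.1.
have isqr := normal_law_integrable_sqr lawD.
have [s0|s0] := eqVneq s 0.
  rewrite s0 in lawD *; rewrite /Rintegral.
  rewrite (@normal_law0 _ _ _ _ D (fun x => (x ^+ 2)%:E) lawD)//.
  by apply/measurable_EFinP; exact: exprn_measurable.
have s2 : 0 < s ^+ 2 by rewrite exprn_even_gt0.
set q := \int[P]_w (D w ^+ 2).
suff qs : q / s ^+ 2 = 1 by rewrite -[LHS](divfK (lt0r_neq0 s2)) qs mul1r.
apply: eq1_of_sqr_bound => u u0.
set k := (1 - u ^+ 2) / (2 * s ^+ 2).
have h := normal_law_expR_sqr lawD s0 u0.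
have i1 : P.-integrable [set: Omega] (EFin \o cst 1).
  exact: finite_measure_integrable_cst.
have iE : P.-integrable [set: Omega] (EFin \o (fun w => expR (k * D w ^+ 2))).
  apply/integrableP; split.
    apply/measurable_EFinP; apply: measurableT_comp => //.
    by apply: measurable_funM => //; exact: measurable_funX.
  under eq_integral do rewrite gee0_abs ?lee_fin ?expR_ge0//.
  by rewrite h ltry.
have ik : P.-integrable [set: Omega] (EFin \o (fun w => k * D w ^+ 2)).
  exact: (@integrableZl _ _ _ _ _ _ k (fun w => (D w ^+ 2)%:E)).
have : \int[P]_w (cst 1 w + k * D w ^+ 2) <= \int[P]_w (expR (k * D w ^+ 2)).
  apply: le_Rintegral => //; first exact: (integrableD measurableT i1 ik).
  by move=> w _; exact: expR_ge1Dx.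
rewrite RintegralD// Rintegral_cst//= probability_setT mul1r RintegralZl//.
rewrite [X in _ <= X]/Rintegral h /= -/q.
rewrite /k => hh.
rewrite (_ : (1 - u ^+ 2) * (q / s ^+ 2) = 2 * ((1 - u ^+ 2) / (2 * s ^+ 2) * q)).
  by lra.
by field.
Qed.

Lemma normal_law_integrable (D : Omega -> R) (s : R) : normal_law P D s ->
  P.-integrable [set: Omega] (EFin \o D).
Proof.
move=> lawD.
exact: (integrable_sqr_prob lawD.1 (normal_law_integrable_sqr lawD)).
Qed.

(** Integrating [1 + t D <= exp (t D)] bounds [t m] by a quantity of order [t^2] for [t] of either
    sign, which forces [m = 0]. *)
Lemma normal_law_mean (D : Omega -> R) (s : R) : normal_law P D s ->
  \int[P]_w D w = 0.
Proof.
move=> lawD; have mD := lawD.1.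
have iD := normal_law_integrable lawD.
have [s0|s0] := eqVneq s 0.
  rewrite s0 in lawD *; rewrite /Rintegral.
  by rewrite (@normal_law0 _ _ _ _ D EFin lawD).
have s2 : 0 < s ^+ 2 by rewrite exprn_even_gt0.
set m := \int[P]_w D w.
have key t : t * m <= expR (t ^+ 2 * s ^+ 2 / 2) - 1.
  have h : (\int[P]_w (expR (t * D w))%:E = (expR (t ^+ 2 * s ^+ 2 / 2))%:E)%E.
    rewrite -(integral_normal_expM t s0).
    rewrite (ge0_integral_normal_law (f:=fun x => (expR (t * x))%:E) lawD)//.
    by apply/measurable_EFinP; apply: measurableT_comp => //; apply: measurable_funM.
  have i1 : P.-integrable [set: Omega] (EFin \o cst 1).
    exact: finite_measure_integrable_cst.
  have iE : P.-integrable [set: Omega] (EFin \o (fun w => expR (t * D w))).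
    apply/integrableP; split.
      apply/measurable_EFinP; apply: measurableT_comp => //.
      exact: measurable_funM.
    under eq_integral do rewrite gee0_abs ?lee_fin ?expR_ge0//.
    by rewrite h ltry.
  have ik : P.-integrable [set: Omega] (EFin \o (fun w => t * D w)).
    exact: (@integrableZl _ _ _ _ _ _ t (EFin \o D)).
  have : \int[P]_w (cst 1 w + t * D w) <= \int[P]_w (expR (t * D w)).
    apply: le_Rintegral => //; first exact: (integrableD measurableT i1 ik).
    by move=> w _; exact: expR_ge1Dx.
  rewrite RintegralD// Rintegral_cst//= probability_setT mul1r RintegralZl//.
  rewrite [X in _ <= X]/Rintegral h /= -/m; lra.
(* From [exp z - 1 <= z exp z], which is [1 - z <= exp (- z)] multiplied by [exp z]. *)
have key2 t : `|t| <= 1 -> t * m <= t ^+ 2 * (expR (s ^+ 2 / 2) * s ^+ 2 / 2).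
  move=> t1; apply: (le_trans (key t)).
  have := expR_ge1Dx (- (t ^+ 2 * s ^+ 2 / 2)); rewrite expRN.
  set z := t ^+ 2 * s ^+ 2 / 2 => hz.
  have ez : 0 < expR z := expR_gt0 z.
  have : expR z - 1 <= z * expR z.
    move: hz; rewrite -(ler_pM2r ez) mulVf ?gt_eqF// mulrDl mul1r mulNr; lra.
  move=> /le_trans; apply; rewrite /z.
  rewrite [leRHS](_ : _ = t ^+ 2 * s ^+ 2 / 2 * expR (s ^+ 2 / 2)); last by field.
  apply: ler_wpM2l; first by rewrite divr_ge0// mulr_ge0 ?sqr_ge0.
  rewrite ler_expR ler_wpM2r// ler_piMl ?sqr_ge0//.
  by rewrite -real_normK ?num_real// expr_le1.
set C := expR _ * _ / _ in key2.
have C0 : 0 < C by rewrite /C divr_gt0// mulr_gt0 ?expR_gt0.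
apply/eqP; apply: contraT => m0.
have m0' : 0 < `|m| by rewrite normr_gt0.
(* With the sign of [m] in front, [key2] becomes [|m| <= t C], while this choice ensures
   [t C <= |m| / 2]. *)
pose t := Num.min 1 (`|m| / (2 * C)).
have t0 : 0 < t by rewrite lt_min ltr01 divr_gt0// mulr_gt0.
have t1 : t <= 1 by rewrite ge_min lexx.
have := key2 (Num.sg m * t).
rewrite normrM normr_sg m0 mul1r gtr0_norm// => /(_ t1).
rewrite exprMn sqr_sg m0 mul1r mulrAC -normrEsg.
rewrite mulrC expr2 -mulrA ler_pM2l// => h.
have : t * C <= `|m| / 2.
  rewrite -ler_pdivlMr// (_ : _ / _ / _ = `|m| / (2 * C)) ?ge_min ?lexx ?orbT//.
  by field; rewrite gt_eqF.
by lra.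
Qed.

End gaussian_moments.

(** * The process and its integral *)

Section gaussian_process.
Context {R : realType} {d : measure_display} {Omega : measurableType d}.
Variable P : probability Omega R.
Variables (Z : R -> {RV P >-> R}) (kappa : R -> R -> R).
Hypothesis Zgauss : centered_gaussian_process Z.
Hypothesis Zcov : has_covariance Z kappa.

Lemma gaussian_comb_law (s : seq (R * R)) : all (fun p => 0 <= p.2) s ->
  exists sigma, normal_law P (fun w => \sum_(p <- s) p.1 * Z p.2 w) sigma.
Proof.
move=> s0; pose t (i : 'I_(size s)) := (nth (0, 0) s i).2.
pose c (i : 'I_(size s)) := (nth (0, 0) s i).1.
have [|sigma lawD] := Zgauss (t := t) c; first move=> i.
  by move/all_nthP : s0; apply.
exists sigma; split => [|A mA].
  by apply: measurable_sum => p; apply: measurable_funM.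
rewrite -lawD//; congr (P (_ @^-1` A)); apply/funext => w.
by rewrite (big_nth (0, 0)) big_mkord.
Qed.

Lemma gaussian_marginal_law (t : R) : 0 <= t ->
  exists sigma, normal_law P (Z t) sigma.
Proof.
move=> t0; have [|sigma] := @gaussian_comb_law [:: (1, t)]; first by rewrite /= t0.
rewrite (_ : (fun w => _) = Z t); first by exists sigma.
by apply/funext => w; rewrite big_seq1 mul1r.
Qed.

Lemma gaussian_integrableM (s t : R) : 0 <= s -> 0 <= t ->
  P.-integrable [set: Omega] (EFin \o (fun w => Z s w * Z t w)).
Proof.
move=> s0 t0; have [a la] := gaussian_marginal_law s0.
have [b lb] := gaussian_marginal_law t0.
have ia := normal_law_integrable_sqr la.
have ib := normal_law_integrable_sqr lb.
apply: le_integrable (integrableD measurableT ia ib) => //.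
  by apply/measurable_EFinP; exact: measurable_funM.
move=> w _ /=; rewrite lee_fin [leRHS]ger0_norm ?addr_ge0 ?sqr_ge0//.
rewrite normrM -[Z s w ^+ 2]real_normK ?num_real// -[Z t w ^+ 2]real_normK ?num_real//.
have := sqr_ge0 (`|Z s w| - `|Z t w|).
have := sqr_ge0 (`|Z s w|); have := sqr_ge0 (`|Z t w|).
have := mulr_ge0 (normr_ge0 (Z s w)) (normr_ge0 (Z t w)); nra.
Qed.

Lemma gaussian_prod_mean (s t : R) : 0 <= s -> 0 <= t ->
  \int[P]_w (Z s w * Z t w) = kappa s t.
Proof.
move=> s0 t0; have [a la] := gaussian_marginal_law s0.
have [b lb] := gaussian_marginal_law t0.
have := Zcov s0 t0; rewrite covarianceE; first last.
- by apply/Lfun1_integrable; exact: gaussian_integrableM.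
- by apply/Lfun1_integrable; exact: normal_law_integrable lb.
- by apply/Lfun1_integrable; exact: normal_law_integrable la.
rewrite !unlock.
have Ea : (\int[P]_w (Z s w)%:E = 0)%E.
  rewrite -(@fineK _ (\int[P]_w (Z s w)%:E)%E).
    by congr EFin; exact: normal_law_mean la.
  by apply: integrable_fin_num => //; exact: normal_law_integrable la.
rewrite Ea mul0e sube0 /Rintegral.
by rewrite /GRing.mul/= => ->.
Qed.

Lemma gaussian_comb (s : seq (R * R)) : all (fun p => 0 <= p.2) s ->
  exists sigma, normal_law P (fun w => \sum_(p <- s) p.1 * Z p.2 w) sigma /\
    sigma ^+ 2 = \sum_(p <- s) \sum_(q <- s) p.1 * q.1 * kappa p.2 q.2.
Proof.
move=> s0; have [sigma lawD] := gaussian_comb_law s0.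
exists sigma; split => //; rewrite -(normal_law_sqr lawD).
apply: EFin_inj; rewrite /Rintegral fineK; last first.
  by apply: integrable_fin_num => //; exact: normal_law_integrable_sqr lawD.
pose t (i : 'I_(size s)) := (nth (0, 0) s i).2.
pose c (i : 'I_(size s)) := (nth (0, 0) s i).1.
have t0 i : 0 <= t i by move/all_nthP : s0; apply.
have iij i j : P.-integrable [set: Omega]
    (fun w => (c i * c j)%:E * (Z (t i) w * Z (t j) w)%:E)%E.
  by apply: integrableZl => //; exact: gaussian_integrableM.
under eq_integral => w _.
  rewrite expr2 mulr_suml (big_nth (0, 0)) big_mkord -sumEFin.
  under eq_bigr => i _.
    rewrite mulr_sumr (big_nth (0, 0)) big_mkord -sumEFin.
    under eq_bigr => j _ do rewrite mulrACA EFinM -/(c i) -/(c j) -/(t i) -/(t j).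
    over.
  over.
rewrite integral_sum//=; last by move=> i; exact: integrable_sum.
rewrite (big_nth (0, 0)) big_mkord -sumEFin; apply: eq_bigr => i _.
rewrite integral_sum//=.
rewrite (big_nth (0, 0)) big_mkord -sumEFin; apply: eq_bigr => j _.
rewrite integralZl//; last exact: gaussian_integrableM.
rewrite [RHS]EFinM; congr *%E.
rewrite -(gaussian_prod_mean (t0 i) (t0 j)) /Rintegral fineK//.
by apply: integrable_fin_num => //; exact: gaussian_integrableM.
Qed.

End gaussian_process.

(** * Control of the increments of Z by an exponential integral *)

Section increments.
Context {R : realType} {d : measure_display} {Omega : measurableType d}.
Variable P : probability Omega R.
Variables (Z : R -> {RV P >-> R}) (kappa : R -> R -> R).
Hypothesis Zgauss : centered_gaussian_process Z.
Hypothesis Zcov : has_covariance Z kappa.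
Hypothesis Zmeas : jointly_measurable Z.
Local Notation mu := (@lebesgue_measure R).

Definition incr_var (u p : R) : R :=
  kappa u u - kappa u p - kappa p u + kappa p p.

Lemma increment_law (u p : R) : 0 <= u -> 0 <= p ->
  exists sigma, normal_law P (fun w => Z u w - Z p w) sigma /\
    sigma ^+ 2 = incr_var u p.
Proof.
move=> u0 p0.
have [|sigma] := gaussian_comb Zgauss Zcov (s := [:: (1, u); (-1, p)]).
  by rewrite /= u0 p0.
rewrite !big_cons !big_nil !addr0 /= => -[law var]; exists sigma; split.
  rewrite (_ : (fun w => _) =
    (fun w => \sum_(q <- [:: (1, u); (-1, p)]) q.1 * Z q.2 w))//.
  by apply/funext => w; rewrite !big_cons !big_nil addr0 mul1r mulN1r.
by rewrite var /incr_var; ring.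
Qed.

Lemma measurable_increment_section (w : Omega) (p h : R) : 0 <= p ->
  measurable_fun `[p, p + h] (fun u : measurableTypeR R => Z u w - Z p w).
Proof.
move=> p0; apply: measurable_funB => //.
apply: (@measurable_comp _ _ _ _ _ _ [set z : measurableTypeR R * Omega | 0 <= z.1]
  (fun z => Z z.1 z.2) _ (fun u : measurableTypeR R => (u, w))).
- rewrite (_ : [set z | _] = fst @^-1` `[0, +oo[%classic); last first.
    by apply/seteqP; split => z /=; rewrite in_itv/= andbT.
  by rewrite -[X in measurable X]setTI; exact: measurable_fst.
- by move=> _ [u /= + <-]/=; rewrite in_itv/= => /andP[+ _]; exact: le_trans.
- exact: Zmeas.
- exact/measurable_funTS/pair2_measurable.
Qed.

(** One event controls the whole interval: Tonelli's theorem bounds the expectation of the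
    exponential integral by [h sqrt 2], and Markov's inequality does the rest. Integrability of the
    path on the interval is part of the conclusion, since it follows from finiteness of that
    integral. *)
Lemma increment_tail (p h s m : R) : 0 <= p -> 0 < h -> 0 < s -> 0 < m ->
  (forall u, p <= u <= p + h -> incr_var u p <= s ^+ 2) ->
  exists2 B : set Omega, measurable B /\
    (P B <= ((Num.sqrt 2^-1)^-1 * expR (- (m ^+ 2 / (4 * s ^+ 2))))%:E)%E &
    forall w, ~ B w ->
      mu.-integrable `[p, p + h] (EFin \o (fun u => Z u w - Z p w)) /\
      \int[mu]_(u in `[p, p + h]) `|Z u w - Z p w| <= h * m.
Proof.
move=> p0 h0 s0 m0 var.
(* Half of the critical exponent [1 / (2 s^2)], which is the case [r = 1/2] of
   [normal_law_exp_sqr]. *)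
pose theta := (4 * s ^+ 2)^-1.
have theta0 : 0 < theta by rewrite invr_gt0 mulr_gt0 ?exprn_gt0.
pose phi (u : R) (w : Omega) := expR (theta * (Z u w - Z p w) ^+ 2).
pose D := `[p, p + h]%classic : set R.
(* Extended by 0 outside [D], so that Tonelli's theorem applies on the full product space. *)
pose F : measurableTypeR R * Omega -> \bar R :=
  (fun z => (phi z.1 z.2)%:E) \_ (D `*` [set: Omega]).
have mD : measurable (D : set (measurableTypeR R)) by exact: measurable_itv.
have mF : measurable_fun setT F.
  apply/(measurable_restrictT _ _).1; first exact: measurableX.
  apply/measurable_EFinP; apply: measurableT_comp => //.
  apply: measurable_funM => //; apply: measurable_funX; apply: measurable_funB.
    apply: measurable_funS Zmeas.
      rewrite (_ : [set z | _] = fst @^-1` `[0, +oo[%classic); last first.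
        by apply/seteqP; split => z /=; rewrite in_itv/= andbT.
      by rewrite -[X in measurable X]setTI; exact: measurable_fst.
    by move=> z [/= + _]; rewrite /D /= in_itv/= => /andP[+ _]; exact: le_trans.
  by apply/measurable_funTS; exact: measurableT_comp measurable_snd.
have F0 z : (0 <= F z)%E.
  by rewrite /F patchE; case: ifP => // _; rewrite lee_fin expR_ge0.
pose G w := (\int[mu]_(u in D) (phi u w)%:E)%E.
have GE w : G w = (\int[mu]_u F (u, w))%E.
  rewrite /G integral_mkcond; apply: eq_integral => u _.
  by rewrite /F !patchE in_setX in_setT andbT.
have mG : measurable_fun setT G.
  rewrite (funext GE). have h1 := (measurable_fun_fubini_tonelli_G (m1:=mu) F mF F0). exact h1.
have G0 w : (0 <= G w)%E by apply: integral_ge0 => u _; rewrite lee_fin expR_ge0.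
have intG : (\int[P]_w G w <= h%:E * ((Num.sqrt 2^-1)^-1)%:E)%E.
  have -> : (\int[P]_w G w = \int[mu]_u \int[P]_w F (u, w))%E.
    rewrite (fubini_tonelli (m1:=mu) (m2:=P) F mF F0).
    by apply: eq_integral => w _; rewrite GE.
  have -> : (\int[mu]_u \int[P]_w F (u, w) =
      \int[mu]_u (((fun u => \int[P]_w (phi u w)%:E) \_ D) u))%E.
    apply: eq_integral => u _; rewrite patchE; case: ifPn => uD.
      by apply: eq_integral => w _; rewrite /F patchE in_setX in_setT andbT uD.
    rewrite integral0_eq// => w _.
    by rewrite /F patchE in_setX in_setT andbT (negbTE uD).
  rewrite -integral_mkcond.
  apply: (@le_trans _ _ (\int[mu]_(u in D) ((Num.sqrt 2^-1)^-1)%:E)%E); last first.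
    rewrite integral_cst//= lebesgue_measure_itv/= lte_fin ltrDl h0.
    by rewrite -EFinB addrAC subrr add0r muleC.
  apply: ge0_le_integral => //=.
  - by move=> u _; apply: integral_ge0 => w _; rewrite lee_fin expR_ge0.
  - have := measurable_fun_fubini_tonelli_F (m2:=P) F mF F0.
    move=> /(@measurable_funTS _ _ _ _ D); apply: eq_measurable_fun => u uD.
    rewrite /fubini_F; apply: eq_integral => w _.
    by rewrite /F patchE in_setX in_setT andbT uD.
  move=> u; rewrite /D/= in_itv/= => /andP[pu uph].
  have u0 : 0 <= u by exact: le_trans pu.
  have [sigma [law sig]] := increment_law u0 p0.
  have ss : sigma ^+ 2 <= s ^+ 2 by rewrite sig var ?pu.
  have r01 : 0 < (2^-1 : R) <= 1 by apply/andP; split; lra.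
  apply: le_trans (normal_law_exp_sqr law ss s0 r01).
  apply: ge0_le_integral => //=.
  - by move=> w _; rewrite lee_fin expR_ge0.
  - apply/measurable_EFinP; apply: measurableT_comp => //.
    by apply: measurable_funM => //; apply: measurable_funX; exact: law.1.
  - apply/measurable_EFinP; apply: measurableT_comp => //.
    apply: measurable_funM => //; apply: measurable_funM => //.
    by apply: measurable_funX; exact: law.1.
  move=> w _; rewrite lee_fin ler_expR /theta.
  rewrite [leRHS](_ : _ = (4 * s ^+ 2)^-1 * (Z u w - Z p w) ^+ 2)//.
  by field; rewrite gt_eqF.
(* The value of [G] for an increment constantly equal to [m]. Below it, Jensen's inequality for
   [y -> exp (theta y^2)] bounds the mean of [|Z u - Z p|] by [m]. *)
pose c := h * expR (theta * m ^+ 2).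
have c0 : 0 < c by rewrite mulr_gt0 ?expR_gt0.
exists [set w | (c%:E <= G w)%E]; first split.
- by rewrite -[X in measurable X]setTI; exact: emeasurable_fun_c_infty.
- apply: (le_trans (ge0_markov P c0 mG G0)).
  apply: (@le_trans _ _ (c^-1%:E * (h%:E * ((Num.sqrt 2^-1)^-1)%:E))%E).
    by apply: lee_wpmul2l => //; rewrite lee_fin invr_ge0 ltW.
  rewrite (_ : m ^+ 2 / (4 * s ^+ 2) = theta * m ^+ 2); last by rewrite mulrC.
  rewrite -!EFinM lee_fin /c expRN; set E := expR _; set S := (Num.sqrt _)^-1.
  rewrite invfM mulrACA mulVf ?gt_eqF// mul1r mulrC.
  by rewrite lexx.
- move=> w /= /negP; rewrite -ltNge => Gw.
  have mY := @measurable_increment_section w p h p0.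
  have iphi : mu.-integrable D (EFin \o phi ^~ w).
    apply/integrableP; split.
      apply/measurable_EFinP; apply: measurableT_comp => //.
      by apply: measurable_funM => //; exact: measurable_funX.
    under eq_integral do rewrite gee0_abs ?lee_fin ?expR_ge0//.
    by rewrite (lt_trans Gw)// ltry.
  pose k := expR (theta * m ^+ 2).
  have k0 : 0 < k := expR_gt0 _.
  (* the tangent of [exp (theta y^2)] at [y = m] turns the bound on the integral
     of [phi] into a bound on the integral of [|Z u - Z p|] *)
  have key (y : R) : k * (1 + 2 * theta * m * (`|y| - m)) <= expR (theta * y ^+ 2).
    rewrite -[y ^+ 2]real_normK ?num_real//.
    rewrite (_ : theta * `|y| ^+ 2 = theta * m ^+ 2 + (2 * theta * m * (`|y| - m)
       + theta * (`|y| - m) ^+ 2)); last by ring.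
    rewrite expRD -/k ler_pM2l// (le_trans _ (expR_ge1Dx _))// lerD2l lerDl.
    by rewrite mulr_ge0 ?sqr_ge0// ltW.
  have a0 : 0 < k * (2 * theta * m) by rewrite !mulr_gt0.
  have iY : mu.-integrable D (EFin \o (fun u => Z u w - Z p w)).
    pose C := (k * (2 * theta * m))^-1.
    have C0 : 0 < C by rewrite invr_gt0.
    have i1 : mu.-integrable D (EFin \o cst (C * (k * (2 * theta * m * m)))).
      apply/integrableP; split; first exact/measurable_EFinP.
      rewrite /= integral_cst//= lebesgue_measure_itv/= lte_fin ltrDl h0.
      by rewrite -EFinB -EFinM ltry.
    have i2 : mu.-integrable D (fun u => C%:E * (phi u w)%:E)%E.
      exact: integrableZl.
    apply: le_integrable (integrableD mD i1 i2) => //.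
      exact/measurable_EFinP.
    move=> u _ /=; rewrite lee_fin [leRHS]ger0_norm.
      have := key (Z u w - Z p w); rewrite -/(phi u w) => hk.
      rewrite -mulrDr -ler_pdivrMl// invrK.
      rewrite mulrDr mulr1 [X in _ + X <= _]mulrCA in hk.
      rewrite mulrBr mulrBr in hk.
      by move: hk; rewrite (mulrA k) => hk; lra.
    by rewrite addr_ge0 ?mulr_ge0 ?expR_ge0 ?(ltW C0) ?(ltW k0) ?(ltW theta0) ?(ltW m0).
  split => //.
  have iaY : mu.-integrable D (EFin \o (fun u => `|Z u w - Z p w|)).
    exact: (integrable_norm iY).
  have i1 : mu.-integrable D (EFin \o cst (k * (1 - 2 * theta * m * m))).
    apply/integrableP; split; first exact/measurable_EFinP.
    rewrite /= integral_cst//= lebesgue_measure_itv/= lte_fin ltrDl h0.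
    by rewrite -EFinB -EFinM ltry.
  have i2 : mu.-integrable D
      (EFin \o (fun u => k * (2 * theta * m) * `|Z u w - Z p w|)).
    exact: (@integrableZl _ _ _ _ _ _ _ (EFin \o _) iaY).
  have : \int[mu]_(u in D) (cst (k * (1 - 2 * theta * m * m)) u +
      k * (2 * theta * m) * `|Z u w - Z p w|) <= \int[mu]_(u in D) phi u w.
    apply: le_Rintegral => //; first exact: (integrableD mD i1 i2).
    move=> u _ /=; apply: le_trans (key (Z u w - Z p w)); lra.
  rewrite RintegralD// Rintegral_cst// RintegralZl//.
  have -> : fine (mu D) = h.
    by rewrite /D lebesgue_measure_itv/= lte_fin ltrDl h0/= addrAC subrr add0r.
  set W := \int[mu]_(u in D) _ => hW.
  have : \int[mu]_(u in D) phi u w <= h * k.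
    rewrite /Rintegral -lee_fin fineK; last first.
      exact: integrable_fin_num.
    by rewrite -/(G w) ltW.
  move=> /(le_trans hW) hW'.
  rewrite -(ler_pM2l a0); lra.
Qed.

End increments.

Section within_continuity.
Context {R : realType}.

Lemma within_continuous_epsP (T : pseudoMetricType R) (A : set T) (f : T -> R) :
  {within A, continuous f} <->
  forall x, A x -> forall e, 0 < e -> exists2 del, 0 < del &
    forall y, A y -> ball x del y -> `|f x - f y| < e.
Proof.
split.
  move=> /subspace_continuousP cf x Ax e e0.
  have /cvgrPdist_lt/(_ e e0) := cf x Ax.
  rewrite near_withinE -nbhs_ballE => -[del/= del0 h].
  by exists del => // y Ay xy; exact: h.
move=> h; apply/subspace_continuousP => x Ax; apply/cvgrPdist_lt => e e0.
have [del del0 hd] := h x Ax e e0.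
rewrite near_withinE -nbhs_ballE; exists del => //= y xy Ay; exact: hd.
Qed.

(** Points below 1 are approached from the right and 1 from the left, so that the rational stays in
    the interval. *)
Lemma rat_dense01 (t e : R) : 0 <= t <= 1 -> 0 < e ->
  exists2 r : rat, 0 <= (ratr r : R) <= 1 & `|t - ratr r| < e.
Proof.
move=> /andP[t0 t1] e0.
have [t1'|t1'] := ltP t 1.
  have [|r] := @rat_in_itvoo R t (Num.min 1 (t + e)).
    by rewrite lt_min t1' ltrDl.
  rewrite in_itv/= lt_min => /and3P[tr r1 re]; exists r.
    by rewrite (ltW r1) (le_trans t0 (ltW tr)).
  by rewrite ltr_norml; lra.
have [|r] := @rat_in_itvoo R (Num.max 0 (t - e)) t.
  by rewrite gt_max; apply/andP; split; lra.
rewrite in_itv/= gt_max => /andP[/andP[r0 re] rt]; exists r; last first.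
  by rewrite ltr_norml; lra.
by rewrite (ltW r0) (le_trans (ltW rt)).
Qed.

Lemma within_le_rat (f : R -> R) (c : R) : {within `[0, 1], continuous f} ->
  (forall r : rat, 0 <= (ratr r : R) <= 1 -> `|f (ratr r)| <= c) ->
  forall t, 0 <= t <= 1 -> `|f t| <= c.
Proof.
move=> /within_continuous_epsP cf h t t01; apply/ler_addgt0Pr => e e0.
have [del del0 hd] := cf t ltac:(by rewrite /= in_itv) e e0.
have [r r01 tr] := rat_dense01 t01 del0.
have := hd (ratr r) ltac:(by rewrite /= in_itv) tr.
have := h r r01; have := ler_normD (f t - f (ratr r)) (f (ratr r)).
by rewrite subrK; lra.
Qed.

Lemma within_continuous_line (f : R -> R) (p h : R) : 0 <= p -> 0 <= h ->
  {within `[0, +oo[, continuous f} ->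
  {within `[0, 1], continuous (fun t => f (p + h * t))}.
Proof.
move=> p0 h0 /within_continuous_epsP cf; apply/within_continuous_epsP.
have ge0 t : `[(0:R), 1]%classic t -> `[0, +oo[%classic (p + h * t).
  by rewrite /= !in_itv/= andbT => /andP[t0 _]; rewrite addr_ge0 ?mulr_ge0.
move=> t t01 e e0; have [del del0 hd] := cf _ (ge0 t t01) e e0.
have h1 : 0 < h + 1 by lra.
exists (del / (h + 1)); first by rewrite divr_gt0.
move=> y y01; rewrite /ball/= => ty; apply: hd; first exact: ge0.
rewrite /ball/= opprD addrACA subrr add0r -mulrBr normrM ger0_norm//.
rewrite ltr_pdivlMr// in ty.
by have := normr_ge0 (t - y); nra.
Qed.

End within_continuity.

(** * Properties valid outside an event of small probability *)

Section exceptional_events.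
Context {R : realType} {d : measure_display} {Omega : measurableType d}.
Variable P : probability Omega R.

(** The exceptional set is enclosed in a measurable [B], because [Q] may quantify over all times or
    assert integrability of a path, and so need not define a measurable set. The costs [c] add up
    under conjunction. *)
Definition outside_event (c : R) (Q : Omega -> Prop) : Prop :=
  exists2 B : set Omega, measurable B /\ (P B <= c%:E)%E &
    forall w, ~ B w -> Q w.

Lemma outside_event_and c1 c2 (Q1 Q2 : Omega -> Prop) :
  outside_event c1 Q1 -> outside_event c2 Q2 ->
  outside_event (c1 + c2) (fun w => Q1 w /\ Q2 w).
Proof.
move=> [B1 [mB1 P1] h1] [B2 [mB2 P2] h2]; exists (B1 `|` B2).
  split; first exact: measurableU.
  by rewrite (le_trans (measureU2 _ _ _))// EFinD leeD.
by move=> w /not_orP[nB1 nB2]; split; [exact: h1|exact: h2].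
Qed.

Lemma outside_event_sub c1 c2 (Q1 Q2 : Omega -> Prop) : c1 <= c2 ->
  (forall w, Q1 w -> Q2 w) -> outside_event c1 Q1 -> outside_event c2 Q2.
Proof.
move=> c12 h [B [mB PB] hB]; exists B; last by move=> w /hB /h.
by split => //; rewrite (le_trans PB)// lee_fin.
Qed.

Lemma outside_event_forall (n : nat) (c : R) (Q : nat -> Omega -> Prop) :
  (forall i, (i < n)%N -> outside_event c (Q i)) ->
  outside_event (n%:R * c) (fun w => forall i, (i < n)%N -> Q i w).
Proof.
elim: n => [_|n ih h].
  by exists set0; [split => //; rewrite measure0 mul0r|].
have h1 := ih (fun i ni => h i (ltnW ni)).
apply: outside_event_sub (outside_event_and h1 (h n (ltnSn n))).
  by rewrite -natr1 mulrDl mul1r.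
by move=> w [h2 h3] i; rewrite ltnS leq_eqVlt => /predU1P[->//|]; exact: h2.
Qed.

Lemma outside_event_ae (Q : Omega -> Prop) :
  {ae P, forall w, Q w} -> outside_event 0 Q.
Proof.
move=> [N [mN PN h]]; exists N; first by split => //; rewrite PN.
by move=> w; apply: contra_notP => nQ; exact: h.
Qed.

End exceptional_events.

(** * Linearization of the paths of X *)

Section paths.
Context {R : realType} {d : measure_display} {Omega : measurableType d}.
Variable P : probability Omega R.
Variables (Z X : R -> {RV P >-> R}) (kappa : R -> R -> R).
Hypothesis Zgauss : centered_gaussian_process Z.
Hypothesis Zcov : has_covariance Z kappa.
Hypothesis Zmeas : jointly_measurable Z.
Hypothesis Xcont : continuous_paths X.
Hypothesis Xint : integrated_process Z X.
Local Notation mu := (@lebesgue_measure R).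

(* The bound of [normal_tail] at [r = 1/2]. *)
Definition gauss_bound (a : R) : R := (Num.sqrt 2^-1)^-1 * expR (- a).

Lemma Rintegral_itv_sub (f : R -> R) (p q : R) : 0 <= p <= q ->
  mu.-integrable `[0, q] (EFin \o f) ->
  \int[mu]_(u in `[0, q]) f u - \int[mu]_(u in `[0, p]) f u =
  \int[mu]_(u in `[p, q]) f u.
Proof.
move=> /andP[p0 pq] intf; rewrite Rintegral_itvB ?bnd_simp//.
rewrite Rintegral_itv_obnd_cbnd//; apply: integrableS intf => //.
by apply: subset_itvr; rewrite bnd_simp.
Qed.

Lemma Rintegral_cst_itv (p h c : R) : 0 <= h ->
  \int[mu]_(u in `[p, p + h]) c = h * c.
Proof.
move=> h0; rewrite Rintegral_cst//= lebesgue_measure_itv/= lte_fin ltrDl mulrC.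
case: ltP => h1 /=; first by rewrite addrAC subrr add0r.
by rewrite (_ : h = 0) ?mulr0 ?mul0r//; apply: le_anti; rewrite h1 h0.
Qed.

Lemma integrable_cst_itv (p q c : R) :
  mu.-integrable `[p, q] (EFin \o (fun=> c)).
Proof.
apply/integrableP; split; first exact/measurable_EFinP.
rewrite /= integral_cst//= lebesgue_measure_itv/=.
by case: ifP => _; [rewrite -EFinB -EFinM ltry|rewrite mule0 ltry].
Qed.

(** Additivity of the integral of [Z] over adjacent intervals requires integrable paths; this
    supplies them at the same exponential cost as the other estimates, for any [m]. *)
Lemma path_integrable_tail (h s m : R) : 0 < h -> 0 < s -> 0 < m ->
  (forall u, 0 <= u <= h -> incr_var kappa u 0 <= s ^+ 2) ->
  outside_event P (gauss_bound (m ^+ 2 / (4 * s ^+ 2)))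
    (fun w => mu.-integrable `[0, h] (EFin \o (Z ^~ w))).
Proof.
move=> h0 s0 m0 var.
have [|B [mB PB] hB] := increment_tail Zgauss Zcov Zmeas (lexx 0) h0 s0 m0.
  by rewrite add0r.
exists B; first by [].
move=> w /hB[+ _]; rewrite add0r => iY.
apply: eq_integrable (integrableD _ iY (integrable_cst_itv 0 h (Z 0 w))) => //.
by move=> u _ /=; rewrite -EFinD subrK.
Qed.

(** The error at [t] is the integral of [Z u - Z p] over [[p, p + h t]], so the integral of the
    absolute value over [[p, p + h]] bounds it for all [t] at once. Integrability stays a premise
    inside the event, to be paid for once and shared by all intervals. *)
Lemma path_tail (p h s m : R) : 0 <= p -> 0 < h -> 0 < s -> 0 < m ->
  (forall u, p <= u <= p + h -> incr_var kappa u p <= s ^+ 2) ->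
  outside_event P (gauss_bound (m ^+ 2 / (4 * s ^+ 2)))
    (fun w => mu.-integrable `[0, p + h] (EFin \o (Z ^~ w)) ->
      forall t, 0 <= t <= 1 ->
        `|X (p + h * t) w - X p w - h * t * Z p w| <= h * m).
Proof.
move=> p0 h0 s0 m0 var.
have [B PB hB] := increment_tail Zgauss Zcov Zmeas p0 h0 s0 m0 var.
have hB' : outside_event P (gauss_bound (m ^+ 2 / (4 * s ^+ 2))) (fun w =>
   mu.-integrable `[p, p + h] (EFin \o (fun u => Z u w - Z p w)) /\
      \int[mu]_(u in `[p, p + h]) `|Z u w - Z p w| <= h * m) by exists B.
(* [Xint] holds almost surely at each fixed time only, hence the restriction to
   rational times *)
pose r k : R := ratr (odflt 0 (@unpickle rat k)).
have aeX : {ae P, forall w, forall k, 0 <= r k <= 1 ->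
    X (p + h * r k) w = \int[mu]_(u in `[0, p + h * r k]) Z u w}.
  apply/ae_foralln => k; have [rk|rk] := boolP (0 <= r k <= 1).
    have h0r : 0 <= p + h * r k.
      by case/andP: rk => r0 _; rewrite addr_ge0// mulr_ge0// ltW.
    have := Xint h0r; apply: filterS => w Xw _. exact: Xw.
  exact: nearW.
have hX := outside_event_and (outside_event_ae aeX) (outside_event_ae (Xint p0)).
apply: outside_event_sub (outside_event_and hX hB').
  by rewrite !add0r.
move=> w [[Xr Xp] [iY hY]] iZ.
apply: within_le_rat => [|q q01].
  apply/within_continuous_epsP => t t01 e e0.
  have /within_continuous_epsP := within_continuous_line p0 (ltW h0) (@Xcont w).
  move=> /(_ t t01 (e / 2)) [|del del0 hd]; first by rewrite divr_gt0.
  have c0 : 0 < 2 * (h * `|Z p w| + 1).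
    by rewrite mulr_gt0// ltr_wpDl// mulr_ge0// ltW.
  exists (Num.min del (e / (2 * (h * `|Z p w| + 1)))).
    by rewrite lt_min del0 divr_gt0.
  move=> y y01; rewrite /ball/= lt_min => /andP[ty1 ty2].
  have := hd y y01 ty1; rewrite ltr_pdivlMr// in ty2 => h1.
  have h2 : `|h * t * Z p w - h * y * Z p w| <= `|t - y| * (h * `|Z p w|).
    by rewrite -mulrBl -mulrBr !normrM (gtr0_norm h0) mulrAC mulrC.
  have := normr_ge0 (t - y).
  have := ler_normB (X (p + h * t) w - X (p + h * y) w) (h * t * Z p w - h * y * Z p w).
  rewrite (_ : _ - _ - (_ - _) = X (p + h * t) w - X p w - h * t * Z p w -
    (X (p + h * y) w - X p w - h * y * Z p w)); last by ring.
  by lra.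
have := Xr (pickle q); rewrite /r pickleK/= => /(_ q01).
set t := ratr q in q01 * => Xt; case/andP: q01 => t0 t1.
have ht0 : 0 <= h * t by apply: mulr_ge0 => //; exact: ltW.
have hth : h * t <= h by apply: ler_piMr => //; exact: ltW.
have sub1 : `[p, (p + h * t)%R] `<=` `[p, (p + h)%R].
  by apply: subset_itvl; rewrite bnd_simp lerD2l.
have sub2 : `[p, (p + h * t)%R] `<=` `[0, (p + h)%R].
  by apply: subset_itv; rewrite bnd_simp// lerD2l.
have iZt : mu.-integrable `[0, p + h * t] (EFin \o (Z ^~ w)).
  by apply: integrableS iZ => //; apply: subset_itvl; rewrite bnd_simp lerD2l.
rewrite Xt Xp Rintegral_itv_sub ?p0 ?lerDl//.
rewrite -(Rintegral_cst_itv p (Z p w) ht0) -RintegralB//; last 2 first.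
- exact: integrableS iZ.
- exact: integrable_cst_itv.
apply: le_trans hY; apply: (@le_trans _ _ (\int[mu]_(u in `[p, p + h * t]) `|Z u w - Z p w|)).
  by apply: le_normr_Rintegral => //; exact: integrableS iY.
rewrite /Rintegral fine_le//.
- by apply: integrable_fin_num => //; apply: integrable_norm; exact: integrableS iY.
- by apply: integrable_fin_num => //; apply: integrable_norm.
apply: ge0_subset_integral => //.
exact: (measurable_int mu (integrable_norm iY)).
Qed.

End paths.

(** * The integrated kernel *)

Section uniform_continuity.
Context {R : realType}.

(** By the triangle inequality a radius [del / 2] valid at [x] serves every nearby point; the
    near-covering form of compactness then provides one radius for all of [A]. *)
Lemma compact_uniformly_continuous (T : pseudoMetricType R) (A : set T) (f : T -> R) :
  compact A -> {within A, continuous f} ->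
  forall e, 0 < e -> exists2 del, 0 < del &
    forall x y, A x -> A y -> ball x del y -> `|f x - f y| < e.
Proof.
move=> /compact_near_coveringP cA /within_continuous_epsP cf e e0.
pose Q (del : R) (x : T) := A x -> forall y, A y -> ball x del y -> `|f x - f y| < e.
have cover x : A x -> \forall x' \near x & i \near 0^'+, Q i x'.
  move=> Ax; have [del del0 hd] := cf x Ax (e / 2) ltac:(by rewrite divr_gt0).
  exists (ball x (del / 2), [set r | r < del / 2]) => /=.
    split; first by apply: nbhsx_ballx; rewrite divr_gt0.
    by apply: nbhs_right_lt; rewrite divr_gt0.
  move=> [x' r] [/= xx' rdel] Ax' y Ay x'y.
  have xy : ball x del y.
    rewrite [del]splitr; apply: ball_triangle xx' _.
    by apply: le_ball x'y; exact: ltW.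
  have x'b : ball x del x'.
    by apply: le_ball xx'; rewrite ler_pdivrMr//; lra.
  have h1 := hd _ Ay xy; have := hd _ Ax' x'b; rewrite distrC => h2.
  have := ler_normD (f x' - f x) (f x - f y).
  by rewrite addrA subrK; lra.
have [del /= del0 h] := cA R 0^'+ Q _ cover.
exists (del / 2); first by rewrite divr_gt0.
move=> x y Ax Ay xy; apply: (h (del / 2)) => //=.
  rewrite sub0r normrN gtr0_norm ?divr_gt0//.
  by rewrite ltr_pdivrMr//; lra.
by rewrite divr_gt0.
Qed.

Lemma compact_continuous_bounded (T : topologicalType) (A : set T) (f : T -> R) :
  compact A -> {within A, continuous f} -> exists2 C, 0 < C & forall x, A x -> `|f x| <= C.
Proof.
move=> cA cf; have /compact_bounded := continuous_compact cf cA.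
move=> [M [_ hM]]; exists (`|M| + 1); first by rewrite ltr_wpDl.
move=> x Ax; apply: (hM (`|M| + 1)); last by exists x.
by rewrite (le_lt_trans (ler_norm _))// ltrDl.
Qed.

End uniform_continuity.

Section half_line_integrals.
Context {R : realType}.
Local Notation mu := (@lebesgue_measure R).

Lemma integrable_half_line (g : R -> R) (p q : R) : 0 <= p ->
  {within `[0, +oo[, continuous g} -> mu.-integrable `[p, q] (EFin \o g).
Proof.
move=> p0 cg; apply: continuous_compact_integrable; first exact: segment_compact.
apply: continuous_subspaceW cg => x /=; rewrite !in_itv/= andbT => /andP[+ _].
exact: le_trans.
Qed.

Lemma Rintegral_near_cst (g : R -> R) (p h c eta : R) : 0 <= p -> 0 <= h ->
  {within `[0, +oo[, continuous g} ->
  (forall u, p <= u <= p + h -> `|g u - c| <= eta) ->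
  `|\int[mu]_(u in `[p, p + h]) g u - h * c| <= h * eta.
Proof.
move=> p0 h0 cg hg.
have ig : mu.-integrable `[p, p + h] (EFin \o g) by exact: integrable_half_line.
have ic := integrable_cst_itv p (p + h) c.
have ie := integrable_cst_itv p (p + h) eta.
have iB : mu.-integrable `[p, p + h] (EFin \o (fun u => g u - c)).
  exact: (integrableB _ ig ic).
rewrite -(Rintegral_cst_itv p c h0) -(Rintegral_cst_itv p eta h0) -RintegralB//.
apply: le_trans (le_normr_Rintegral _ iB) _ => //.
apply: le_Rintegral => //; exact: (integrable_norm iB).
Qed.

Definition riemann_sum (N : nat) (s : R) (g : R -> R) : R :=
  \sum_(l < N) s / N%:R * g (s / N%:R * l%:R).

Lemma riemann_sum_approx (g : R -> R) (s eta : R) (N : nat) : (0 < N)%N -> 0 <= s ->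
  {within `[0, +oo[, continuous g} ->
  (forall u v, 0 <= u <= s -> 0 <= v <= s -> `|u - v| <= s / N%:R ->
     `|g u - g v| <= eta) ->
  `|\int[mu]_(u in `[0, s]) g u - riemann_sum N s g| <= s * eta.
Proof.
move=> N0 s0 cg hg; set h := s / N%:R.
have N0' : 0 < N%:R :> R by rewrite ltr0n.
have h0 : 0 <= h by rewrite divr_ge0.
have hN : h * N%:R = s by rewrite divfK ?gt_eqF.
rewrite /riemann_sum -/h.
(* Induction on the number of cells with the mesh [h] kept fixed; each cell adds at most
   [h * eta]. *)
suff H k : (k <= N)%N -> `|\int[mu]_(u in `[0, h * k%:R]) g u -
    \sum_(l < k) h * g (h * l%:R)| <= h * k%:R * eta.
  by have := H N (leqnn N); rewrite hN.
elim: k => [_|k ih kN].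
  rewrite big_ord0 mulr0 mul0r set_itv1 Rintegral_set1 subr0 normr0//.
have hk0 : 0 <= h * k%:R by rewrite mulr_ge0.
rewrite big_ord_recr /= -natr1 mulrDr mulr1 mulrDl.
have := ih (ltnW kN).
have := @Rintegral_near_cst g (h * k%:R) h (g (h * k%:R)) eta hk0 h0 cg.
rewrite -(@Rintegral_itv_sub _ g (h * k%:R) (h * k%:R + h)); last 2 first.
- by rewrite hk0 lerDl.
- exact: integrable_half_line.
have le_s i : (i <= N)%N -> h * i%:R <= s.
  by move=> iN; rewrite -hN ler_wpM2l// ler_nat.
have kp : h * k%:R + h <= s.
  by have := le_s k.+1 kN; rewrite -natr1 mulrDr mulr1.
move=> /(_ _)/wrap[] => [u /andP[u1 u2]|].
  apply: hg; first by rewrite (le_trans hk0 u1) (le_trans u2).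
    by rewrite hk0 le_s// ltnW.
  by rewrite ger0_norm ?subr_ge0// lerBlDl.
set I1 := \int[mu]_(_ in _) _; set I2 := \int[mu]_(_ in _) _; set S := \sum_(_ < _) _.
move=> h1 h2; have := ler_normD (I1 - I2 - h * g (h * k%:R)) (I2 - S).
rewrite (_ : _ - _ - _ + _ = I1 - (S + h * g (h * k%:R))); last by ring.
by lra.
Qed.

End half_line_integrals.

(** * The covariance kernel: moduli of continuity, Riemann sums, one-sided derivatives *)

Section kernel.
Context {R : realType}.
Variable kappa : R -> R -> R.
Hypothesis kappa_cont : {within [set p : R * R | 0 <= p.1 /\ 0 <= p.2],
  continuous (fun p => kappa p.1 p.2)}.
Local Notation mu := (@lebesgue_measure R).

Lemma kernel_square_compact (M : R) : compact (`[0, M]%classic `*` `[0, M]%classic : set (R * R)).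
Proof. by apply: compact_setX; exact: segment_compact. Qed.

Lemma kernel_square_cont (M : R) :
  {within `[0, M]%classic `*` `[0, M]%classic, continuous (fun p => kappa p.1 p.2)}.
Proof.
apply: continuous_subspaceW kappa_cont => -[u v] /= [].
by rewrite !in_itv/= => /andP[-> _] /andP[-> _].
Qed.

Lemma kernel_uniform (M e : R) : 0 < e -> exists2 del, 0 < del &
  forall u v u' v', 0 <= u <= M -> 0 <= v <= M -> 0 <= u' <= M -> 0 <= v' <= M ->
    `|u - u'| < del -> `|v - v'| < del -> `|kappa u v - kappa u' v'| < e.
Proof.
move=> e0; have [del del0 h] := compact_uniformly_continuous
  (@kernel_square_compact M) (@kernel_square_cont M) e0.
exists del => // u v u' v' uM vM u'M v'M uu' vv'.
by apply: (h (u, v) (u', v')); rewrite /= ?in_itv.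
Qed.

Lemma kernel_bounded (M : R) : exists2 C, 0 < C &
  forall u v, 0 <= u <= M -> 0 <= v <= M -> `|kappa u v| <= C.
Proof.
have [C C0 h] := compact_continuous_bounded (@kernel_square_compact M) (@kernel_square_cont M).
by exists C => // u v uM vM; apply: (h (u, v)); rewrite /= !in_itv.
Qed.

Lemma kernel_section (u : R) : 0 <= u -> {within `[0, +oo[, continuous (kappa u)}.
Proof.
move=> u0; apply/within_continuous_epsP => v; rewrite /= in_itv/= andbT => v0 e e0.
have [del del0 h] := (iffLR (within_continuous_epsP _ _)) kappa_cont (u, v) (conj u0 v0) e e0.
exists del => // v'; rewrite /= in_itv/= andbT => v'0 vv'.
by apply: (h (u, v')); split => //; exact: ballxx.
Qed.

Lemma incr_var_small (M e : R) : 0 < e -> exists2 del, 0 < del &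
  forall u p, 0 <= u <= M -> 0 <= p <= M -> `|u - p| < del -> incr_var kappa u p <= e.
Proof.
move=> e0; have [|del del0 h] := @kernel_uniform M (e / 2); first by rewrite divr_gt0.
exists del => // u p uM pM up; rewrite /incr_var.
have d0 : `|u - u| < del by rewrite subrr normr0.
have d0' : `|p - p| < del by rewrite subrr normr0.
have pu : `|p - u| < del by rewrite distrC.
have := h u u u p uM uM uM pM d0 up; have := h p p p u pM pM pM uM d0' pu.
rewrite !ltr_norml; lra.
Qed.

Lemma incr_var_bounded (M : R) : exists2 s, 0 < s &
  forall u, 0 <= u <= M -> incr_var kappa u 0 <= s ^+ 2.
Proof.
have [C C0 h] := kernel_bounded M.
(* The increment variance is at most [4 C], which is below [(1 + 4 C)^2]; no square root is
   taken. *)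
exists (1 + 4 * C); first by lra.
move=> u uM; have M0 : 0 <= (0 : R) <= M by case/andP: uM => u0 uM; rewrite lexx (le_trans u0).
have := h u u uM uM; have := h u 0 uM M0; have := h 0 u M0 uM; have := h 0 0 M0 M0.
rewrite /incr_var !ler_norml => *.
have := sqr_ge0 C; nra.
Qed.

(** The covariance of [X s] and [Z u], and the derivative in [u] of [integrated_kernel u s]. At
    [u = T n] it is [d_0 (s)]. *)
Definition kernel_int (s u : R) : R := \int[mu]_(v in `[0, s]) kappa u v.

Lemma kernel_int_modulus (s u u' eta : R) : 0 <= s -> 0 <= u -> 0 <= u' ->
  (forall v, 0 <= v <= s -> `|kappa u v - kappa u' v| <= eta) ->
  `|kernel_int s u - kernel_int s u'| <= s * eta.
Proof.
move=> s0 u0 u'0 h; rewrite /kernel_int -RintegralB//; last 2 first.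
- by apply: integrable_half_line => //; exact: kernel_section.
- by apply: integrable_half_line => //; exact: kernel_section.
have cB : {within `[0, +oo[, continuous (fun v => kappa u v - kappa u' v)}.
  by move=> v; apply: cvgB; exact: kernel_section.
have := @Rintegral_near_cst _ (fun v => kappa u v - kappa u' v) 0 s 0 eta (lexx _) s0 cB.
by rewrite add0r mulr0 subr0; apply => v vs; rewrite subr0; exact: h.
Qed.

Lemma kernel_int_continuous (s : R) : 0 <= s -> {within `[0, +oo[, continuous (kernel_int s)}.
Proof.
move=> s0; apply/within_continuous_epsP => u; rewrite /= in_itv/= andbT => u0 e e0.
have s1 : 0 < s + 1 by lra.
have [|del del0 h] := @kernel_uniform (u + 1 + s) (e / (s + 1)); first by rewrite divr_gt0.
exists (Num.min del 1); first by rewrite lt_min del0 ltr01.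
move=> u'; rewrite /= in_itv/= andbT => u'0; rewrite /ball/= lt_min => /andP[uu' uu'1].
apply: le_lt_trans (@kernel_int_modulus s u u' (e / (s + 1)) s0 u0 u'0 _) _; last first.
  by rewrite mulrCA gtr_pMr// ltr_pdivrMr// mul1r; lra.
move=> v /andP[v0 vs]; apply/ltW/h => //.
- by lra.
- by lra.
- by rewrite u'0/=; move: uu'1; rewrite ltr_norml; lra.
- by lra.
- by rewrite subrr normr0.
Qed.

Lemma integrated_kernelE (t s : R) :
  integrated_kernel kappa t s = \int[mu]_(u in `[0, t]) kernel_int s u.
Proof. by []. Qed.

Lemma div_succ_lt (s del : R) : 0 <= s -> 0 < del ->
  \forall N \near \oo, s / N.+1%:R < del.
Proof.
move=> s0 del0; near=> N.
rewrite ltr_pdivrMr ?ltr0n// -ltr_pdivrMl//.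
rewrite (@lt_trans _ _ N%:R)// ?ltr_nat//.
by near: N; exact: nbhs_infty_gtr.
Unshelve. all: end_near. Qed.

Lemma riemann_sum_kernel_cvg (u s : R) : 0 <= u -> 0 <= s ->
  riemann_sum N.+1 s (kappa u) @[N --> \oo] --> kernel_int s u.
Proof.
move=> u0 s0; apply/cvgrPdist_le => e e0.
have s1 : 0 < s + 1 by lra.
have [|del del0 h] := @kernel_uniform (u + s) (e / (s + 1)); first by rewrite divr_gt0.
near=> N.
have hN : s / N.+1%:R < del by near: N; exact: div_succ_lt.
apply: le_trans (@riemann_sum_approx _ (kappa u) s (e / (s + 1)) N.+1 _ s0 _ _) _ => //.
- exact: kernel_section.
- move=> v v' /andP[v0 vs] /andP[v'0 v's] vv'.
  apply/ltW/h; rewrite ?subrr ?normr0//; try lra.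
  exact: le_lt_trans vv' hN.
- by rewrite mulrCA ger_pMr// ler_pdivrMr// mul1r; lra.
Unshelve. all: end_near. Qed.

(** The double sum is the covariance of two Riemann sums of [Z]; its limit identifies the limiting
    variance of the normal approximation. *)
Lemma riemann_sum_kernel_cvg2 (t s : R) : 0 <= t -> 0 <= s ->
  riemann_sum N.+1 t (fun u => riemann_sum N.+1 s (kappa u)) @[N --> \oo] -->
  integrated_kernel kappa t s.
Proof.
move=> t0 s0; apply/cvgrPdist_le => e e0.
pose M := t + s; have M1 : 0 < (M + 1) * (M + 1) * 2 by rewrite /M !mulr_gt0//; lra.
(* Each of the two successive discretizations costs [t s eta], and [2 t s <= 2 (M + 1)^2]. *)
set eta := e / ((M + 1) * (M + 1) * 2).
have eta0 : 0 < eta by rewrite divr_gt0.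
have [del del0 h] := @kernel_uniform M eta eta0.
near=> N.
have hNs : s / N.+1%:R < del by near: N; exact: div_succ_lt.
have hNt : t / N.+1%:R < del by near: N; exact: div_succ_lt.
have h1 u : 0 <= u <= t -> `|kernel_int s u - riemann_sum N.+1 s (kappa u)| <= s * eta.
  move=> /andP[u0 ut]; apply: riemann_sum_approx => //; first exact: kernel_section.
  move=> v v' /andP[v0 vs] /andP[v'0 v's] vv'.
  apply/ltW/h; rewrite ?subrr ?normr0// /M; try lra.
  exact: le_lt_trans vv' hNs.
have h2 : `|integrated_kernel kappa t s - riemann_sum N.+1 t (kernel_int s)| <= t * (s * eta).
  rewrite integrated_kernelE; apply: riemann_sum_approx => //; first exact: kernel_int_continuous.
  move=> u u' /andP[u0 ut] /andP[u'0 u't] uu'; apply: kernel_int_modulus => //.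
  move=> v /andP[v0 vs]; apply/ltW/h; rewrite ?subrr ?normr0// /M; try lra.
  exact: le_lt_trans uu' hNt.
have h3 : `|riemann_sum N.+1 t (kernel_int s) -
    riemann_sum N.+1 t (fun u => riemann_sum N.+1 s (kappa u))| <= t * (s * eta).
  rewrite /riemann_sum -sumrB; apply: le_trans (ler_norm_sum _ _ _) _.
  have hN0 : 0 <= t / N.+1%:R by rewrite divr_ge0.
  have -> : t * (s * eta) = \sum_(l < N.+1) t / N.+1%:R * (s * eta).
    by rewrite sumr_const card_ord -mulrnAl -[in RHS]mulr_natr divfK// pnatr_eq0.
  apply: ler_sum => l _; rewrite -mulrBr normrM ger0_norm// ler_wpM2l//.
  apply: h1; rewrite mulr_ge0//= -mulrA ler_piMr// mulrC ler_pdivrMr ?ltr0n//.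
  by rewrite mul1r ler_nat ltnW.
have := ler_normD (integrated_kernel kappa t s - riemann_sum N.+1 t (kernel_int s))
  (riemann_sum N.+1 t (kernel_int s) -
    riemann_sum N.+1 t (fun u => riemann_sum N.+1 s (kappa u))).
rewrite addrA subrK => /le_trans; apply.
apply: (@le_trans _ _ (2 * (t * s) * eta)); first by lra.
rewrite /eta mulrCA ger_pMr// ler_pdivrMr// mul1r /M.
by nra.
Unshelve. all: end_near. Qed.

Hypothesis kappa_sym : forall u v, 0 <= u -> 0 <= v -> kappa u v = kappa v u.

(** The double Riemann sums are symmetric term by term, and the symmetry passes to their limits. *)
Lemma integrated_kernelC (t s : R) : 0 <= t -> 0 <= s ->
  integrated_kernel kappa t s = integrated_kernel kappa s t.
Proof.
move=> t0 s0; have h1 := riemann_sum_kernel_cvg2 t0 s0.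
have h2 := riemann_sum_kernel_cvg2 s0 t0.
suff E : (fun N => riemann_sum N.+1 t (fun u => riemann_sum N.+1 s (kappa u))) =
    (fun N => riemann_sum N.+1 s (fun u => riemann_sum N.+1 t (kappa u))).
  by rewrite E in h1; apply: cvg_unique h1 h2.
apply/funext => N; rewrite /riemann_sum.
under eq_bigr do rewrite mulr_sumr.
rewrite exchange_big /=; apply: eq_bigr => i _; rewrite mulr_sumr; apply: eq_bigr => j _.
by rewrite mulrCA kappa_sym// mulr_ge0// divr_ge0.
Qed.

(** Only times [T n + h] with [h >= 0] occur, and the estimates use exactly this linear bound,
    uniform on [[0, h0]]. *)
Definition right_derivable (a : R) (f : R -> R) (f' : R) : Prop :=
  forall eta, 0 < eta -> exists2 h0, 0 < h0 &
    forall h, 0 <= h <= h0 -> `|f (a + h) - f a - h * f'| <= eta * h.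

Lemma right_derivableB a f f' g g' : right_derivable a f f' ->
  right_derivable a g g' -> right_derivable a (fun t => f t - g t) (f' - g').
Proof.
move=> df dg eta eta0; have e2 : 0 < eta / 2 by rewrite divr_gt0.
have [h1 h10 H1] := df _ e2; have [h2 h20 H2] := dg _ e2.
exists (Num.min h1 h2); first by rewrite lt_min h10.
move=> h /andP[h0]; rewrite le_min => /andP[hh1 hh2].
have := H1 h; rewrite h0 hh1 => /(_ isT); have := H2 h; rewrite h0 hh2 => /(_ isT).
have := ler_normB (f (a + h) - f a - h * f') (g (a + h) - g a - h * g').
rewrite (_ : _ - _ - _ - (_ - _ - _) =
  f (a + h) - g (a + h) - (f a - g a) - h * (f' - g')); last by ring.
by lra.
Qed.

Lemma right_derivableZ a f f' c : right_derivable a f f' ->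
  right_derivable a (fun t => f t * c) (f' * c).
Proof.
move=> df eta eta0; have c1 : 0 < `|c| + 1 by rewrite ltr_wpDl.
have [|h1 h10 H1] := df (eta / (`|c| + 1)); first by rewrite divr_gt0.
exists h1 => // h h01; have := H1 h h01.
rewrite (_ : _ * c - _ * c - _ * (_ * c) = (f (a + h) - f a - h * f') * c); last by ring.
rewrite normrM mulrAC ler_pdivlMr// => H.
apply: le_trans H; rewrite ler_wpM2l//; lra.
Qed.

Lemma integrated_kernel_continuous (s : R) : 0 <= s ->
  {within `[0, +oo[, continuous (integrated_kernel kappa ^~ s)}.
Proof.
move=> s0; have cF := kernel_int_continuous s0.
have key t h C : 0 <= t -> 0 <= h -> (forall u, t <= u <= t + h -> `|kernel_int s u| <= C) ->
    `|integrated_kernel kappa (t + h) s - integrated_kernel kappa t s| <= h * C.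
  move=> t0 h0 hC; rewrite !integrated_kernelE Rintegral_itv_sub ?t0 ?lerDl//; last first.
    exact: integrable_half_line.
  have := @Rintegral_near_cst _ (kernel_int s) t h 0 C t0 h0 cF.
  by rewrite mulr0 subr0; apply => u uth; rewrite subr0; exact: hC.
apply/within_continuous_epsP => t; rewrite /= in_itv/= andbT => t0 e e0.
have [C C0 hC] : exists2 C, 0 < C & forall u, `[0, t + 1]%classic u -> `|kernel_int s u| <= C.
  apply: compact_continuous_bounded; first exact: segment_compact.
  by apply: continuous_subspaceW cF => u /=; rewrite !in_itv/= andbT => /andP[].
exists (Num.min 1 (e / C)); first by rewrite lt_min ltr01 divr_gt0.
move=> y; rewrite /= in_itv/= andbT => y0; rewrite /ball/= lt_min ltr_pdivlMr// => /andP[ty1 tyC].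
have [ty|yt] := leP t y.
  rewrite distrC; apply: le_lt_trans tyC; rewrite (distrC t y) [X in _ <= X * _]ger0_norm ?subr_ge0//.
  rewrite -{1}(subrKC t y); apply: key => //; first by rewrite subr_ge0.
  move=> u; rewrite subrKC => /andP[tu uy]; apply: hC; rewrite /= in_itv/=.
  by move: ty1; rewrite ltr_norml; lra.
apply: le_lt_trans tyC; rewrite [X in _ <= X * _]ger0_norm ?subr_ge0 ?(ltW yt)//.
rewrite -{1}(subrKC y t); apply: key => //; first by rewrite subr_ge0 ltW.
move=> u; rewrite subrKC => /andP[tu uy]; apply: hC; rewrite /= in_itv/=.
by lra.
Qed.

Lemma integrated_kernel_right_derivable (a s : R) : 0 <= a -> 0 <= s ->
  right_derivable a (integrated_kernel kappa ^~ s) (kernel_int s a).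
Proof.
move=> a0 s0 eta eta0; have cF := kernel_int_continuous s0.
have [|del del0 hd] := (iffLR (within_continuous_epsP _ _)) cF a _ eta eta0.
  by rewrite /= in_itv/= andbT.
exists (del / 2); first by rewrite divr_gt0.
move=> h /andP[h0 hdel].
rewrite !integrated_kernelE Rintegral_itv_sub ?a0 ?lerDl//; last first.
  exact: integrable_half_line.
rewrite [eta * h]mulrC; apply: Rintegral_near_cst => // u /andP[au uah].
rewrite distrC; apply/ltW/hd; first by rewrite /= in_itv/= andbT; exact: le_trans au.
by rewrite /ball/= ltr_norml; lra.
Qed.

End kernel.

(** * Successive conditioning *)

Section gram_schmidt.
Context {R : comRingType}.

(** The coefficients [b] are independent of [f], so that the same ones serve for the path of [X],
    for the rows of the kernel and for [d_0]. *)
Lemma triangular_expansion (n : nat) (c : nat -> R) (l : nat -> nat -> R) :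
  exists b : nat -> R, forall f : nat -> R,
    \sum_(j < n) c j * (f j - \sum_(p < j) l j p * f p) = \sum_(i < n) b i * f i.
Proof.
elim: n => [|n [b hb]]; first by exists (fun=> 0) => f; rewrite !big_ord0.
exists (fun i => if (i == n)%N then c n else b i - c n * l n i) => f.
rewrite !big_ord_recr /= eqxx hb.
under [X in _ = X + _]eq_bigr => i _.
  rewrite ifF ?mulrBl -?mulrA; last by rewrite ltn_eqF.
  over.
by rewrite sumrB -mulr_sumr; ring.
Qed.

End gram_schmidt.

Section gram_schmidt_field.
Context {R : fieldType}.

(* [K] is a Gram matrix, [e j i] the product of the [j]-th orthogonalized vector
   with the [i]-th one, and [d0], [dd] the products with an outside vector. *)
Lemma gram_schmidt_quadratic (n : nat) (K e : nat -> nat -> R) (d0 dd c b : nat -> R)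
    (l : nat -> nat -> R) :
  (forall i j, (i < n)%N -> (j < n)%N -> K i j = K j i) ->
  (forall j i, (j < n)%N -> (i < n)%N -> e j i = K j i - \sum_(p < j) l j p * K p i) ->
  (forall j i, (j < n)%N -> (i < j)%N -> e j i = 0) ->
  (forall j, (j < n)%N -> e j j != 0) ->
  (forall j, dd j = d0 j - \sum_(p < j) l j p * d0 p) ->
  (forall j, c j = dd j / e j j) ->
  (forall f : nat -> R,
    \sum_(j < n) c j * (f j - \sum_(p < j) l j p * f p) = \sum_(i < n) b i * f i) ->
  - \sum_(j < n) dd j ^+ 2 / e j j =
  - (2 * \sum_(i < n) b i * d0 i) + \sum_(i < n) \sum_(m < n) b i * b m * K i m.
Proof.
move=> Ksym eK e0 en0 ddE cE hb; set S := \sum_(j < n) dd j ^+ 2 / e j j.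
(* The conclusion is [- S = - 2 S + S]: the cross term and the quadratic form both equal [S]. *)
have S1 : \sum_(i < n) b i * d0 i = S.
  by rewrite -hb; apply: eq_bigr => j _; rewrite -ddE cE expr2 mulrAC.
have lt_n (j : nat) (p : 'I_j) : (j < n)%N -> (p < n)%N by exact: ltn_trans.
(* The left side is the product of the [j]-th and [m]-th orthogonalized vectors, here expanded in
   [K]. *)
have side (j m : nat) : (j < n)%N -> (m < n)%N ->
    e j m - \sum_(q < m) l m q * e j q =
    K j m - \sum_(p < j) l j p * K p m - \sum_(q < m) l m q * K j q +
    \sum_(q < m) \sum_(p < j) l m q * (l j p * K p q).
  move=> jn mn.
  have -> : \sum_(q < m) l m q * e j q = \sum_(q < m) l m q * K j q -
      \sum_(q < m) \sum_(p < j) l m q * (l j p * K p q).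
    rewrite -sumrB; apply: eq_bigr => q _.
    by rewrite eK ?lt_n// mulrBr mulr_sumr.
  by rewrite eK//; ring.
(* This product is symmetric because [K] is, so its vanishing need only be checked for [m < j],
   where [e0] applies. *)
have elin (j m : nat) : (j < n)%N -> (m < n)%N ->
    e j m - \sum_(q < m) l m q * e j q =
    e m j - \sum_(p < j) l j p * e m p.
  move=> jn mn; rewrite !side// exchange_big /= (Ksym j m)//.
  have -> : \sum_(p < j) l j p * K p m = \sum_(p < j) l j p * K m p.
    by apply: eq_bigr => p _; rewrite (Ksym p m) ?lt_n.
  have -> : \sum_(q < m) l m q * K j q = \sum_(q < m) l m q * K q j.
    by apply: eq_bigr => q _; rewrite (Ksym q j) ?lt_n.
  have -> : \sum_(p < j) \sum_(q < m) l m q * (l j p * K p q) =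
      \sum_(p < j) \sum_(q < m) l j p * (l m q * K q p).
    by apply: eq_bigr => p _; apply: eq_bigr => q _; rewrite mulrCA (Ksym p q) ?lt_n.
  by ring.
have elow (j m : nat) : (j < n)%N -> (m <= j)%N ->
    e j m - \sum_(q < m) l m q * e j q = (m == j)%:R * e j j.
  move=> jn; rewrite leq_eqVlt => /predU1P[->|mj].
    rewrite eqxx mul1r big1 ?subr0// => q _; rewrite e0 ?mulr0//.
  rewrite ltn_eqF// mul0r e0// big1 ?subr0// => q _; rewrite e0 ?mulr0//.
  exact: ltn_trans (ltn_ord q) mj.
have eorth (j m : nat) : (j < n)%N -> (m < n)%N ->
    e j m - \sum_(q < m) l m q * e j q = (m == j)%:R * e j j.
  move=> jn mn; have [mj|jm] := leqP m j; first exact: elow.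
  by rewrite elin// elow ?(ltnW jm)// (gtn_eqF jm) (ltn_eqF jm) !mul0r.
(* Applying [hb] to the rows of [K], then to each [e j], replaces [b] by [c]; orthogonality leaves
   the sum of [c_j^2 e_jj]. *)
have S2 : \sum_(i < n) \sum_(m < n) b i * b m * K i m = S.
  transitivity (\sum_(i < n) b i * \sum_(j < n) c j * e j i).
    apply: eq_bigr => i _; under eq_bigr do rewrite -mulrA.
    rewrite -mulr_sumr; congr (_ * _).
    rewrite -(hb (K i)); apply: eq_bigr => j _; rewrite eK// (Ksym j i)//.
    congr (_ * (_ - _)); apply: eq_bigr => p _; rewrite (Ksym i p)//.
    exact: ltn_trans (ltn_ord p) (ltn_ord j).
  under eq_bigr do rewrite mulr_sumr.
  rewrite exchange_big /=; apply: eq_bigr => j _.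
  under eq_bigr do rewrite mulrCA.
  rewrite -mulr_sumr -(hb (e j)) (bigD1 j)//= eorth// eqxx mul1r big1.
    by rewrite addr0 cE divfK ?en0// expr2 mulrAC.
  move=> m mj; rewrite eorth// (negbTE (_ : (m != j :> nat)%N)) ?mul0r ?mulr0//.
by rewrite S1 S2; ring.
Qed.

End gram_schmidt_field.

(** * The conditional kernels and the variance a_n^2 *)

Section conditioning_algebra.
Context {R : realType}.
Variables (kappa : R -> R -> R) (T : nat -> R) (n : nat).
Hypothesis kappa_cont : {within [set p : R * R | 0 <= p.1 /\ 0 <= p.2],
  continuous (fun p => kappa p.1 p.2)}.
Hypothesis kappa_sym : forall u v, 0 <= u -> 0 <= v -> kappa u v = kappa v u.
Hypothesis T_ge0 : forall j, (1 <= j <= n)%N -> 0 <= T j.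
Hypothesis k_gt0 : forall j, (1 <= j <= n)%N -> 0 < cond_kernel kappa T j.-1 (T j) (T j).
Local Notation k := (cond_kernel kappa T).
Local Notation alpha := (alpha kappa T).
Local Notation d := (dcoef kappa T n).

(* The linear operator that maps the path of [X] to that of [X^j], for [x = 0]. *)
Fixpoint cond_lin (f : R -> R) (j : nat) (t : R) : R :=
  match j with
  | 0%N => f t
  | i.+1 => cond_lin f i t - alpha i.+1 t * cond_lin f i (T i.+1)
  end.

Lemma cond_linE (j : nat) (t : R) : exists l : nat -> R,
  forall f, cond_lin f j t = f t - \sum_(i < j) l i * f (T i.+1).
Proof.
elim: j t => [t|j ih t]; first by exists (fun=> 0) => f; rewrite big_ord0 subr0.
have [l hl] := ih t; have [l' hl'] := ih (T j.+1).
exists (fun i => if (i == j)%N then alpha j.+1 t else l i - alpha j.+1 t * l' i) => f.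
rewrite /= hl hl' big_ord_recr /= eqxx.
under [X in _ = _ - (X + _)]eq_bigr => i _.
  rewrite ifF ?mulrBl; last by rewrite ltn_eqF.
  over.
rewrite sumrB.
under [X in _ = _ - (_ - X + _)]eq_bigr do rewrite -mulrA.
by rewrite -mulr_sumr; ring.
Qed.

Lemma cond_kernelC (j : nat) (t s : R) : (j <= n)%N -> 0 <= t -> 0 <= s ->
  k j t s = k j s t.
Proof.
elim: j t s => [|j ih] t s jn t0 s0; first exact: integrated_kernelC.
by rewrite /= (ih t s (ltnW jn))//; ring.
Qed.

(** Conditioning acts on the first variable of the kernel as it acts on a path. Symmetry is needed
    because the recursion for [k_j] evaluates the last factor at [(s, T_j)], whereas [cond_lin]
    substitutes [T_j] for [t]. *)
Lemma cond_kernel_lin (j : nat) (t s : R) : (j <= n)%N -> 0 <= t -> 0 <= s ->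
  k j t s = cond_lin (integrated_kernel kappa s) j t.
Proof.
elim: j t s => [|j ih] t s jn t0 s0; first exact: integrated_kernelC.
rewrite /= -(ih t s (ltnW jn) t0 s0) -(ih (T j.+1) s (ltnW jn) _ s0) ?T_ge0//.
by rewrite (@cond_kernelC j s) ?T_ge0// ltnW.
Qed.

Lemma dcoef_lin (j : nat) (t : R) : d j t = cond_lin (d 0) j t.
Proof. by elim: j t => // j ih t; rewrite /= -!ih. Qed.

(** The process [X^j] is deterministic at [T_1, ..., T_j]. This is the orthogonality used in the
    Gram-Schmidt identity. *)
Lemma cond_kernel_eq0 (j l : nat) (s : R) : (j <= n)%N -> (1 <= l <= j)%N -> 0 <= s ->
  k j (T l) s = 0.
Proof.
elim: j l s => [|j ih] l s jn /andP[l1 lj] s0; first by case: l l1 lj.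
have Tj : 0 <= T j.+1 by rewrite T_ge0.
have kj : k j (T j.+1) (T j.+1) != 0.
  by rewrite gt_eqF//; have := @k_gt0 j.+1; apply.
move: lj; rewrite leq_eqVlt => /predU1P[->|lj] /=.
  by rewrite divff// mul1r (@cond_kernelC j s)// ?subrr// ltnW.
have l1j : (1 <= l <= j)%N by rewrite l1.
by rewrite !(ih l _ (ltnW jn) l1j)// mul0r mul0r subr0.
Qed.

(** The right derivative at [T_n] of [alpha_{j+1}], called [beta_{j+1}] in the overview. *)
Definition dirac_coef (j : nat) : R := d j (T j.+1) / k j (T j.+1) (T j.+1).

(** The second identity presents [a_n^2] as the variance of [Z_{T_n}] minus the sum of the
    [b_i X_{T_{i+1}}]: its three terms are those of the expanded square. *)
Lemma orthogonal_expansion : exists b : nat -> R,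
  (forall f, \sum_(j < n) dirac_coef j * cond_lin f j (T j.+1) =
             \sum_(i < n) b i * f (T i.+1)) /\
  asq kappa T n = kappa (T n) (T n) - 2 * \sum_(i < n) b i * d 0 (T i.+1) +
    \sum_(i < n) \sum_(l < n) b i * b l * integrated_kernel kappa (T i.+1) (T l.+1).
Proof.
have [l hl] := choice (fun j => cond_linE j (T j.+1)).
have [b hb] := triangular_expansion n dirac_coef l.
exists b; split=> [f|].
  by rewrite -(hb (fun i => f (T i.+1))); apply: eq_bigr => j _; rewrite hl.
have T0 (i : nat) : (i < n)%N -> 0 <= T i.+1 by move=> ni; rewrite T_ge0.
have kC := integrated_kernelC kappa_cont kappa_sym.
pose K (i m : nat) := integrated_kernel kappa (T i.+1) (T m.+1).
pose e (j i : nat) := k j (T j.+1) (T i.+1).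
have KC i m : (i < n)%N -> (m < n)%N -> K i m = K m i.
  by move=> ni nm; exact: (kC _ _ (T0 _ ni) (T0 _ nm)).
have eK j i : (j < n)%N -> (i < n)%N -> e j i = K j i - \sum_(p < j) l j p * K p i.
  move=> nj ni; rewrite (KC j i nj ni) (_ : \sum_(p < j) _ = \sum_(p < j) l j p * K i p).
    by rewrite /e (cond_kernel_lin (ltnW nj) (T0 _ nj) (T0 _ ni)) hl.
  apply: eq_bigr => p _; apply: congr2; first by [].
  by apply: KC => //; exact: ltn_trans (ltn_ord p) nj.
have e0 j i : (j < n)%N -> (i < j)%N -> e j i = 0.
  move=> nj ij; have ni := ltn_trans ij nj.
  rewrite /e (cond_kernelC (ltnW nj) (T0 _ nj) (T0 _ ni)).
  by rewrite (cond_kernel_eq0 (ltnW nj) _ (T0 _ nj)).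
have en0 j : (j < n)%N -> e j j != 0.
  by move=> nj; rewrite gt_eqF//; exact: (@k_gt0 j.+1 nj).
have ddE j : d j (T j.+1) = d 0 (T j.+1) - \sum_(p < j) l j p * d 0 (T p.+1).
  by rewrite dcoef_lin hl.
have cE j : dirac_coef j = d j (T j.+1) / e j j by [].
have := gram_schmidt_quadratic KC eK e0 en0 ddE cE hb.
rewrite /asq big_add1 big_mkord -addrA => <-.
by [].
Qed.

Lemma cond_kernel_continuous (j : nat) (s : R) : (j <= n)%N -> 0 <= s ->
  {within `[0, +oo[, continuous (k j ^~ s)}.
Proof.
elim: j s => [|j ih] s jn s0; first exact: integrated_kernel_continuous.
have c1 := ih s (ltnW jn) s0; have c2 := ih (T j.+1) (ltnW jn) (@T_ge0 j.+1 jn).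
move=> t /=; apply: cvgB; first exact: c1.
apply: cvgM; last exact: cvg_cst.
by apply: cvgM; [exact: c2|exact: cvg_cst].
Qed.

(** This explains the recursion for [d_j]: differentiating that of [k_j] in [t], the factor
    independent of [t] is [alpha_{j+1} (s)]. *)
Lemma cond_kernel_right_derivable (j : nat) (s : R) : (1 <= n)%N -> (j <= n)%N -> 0 <= s ->
  right_derivable (T n) (k j ^~ s) (d j s).
Proof.
move=> n1; have Tn : 0 <= T n by rewrite T_ge0// n1 leqnn.
elim: j s => [|j ih] s jn s0; first exact: integrated_kernel_right_derivable.
have d1 := ih s (ltnW jn) s0; have d2 := ih (T j.+1) (ltnW jn) (@T_ge0 j.+1 jn).
rewrite /= [X in right_derivable _ _ X](_ : _ = d j s -
  d j (T j.+1) * ((k j (T j.+1) (T j.+1))^-1 * k j s (T j.+1))); last first.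
  by rewrite /Defs.alpha /=; ring.
rewrite [X in right_derivable _ X](_ : _ = fun t => k j t s -
  k j t (T j.+1) * ((k j (T j.+1) (T j.+1))^-1 * k j s (T j.+1))); last first.
  by apply/funext => t; rewrite mulrA.
by apply: right_derivableB => //; exact: right_derivableZ.
Qed.

Lemma alpha_continuous (j : nat) : (j < n)%N -> {within `[0, +oo[, continuous (alpha j.+1)}.
Proof.
move=> jn t; apply: cvgM; last exact: cvg_cst.
exact: (cond_kernel_continuous (ltnW jn) (@T_ge0 j.+1 jn)).
Qed.

Lemma alpha_right_derivable (j : nat) : (j < n)%N ->
  right_derivable (T n) (alpha j.+1) (dirac_coef j).
Proof.
move=> jn; apply: right_derivableZ.
by apply: cond_kernel_right_derivable => //; [case: n jn|exact: ltnW|exact: (@T_ge0 j.+1 jn)].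
Qed.

End conditioning_algebra.

Section conditioned_paths.
Context {R : realType} (kappa : R -> R -> R) (T : nat -> R).
Variables (Omega : Type) (X : R -> Omega -> R) (x : nat -> R).
Local Notation CP := (cond_process kappa T X x).
Local Notation alpha := (alpha kappa T).

Lemma cond_processE (j : nat) (t : R) (w : Omega) :
  CP j t w = X t w - \sum_(i < j) alpha i.+1 t * (CP i (T i.+1) w - x i.+1).
Proof.
elim: j => [|j ih] /=; first by rewrite big_ord0 subr0.
by rewrite ih big_ord_recr /=; ring.
Qed.

(** The conditioning values enter only through the constant [m], independent of [w]; it will
    contribute a deterministic drift of order [e]. *)
Lemma cond_process_lin (j : nat) (t : R) : exists m : R, forall w,
  CP j t w = cond_lin kappa T (X ^~ w) j t + m.
Proof.
elim: j t => [t|j ih t]; first by exists 0 => w; rewrite addr0.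
have [m hm] := ih t; have [m' hm'] := ih (T j.+1).
exists (m - alpha j.+1 t * (m' - x j.+1)) => w.
by rewrite /= hm hm'; ring.
Qed.

End conditioned_paths.

(** * Exponentially good approximation *)

Section riemann_combination.
Context {R : realType}.

(* A list of pairs (coefficient, time). *)
Definition riemann_comb (n : nat) (T b : nat -> R) (N : nat) : seq (R * R) :=
  (1, T n) :: [seq (- b i * (T i.+1 / N.+1%:R), T i.+1 / N.+1%:R * l%:R)
                 | i <- iota 0 n, l <- iota 0 N.+1].

Lemma riemann_comb_sum (n : nat) (T b : nat -> R) (N : nat) (g : R -> R) :
  \sum_(p <- riemann_comb n T b N) p.1 * g p.2 =
  g (T n) - \sum_(i < n) b i * riemann_sum N.+1 (T i.+1) g.
Proof.
rewrite /riemann_comb big_cons mul1r big_flatten big_map -sumrN; congr (_ + _).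
have iotaE k : iota 0 k = index_iota 0 k by rewrite /index_iota subn0.
rewrite iotaE big_mkord; apply: eq_bigr => i _.
rewrite big_map iotaE big_mkord -mulNr mulr_sumr.
by apply: eq_bigr => l _ /=; rewrite -!mulrA.
Qed.

Lemma riemann_comb_ge0 (n : nat) (T b : nat -> R) (N : nat) : (1 <= n)%N ->
  (forall j, (1 <= j <= n)%N -> 0 <= T j) ->
  all (fun p => 0 <= p.2) (riemann_comb n T b N).
Proof.
move=> n1 T0; apply/allP => p; rewrite inE => /predU1P[->/=|].
  by rewrite T0// n1 leqnn.
move=> /flatten_mapP[i]; rewrite mem_iota add0n => /andP[_ ni] /mapP[l _ ->]/=.
by rewrite mulr_ge0// divr_ge0// T0.
Qed.

Lemma riemann_sumB (N : nat) (s : R) (f g : R -> R) :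
  riemann_sum N s (fun u => f u - g u) = riemann_sum N s f - riemann_sum N s g.
Proof. by rewrite /riemann_sum -sumrB; apply: eq_bigr => l _; rewrite mulrBr. Qed.

Lemma riemann_sum_sum (N n : nat) (s : R) (b : nat -> R) (f : nat -> R -> R) :
  riemann_sum N s (fun u => \sum_(i < n) b i * f i u) =
  \sum_(i < n) b i * riemann_sum N s (f i).
Proof.
rewrite /riemann_sum; under eq_bigr do rewrite mulr_sumr.
rewrite exchange_big /=; apply: eq_bigr => i _; rewrite mulr_sumr.
by apply: eq_bigr => l _; rewrite mulrCA.
Qed.

Variable kappa : R -> R -> R.
Hypothesis kappa_cont : {within [set p : R * R | 0 <= p.1 /\ 0 <= p.2],
  continuous (fun p => kappa p.1 p.2)}.
Hypothesis kappa_sym : forall u v, 0 <= u -> 0 <= v -> kappa u v = kappa v u.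

Definition comb_var (s : seq (R * R)) : R :=
  \sum_(p <- s) \sum_(q <- s) p.1 * q.1 * kappa p.2 q.2.

Lemma riemann_comb_var (n : nat) (T b : nat -> R) (N : nat) :
  (forall j, (1 <= j <= n)%N -> 0 <= T j) -> (1 <= n)%N ->
  comb_var (riemann_comb n T b N) =
  kappa (T n) (T n) -
  2 * \sum_(i < n) b i * riemann_sum N.+1 (T i.+1) (kappa (T n)) +
  \sum_(i < n) \sum_(m < n) b i * b m *
    riemann_sum N.+1 (T i.+1) (fun u => riemann_sum N.+1 (T m.+1) (kappa u)).
Proof.
move=> T0 n1; rewrite /comb_var.
transitivity (\sum_(p <- riemann_comb n T b N) p.1 *
    (kappa p.2 (T n) - \sum_(i < n) b i * riemann_sum N.+1 (T i.+1) (kappa p.2))).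
  apply: eq_bigr => p _; rewrite -(riemann_comb_sum n T b N (kappa p.2)) mulr_sumr.
  by apply: eq_bigr => q _; rewrite mulrA.
rewrite (riemann_comb_sum n T b N (fun u => kappa u (T n) -
  \sum_(i < n) b i * riemann_sum N.+1 (T i.+1) (kappa u))).
have -> : \sum_(i < n) b i * riemann_sum N.+1 (T i.+1) (fun u => kappa u (T n) -
      \sum_(i0 < n) b i0 * riemann_sum N.+1 (T i0.+1) (kappa u)) =
    \sum_(i < n) b i * riemann_sum N.+1 (T i.+1) (kappa (T n)) -
    \sum_(i < n) \sum_(m < n) b i * b m *
    riemann_sum N.+1 (T i.+1) (fun u => riemann_sum N.+1 (T m.+1) (kappa u)).
  rewrite -sumrB; apply: eq_bigr => i _.
  rewrite riemann_sumB mulrBr; congr (_ - _).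
    congr (_ * _); apply: eq_bigr => l _; congr (_ * _); apply: kappa_sym.
      by rewrite mulr_ge0// divr_ge0// T0/= ?ltn_ord.
    by rewrite T0// n1 leqnn.
  rewrite (riemann_sum_sum N.+1 n (T i.+1) b (fun m u => riemann_sum N.+1 (T m.+1) (kappa u))).
  by rewrite mulr_sumr; apply: eq_bigr => m _; rewrite mulrA.
by ring.
Qed.

Lemma riemann_comb_var_cvg (n : nat) (T b : nat -> R) :
  (forall j, (1 <= j <= n)%N -> 0 <= T j) -> (1 <= n)%N ->
  comb_var (riemann_comb n T b N) @[N --> \oo] -->
  kappa (T n) (T n) - 2 * \sum_(i < n) b i * kernel_int kappa (T i.+1) (T n) +
  \sum_(i < n) \sum_(m < n) b i * b m * integrated_kernel kappa (T i.+1) (T m.+1).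
Proof.
move=> T0 n1; under eq_fun do rewrite riemann_comb_var//.
have Tn0 : 0 <= T n by rewrite T0// n1 leqnn.
have Ti0 (i : 'I_n) : 0 <= T i.+1 by rewrite T0/= ?ltn_ord.
apply: cvgD.
  apply: cvgB; first exact: cvg_cst.
  apply: cvgM; first exact: cvg_cst.
  apply: cvg_big => [|i _]; first exact: add_continuous.
  by apply: cvgM; [exact: cvg_cst|exact: riemann_sum_kernel_cvg].
apply: cvg_big => [|i _]; first exact: add_continuous.
apply: cvg_big => [|m _]; first exact: add_continuous.
by apply: cvgM; [exact: cvg_cst|exact: riemann_sum_kernel_cvg2].
Qed.

End riemann_combination.

(** * Riemann sums and crude bounds for the paths *)

Section path_bounds.
Context {R : realType} {d : measure_display} {Omega : measurableType d}.
Variable P : probability Omega R.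
Variables (Z X : R -> {RV P >-> R}) (kappa : R -> R -> R).
Hypothesis Zgauss : centered_gaussian_process Z.
Hypothesis Zcov : has_covariance Z kappa.
Hypothesis Zmeas : jointly_measurable Z.
Hypothesis Xcont : continuous_paths X.
Hypothesis Xint : integrated_process Z X.
Local Notation mu := (@lebesgue_measure R).
Local Notation intZ q w := (mu.-integrable `[0, q] (EFin \o (Z ^~ w))).

Lemma integrable_sub0 (p q : R) (w : Omega) : p <= q -> intZ q w -> intZ p w.
Proof.
by move=> pq iZ; apply: integrableS iZ => //; apply: subset_itvl; rewrite bnd_simp.
Qed.

(** The increments of [X] over the cells telescope, and [N.+1] errors [h * m] add up to [q * m]. The
    factor [N.+1] in the probability is harmless, as [N] will not depend on [e]. *)
Lemma riemann_path_tail (s m q : R) (N : nat) : 0 < s -> 0 < m -> 0 < q ->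
  (forall p u, 0 <= p <= q -> 0 <= u <= q -> `|u - p| <= q / N.+1%:R ->
    incr_var kappa u p <= s ^+ 2) ->
  outside_event P (N.+1%:R * gauss_bound (m ^+ 2 / (4 * s ^+ 2)))
    (fun w => intZ q w -> X 0 w = 0 ->
      `|X q w - riemann_sum N.+1 q (Z ^~ w)| <= q * m).
Proof.
move=> s0 m0 q0 var; set h := q / N.+1%:R.
have N0 : 0 < N.+1%:R :> R by rewrite ltr0n.
have h0 : 0 < h by rewrite divr_gt0.
have hN : h * N.+1%:R = q by rewrite divfK ?gt_eqF.
have hl0 l : 0 <= h * l%:R by rewrite mulr_ge0// ltW.
have hlq l : (l < N.+1)%N -> h * l%:R + h <= q.
  move=> lN; rewrite -[X in _ + X]mulr1 -mulrDr natr1 -hN ler_wpM2l ?ler_nat//.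
  exact: ltW.
have H l : (l < N.+1)%N -> outside_event P (gauss_bound (m ^+ 2 / (4 * s ^+ 2)))
    (fun w => intZ q w -> `|X (h * l%:R + h) w - X (h * l%:R) w - h * Z (h * l%:R) w| <= h * m).
  move=> lN; have := path_tail Zgauss Zcov Zmeas Xcont Xint (hl0 l) h0 s0 m0.
  move=> /(_ _)/wrap[u /andP[u1 u2]|].
    have hh := hlq l lN; have := hl0 l => hl.
    apply: var; [by apply/andP; split; lra|by apply/andP; split; lra|].
    by rewrite ger0_norm ?subr_ge0// lerBlDl.
  apply: outside_event_sub => // w hw iZ.
  have := hw (integrable_sub0 (hlq l lN) iZ) 1; rewrite !mulr1; apply.
  by rewrite ler01 lexx.
apply: outside_event_sub (outside_event_forall H) => // w hw iZ X0.
suff S k : (k <= N.+1)%N -> `|X (h * k%:R) w - \sum_(l < k) h * Z (h * l%:R) w| <= h * k%:R * m.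
  by have := S _ (leqnn N.+1); rewrite hN.
elim: k => [_|k ih kN]; first by rewrite big_ord0 mulr0 X0 subr0 normr0 mul0r.
have := ih (ltnW kN); have := hw k kN iZ.
rewrite big_ord_recr/= -natr1 mulrDr mulr1 mulrDl.
set S := \sum_(_ < _) _ => h1 h2.
have := ler_normD (X (h * k%:R + h) w - X (h * k%:R) w - h * Z (h * k%:R) w)
  (X (h * k%:R) w - S).
rewrite (_ : _ - _ - _ + _ = X (h * k%:R + h) w - (S + h * Z (h * k%:R) w)); last by ring.
by lra.
Qed.

Lemma path_sup_tail (s m q : R) : 0 < s -> 0 < m -> 0 < q ->
  (forall u, 0 <= u <= q -> incr_var kappa u 0 <= s ^+ 2) ->
  outside_event P (gauss_bound (m ^+ 2 / (4 * s ^+ 2)))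
    (fun w => intZ q w -> X 0 w = 0 -> `|Z 0 w| <= m -> `|X q w| <= 2 * q * m).
Proof.
move=> s0 m0 q0 var.
have := path_tail Zgauss Zcov Zmeas Xcont Xint (lexx 0) q0 s0 m0.
move=> /(_ _)/wrap[u|]; first by rewrite add0r; exact: var.
apply: outside_event_sub => // w hw iZ X0 Z0.
have := hw; rewrite add0r => /(_ iZ 1); rewrite mulr1 add0r X0 subr0 => /(_ _)/wrap[|h].
  by rewrite ler01 lexx.
have := ler_normD (X q w - q * Z 0 w) (q * Z 0 w); rewrite subrK normrM (gtr0_norm q0).
have : q * `|Z 0 w| <= q * m by rewrite ler_wpM2l// ltW.
by lra.
Qed.

Lemma normal_outside (D : Omega -> R) (sigma s y : R) : normal_law P D sigma ->
  sigma ^+ 2 <= s ^+ 2 -> 0 < s -> 0 <= y ->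
  outside_event P (gauss_bound (y ^+ 2 / (4 * s ^+ 2))) (fun w => `|D w| <= y).
Proof.
move=> law ss s0 y0; exists [set w | y <= `|D w|]; last first.
  by move=> w /= /negP; rewrite -ltNge => /ltW.
split.
  rewrite -[X in measurable X]setTI; apply: measurable_fun_le => //.
  by apply: measurableT_comp => //; exact: law.1.
have r01 : 0 < (2^-1 : R) <= 1 by apply/andP; split; lra.
apply: le_trans (normal_tail law ss s0 r01 y0) _; rewrite lee_fin /gauss_bound.
rewrite (_ : (1 - 2^-1) * y ^+ 2 / (2 * s ^+ 2) = y ^+ 2 / (4 * s ^+ 2))//.
by field; rewrite gt_eqF.
Qed.

Lemma path0 : {ae P, forall w, X 0 w = 0}.
Proof.
have := Xint (lexx 0); apply: filterS => w ->.
by rewrite set_itv1 Rintegral_set1.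
Qed.

End path_bounds.

Section exponentially_good_approximation.
Context {R : realType} {d : measure_display} {Omega : measurableType d}.
Variable P : probability Omega R.

(* [D] may depend on [K] and [delta]: no limit of these normal variables is ever
   taken. *)
Definition exp_good_approx (V : R -> Omega -> R -> R) (v : R) : Prop :=
  forall K delta, 0 < K -> 0 < delta -> exists (D : Omega -> R) (sigma C e0 : R),
    [/\ normal_law P D sigma, `|sigma ^+ 2 - v| <= delta, 0 < e0 &
      forall e, 0 < e < e0 -> outside_event P (C * expR (- (K / e ^+ 2)))
        (fun w => forall t, 0 <= t <= 1 -> `|V e w t - e * t * D w| <= delta)].

(** The level is chosen so that its product with [e] is [2 s (K + 1)], free of [e], while the
    exponent is [(K + 1)^2 / e^2], at least [K / e^2]. *)
Lemma gauss_bound_scaled (s e K : R) : 0 < s -> 0 < e -> 0 < K ->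
  gauss_bound ((2 * s * (K + 1) / e) ^+ 2 / (4 * s ^+ 2)) <=
  gauss_bound 0 * expR (- (K / e ^+ 2)).
Proof.
move=> s0 e0 K0; rewrite /gauss_bound oppr0 expR0 mulr1.
apply: ler_wpM2l; first by rewrite invr_ge0.
rewrite ler_expR lerN2 (_ : _ / (4 * _) = (K + 1) ^+ 2 / e ^+ 2); last first.
  by field; rewrite !gt_eqF.
by rewrite ler_wpM2r ?invr_ge0 ?sqr_ge0//; have := sqr_ge0 K; lra.
Qed.

Lemma ler_normB4 (a b c d' delta : R) :
  `|a| <= delta / 4 -> `|b| <= delta / 4 -> `|c| <= delta / 4 -> `|d'| <= delta / 4 ->
  `|a - b - c - d'| <= delta.
Proof.
rewrite !ler_norml => /andP[? ?] /andP[? ?] /andP[? ?] /andP[? ?].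
by apply/andP; split; lra.
Qed.

Lemma right_derivable_uniform (n : nat) (a : R) (f : nat -> R -> R) (f' : nat -> R) :
  (forall j, (j < n)%N -> right_derivable a (f j) (f' j)) ->
  forall eta, 0 < eta -> exists2 h0, 0 < h0 & forall j h, (j < n)%N ->
    0 <= h <= h0 -> `|f j (a + h) - f j a - h * f' j| <= eta * h.
Proof.
elim: n => [_ eta _|n ih df eta eta0]; first by exists 1.
have [h1 h10 H1] := ih (fun j jn => df j (ltnW jn)) eta eta0.
have [h2 h20 H2] := df n (ltnSn n) eta eta0.
exists (Num.min h1 h2); first by rewrite lt_min h10.
move=> j h jn /andP[h0]; rewrite le_min => /andP[hh1 hh2].
move: jn; rewrite ltnS leq_eqVlt => /predU1P[->|jn].
  by apply: H2; rewrite h0.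
by apply: H1 => //; rewrite h0.
Qed.

End exponentially_good_approximation.

(** * The conditioned process near its last conditioning time *)

Section conditioned_approximation.
Context {R : realType} {d : measure_display} {Omega : measurableType d}.
Variable P : probability Omega R.
Variables (kappa : R -> R -> R) (Z X : R -> {RV P >-> R}) (n : nat) (T x : nat -> R).
Hypothesis kappa_cont : {within [set p : R * R | 0 <= p.1 /\ 0 <= p.2],
  continuous (fun p => kappa p.1 p.2)}.
Hypothesis Zgauss : centered_gaussian_process Z.
Hypothesis Zcov : has_covariance Z kappa.
Hypothesis Zmeas : jointly_measurable Z.
Hypothesis Xcont : continuous_paths X.
Hypothesis Xint : integrated_process Z X.
Hypothesis n1 : (1 <= n)%N.
Hypothesis T1_gt0 : 0 < T 1%N.
Hypothesis T_incr : forall j : nat, (1 <= j < n)%N -> T j < T j.+1.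
Hypothesis k_gt0 : forall j : nat, (1 <= j <= n)%N -> 0 < cond_kernel kappa T j.-1 (T j) (T j).
Local Notation mu := (@lebesgue_measure R).
Local Notation CP := (cond_process kappa T X x).
Local Notation al := (alpha kappa T).
Local Notation beta := (dirac_coef kappa T n).

Lemma covariance_sym u v : 0 <= u -> 0 <= v -> kappa u v = kappa v u.
Proof.
by move=> u0 v0; apply: EFin_inj; rewrite -(Zcov u0 v0) -(Zcov v0 u0) covarianceC.
Qed.

Lemma times_gt0 j : (1 <= j <= n)%N -> 0 < T j.
Proof.
elim: j => // -[//|j] ih jn; apply: lt_trans (ih _) (T_incr _) => //.
by rewrite /= ltnW.
Qed.

Lemma times_le j : (1 <= j <= n)%N -> T j <= T n.
Proof.
move=> /andP[j1 jn]; suff H k : (j + k <= n)%N -> T j <= T (j + k)%N.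
  by have := H (n - j)%N; rewrite subnKC//; exact.
elim: k => [|k ih]; first by rewrite addn0.
rewrite addnS => jk; apply: le_trans (ih (ltnW jk)) _; apply/ltW/T_incr.
by rewrite jk (leq_trans j1)// leq_addr.
Qed.

Let T_ge0 j : (1 <= j <= n)%N -> 0 <= T j.
Proof. by move=> /times_gt0/ltW. Qed.

Let Tn_gt0 : 0 < T n.
Proof. by apply: times_gt0; rewrite n1 leqnn. Qed.

Lemma cond_process_T w : CP n (T n) w = x n.
Proof.
move: n1 k_gt0; case: n => // m _ k0 /=.
have := k0 m.+1; rewrite leqnn => /(_ isT) km.
by rewrite /alpha/= divff ?gt_eqF// mul1r opprB addrC subrK.
Qed.

Lemma cond_process_increment (h : R) (w : Omega) :
  CP n (T n + h) w - x n = X (T n + h) w - X (T n) w -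
  \sum_(j < n) (al j.+1 (T n + h) - al j.+1 (T n)) * (CP j (T j.+1) w - x j.+1).
Proof.
rewrite -(cond_process_T w) !(@cond_processE _ _ _ _ _ _ n).
under [in RHS]eq_bigr do rewrite mulrBl.
by rewrite sumrB; ring.
Qed.

Lemma cond_exp_good_approx :
  exp_good_approx P (fun e w t => CP n (T n + e * t) w - x n) (asq kappa T n).
Proof.
move=> K delta K0 delta0.
have [b [hb hasq]] := orthogonal_expansion kappa_cont covariance_sym T_ge0 k_gt0.
have [l hl] := choice (fun j => cond_linE kappa T j (T j.+1)).
have [mm hmm] := choice (fun j => cond_process_lin kappa T X x j (T j.+1)).
have Ti0 i : (i < n)%N -> 0 < T i.+1 by move=> ni; exact: times_gt0.
have TiTn i : (i < n)%N -> T i.+1 <= T n by move=> ni; exact: times_le.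
have K1 : 0 < K + 1 by lra.
have [sig0 law0] := gaussian_marginal_law Zgauss (lexx 0).
have [sM0 sM00 hsM0] := incr_var_bounded kappa_cont (T n + 1).
(* Dominates both the deviation of [Z 0] and those of the increments from 0; with [M] below, the
   level [M / e] has the form required by [gauss_bound_scaled]. *)
pose sM := sM0 + `|sig0| + 1.
have sM_gt0 : 0 < sM by rewrite /sM; have := normr_ge0 sig0; lra.
have hsM u : 0 <= u <= T n + 1 -> incr_var kappa u 0 <= sM ^+ 2.
  move=> /hsM0 /le_trans; apply; rewrite ler_sqr ?nnegrE ?(ltW sM00) ?(ltW sM_gt0)//.
  by rewrite /sM; have := normr_ge0 sig0; lra.
have hsig0 : sig0 ^+ 2 <= sM ^+ 2.
  rewrite -(real_normK (num_real sig0)) ler_sqr ?nnegrE ?(ltW sM_gt0)//.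
  by rewrite /sM; have := sM00; lra.
pose M := 2 * sM * (K + 1).
have M_gt0 : 0 < M by rewrite /M !mulr_gt0.
pose c0 := \sum_(j < n) beta j * (mm j - x j.+1).
(* Outside the exceptional event [X^j_{T_{j+1}} - x_{j+1}] is at most [Cg j / e]; this uses [e < 1]
   for the constant term. *)
pose Cg (j : nat) := 2 * T j.+1 * M + \sum_(i < j) `|l j i| * (2 * T i.+1 * M) + `|mm j - x j.+1|.
have TM0 i : (i < n)%N -> 0 <= 2 * T i.+1 * M.
  by move=> ni; rewrite !mulr_ge0// ?(ltW M_gt0)// ltW// Ti0.
have Cg0 (j : 'I_n) : 0 <= Cg j.
  rewrite /Cg; apply: addr_ge0 => //; apply: addr_ge0; first exact: TM0.
  apply: sumr_ge0 => i _; apply: mulr_ge0 => //; apply: TM0.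
  exact: ltn_trans (ltn_ord i) (ltn_ord j).
pose CG := \sum_(j < n) Cg j + 1.
have CG0 : 0 < CG by rewrite ltr_wpDl// sumr_ge0.
(* The derivative errors, at most [eta * e], multiply factors [Cg j / e]; the powers of [e] cancel
   and the sum is at most [delta / 4]. *)
pose eta := delta / (4 * CG).
have eta0 : 0 < eta by rewrite divr_gt0// mulr_gt0.
have [h0 h00 hder] := right_derivable_uniform
  (fun j jn => alpha_right_derivable kappa_cont T_ge0 jn) eta0.
(* Makes [2 s1 (K + 1) = delta / 4]; likewise [s2] below makes [B * 2 s2 (K + 1) = delta / 4]. *)
pose s1 := delta / (8 * (K + 1)).
have s10 : 0 < s1 by rewrite divr_gt0// mulr_gt0.
have [|del1 del10 hvar1] := @incr_var_small _ _ kappa_cont (T n + 1) (s1 ^+ 2).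
  by rewrite exprn_gt0.
pose B := \sum_(i < n) `|b i| * T i.+1 + 1.
have B0 : 0 < B.
  rewrite ltr_wpDl// sumr_ge0// => i _; rewrite mulr_ge0// ltW// Ti0//.
pose s2 := delta / (8 * B * (K + 1)).
have s20 : 0 < s2 by rewrite divr_gt0// !mulr_gt0.
have [|del2 del20 hvar2] := @incr_var_small _ _ kappa_cont (T n) (s2 ^+ 2).
  by rewrite exprn_gt0.
(* The mesh is chosen before [e], so that [N] enters the constant [C]. One [N] serves all the [T_i],
   as they are at most [T n]. *)
have [N [hN hNvar]] : exists N, T n / N.+1%:R < del2 /\
    `|comb_var kappa (riemann_comb n T b N) - asq kappa T n| <= delta.
  have h1 := div_succ_lt (ltW Tn_gt0) del20.
  have := riemann_comb_var_cvg kappa_cont covariance_sym (b := b) T_ge0 n1.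
  rewrite -hasq => /cvgrPdist_le/(_ delta delta0) h2.
  have [N _ hN] := filterI h1 h2; exists N; have [] := hN N (leqnn N).
  by rewrite distrC.
have [sigma [lawD varD]] := gaussian_comb Zgauss Zcov (riemann_comb_ge0 b N n1 T_ge0).
set D := (fun w => _) in lawD.
have DE w : D w = Z (T n) w - \sum_(i < n) b i * riemann_sum N.+1 (T i.+1) (Z ^~ w).
  by rewrite /D (riemann_comb_sum n T b N (Z ^~ w)).
(* The four bounds keep [T n + e] below [T n + 1], make the derivative estimates valid, make the
   increments after [T n] small, and bring the drift [e t c0] below [delta / 4]. *)
pose e0 := Num.min (Num.min 1 h0) (Num.min del1 (delta / (4 * (`|c0| + 1)))).
exists D, sigma, (gauss_bound 0 * (1 + 1 + n%:R * N.+1%:R + n%:R + 1)), e0; split => //.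
- by rewrite varD.
- have c01 : 0 < `|c0| + 1 by rewrite ltr_wpDl.
  by rewrite /e0 !lt_min ltr01 h00 del10 divr_gt0// mulr_gt0.
move=> e /andP[e_gt0]; rewrite /e0 !lt_min => /andP[/andP[e1 eh0] /andP[edel1 ec0]].
have Me0 : 0 < M / e by rewrite divr_gt0.
have m10 : 0 < 2 * s1 * (K + 1) / e by rewrite divr_gt0// mulr_gt0// mulr_gt0.
have m20 : 0 < 2 * s2 * (K + 1) / e by rewrite divr_gt0// mulr_gt0// mulr_gt0.
have Tn10 : 0 < T n + 1 by rewrite addr_gt0.
have ev1 := path_integrable_tail Zgauss Zcov Zmeas Tn10 sM_gt0 Me0 hsM.
have h1 : outside_event P (gauss_bound 0 * expR (- (K / e ^+ 2)))
    (fun w => mu.-integrable `[0, T n + 1] (EFin \o (Z ^~ w))).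
  by apply: outside_event_sub ev1 => //; exact: gauss_bound_scaled.
have h2 : outside_event P (gauss_bound 0 * expR (- (K / e ^+ 2)))
    (fun w => mu.-integrable `[0, T n + e] (EFin \o (Z ^~ w)) ->
      forall t, 0 <= t <= 1 ->
        `|X (T n + e * t) w - X (T n) w - e * t * Z (T n) w| <=
        e * (2 * s1 * (K + 1) / e)).
  apply: outside_event_sub (path_tail Zgauss Zcov Zmeas Xcont Xint (ltW Tn_gt0) e_gt0 s10 m10 _) => //.
    exact: gauss_bound_scaled.
  move=> u /andP[u1 u2]; have Tn0 := Tn_gt0; apply: hvar1.
  - by rewrite (le_trans (ltW Tn0) u1) (le_trans u2)// lerD2l ltW.
  - by rewrite (ltW Tn0) lerDl ler01.
  - by rewrite ger0_norm ?subr_ge0// ltrBlDl (le_lt_trans u2)// ltrD2l.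
have h3 : outside_event P (n%:R * (N.+1%:R * (gauss_bound 0 * expR (- (K / e ^+ 2)))))
    (fun w => forall i, (i < n)%N -> mu.-integrable `[0, T i.+1] (EFin \o (Z ^~ w)) ->
      X 0 w = 0 -> `|X (T i.+1) w - riemann_sum N.+1 (T i.+1) (Z ^~ w)| <=
        T i.+1 * (2 * s2 * (K + 1) / e)).
  apply: outside_event_forall => i ni.
  apply: outside_event_sub (riemann_path_tail (N := N) Zgauss Zcov Zmeas Xcont Xint s20 m20 (Ti0 i ni) _) => //.
    by apply: ler_wpM2l => //; exact: gauss_bound_scaled.
  move=> p u /andP[p1 p2] /andP[u1 u2] up; have TT := TiTn i ni.
  apply: hvar2.
  - by rewrite u1 (le_trans u2).
  - by rewrite p1 (le_trans p2).
  apply: le_lt_trans up _; apply: le_lt_trans hN.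
  by rewrite ler_wpM2r.
have h4 : outside_event P (n%:R * (gauss_bound 0 * expR (- (K / e ^+ 2))))
    (fun w => forall i, (i < n)%N -> mu.-integrable `[0, T i.+1] (EFin \o (Z ^~ w)) ->
      X 0 w = 0 -> `|Z 0 w| <= M / e -> `|X (T i.+1) w| <= 2 * T i.+1 * (M / e)).
  apply: outside_event_forall => i ni; have TT := TiTn i ni.
  apply: outside_event_sub (path_sup_tail Zgauss Zcov Zmeas Xcont Xint sM_gt0 Me0 (Ti0 i ni) _) => //.
    exact: gauss_bound_scaled.
  move=> u /andP[u1 u2]; apply: hsM.
  by rewrite u1 (le_trans u2)// (le_trans TT)// lerDl.
have h5 : outside_event P (gauss_bound 0 * expR (- (K / e ^+ 2)))
    (fun w => `|Z 0 w| <= M / e).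
  apply: outside_event_sub (normal_outside law0 hsig0 sM_gt0 (ltW Me0)) => //.
  exact: gauss_bound_scaled.
have h6 := outside_event_ae (path0 Xint).
have H := outside_event_and (outside_event_and (outside_event_and h1 h2)
  (outside_event_and h3 h4)) (outside_event_and h5 h6).
apply: outside_event_sub H => [|w [[[iZ g2] [g3 g4]] [g5 g6]] t /andP[t0 t1]].
  by rewrite le_eqVlt; apply/orP; left; apply/eqP; ring.
have iZi i : (i < n)%N -> mu.-integrable `[0, T i.+1] (EFin \o (Z ^~ w)).
  by move=> ni; apply: integrable_sub0 iZ; rewrite (le_trans (TiTn i ni))// lerDl.
have Tne : T n + e <= T n + 1 by rewrite lerD2l ltW.
have {}g2 := g2 (integrable_sub0 Tne iZ) t.
have {}g2 : `|X (T n + e * t) w - X (T n) w - e * t * Z (T n) w| <= delta / 4.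
  apply: (le_trans (g2 _)); first by rewrite t0 t1.
  by rewrite le_eqVlt; apply/orP; left; apply/eqP; rewrite /s1; field; rewrite !gt_eqF.
have et0 : 0 <= e * t by rewrite mulr_ge0// ltW.
have ete : e * t <= e by rewrite ler_piMr// ltW.
pose G j := CP j (T j.+1) w - x j.+1.
have GE j : G j = cond_lin kappa T (X ^~ w) j (T j.+1) + (mm j - x j.+1).
  by rewrite /G hmm addrA.
have Xb i : (i < n)%N -> `|X (T i.+1) w| <= 2 * T i.+1 * M / e.
  by move=> ni; have := g4 i ni (iZi i ni) g6 g5; rewrite !mulrA.
have Gb j : (j < n)%N -> `|G j| <= Cg j / e.
  move=> nj; rewrite GE hl; apply: le_trans (ler_normD _ _) _.
  rewrite /Cg mulrDl lerD//; last first.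
    by rewrite ler_pdivlMr// ler_piMr// ltW.
  apply: le_trans (ler_normB _ _) _; rewrite mulrDl lerD ?Xb//.
  rewrite mulr_suml; apply: le_trans (ler_norm_sum _ _ _) _; apply: ler_sum => i _.
  rewrite normrM -[leRHS]mulrA; apply: ler_wpM2l => //; apply: Xb.
  exact: ltn_trans (ltn_ord i) nj.
pose A := \sum_(j < n) (al j.+1 (T n + e * t) - al j.+1 (T n) - e * t * beta j) * G j.
have hA : `|A| <= delta / 4.
  apply: le_trans (ler_norm_sum _ _ _) _.
  apply: (@le_trans _ _ (\sum_(j < n) eta * Cg j)).
    apply: ler_sum => j _; rewrite normrM.
    have h := hder j (e * t) (ltn_ord j) (introT andP (conj et0 (le_trans ete (ltW eh0)))).
    apply: (@le_trans _ _ ((eta * e) * (Cg j / e))).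
      apply: ler_pM => //; last exact: Gb.
      by apply: le_trans h _; rewrite ler_wpM2l// ltW.
    by rewrite le_eqVlt; apply/orP; left; apply/eqP; field; rewrite gt_eqF.
  rewrite -mulr_sumr /eta mulrAC ler_pdivrMr ?mulr_gt0//.
  rewrite (_ : delta / 4 * (4 * CG) = delta * CG); last by field.
  by rewrite ler_wpM2l ?(ltW delta0)// /CG lerDl.
pose Bt := \sum_(i < n) b i * (X (T i.+1) w - riemann_sum N.+1 (T i.+1) (Z ^~ w)).
have hB : `|e * t * Bt| <= delta / 4.
  rewrite normrM (ger0_norm et0).
  have : `|Bt| <= B * (2 * s2 * (K + 1) / e).
    apply: le_trans (ler_norm_sum _ _ _) _.
    rewrite /B mulrDl mul1r mulr_suml ler_wpDr ?(ltW m20)//.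
    apply: ler_sum => i _; rewrite normrM -[leRHS]mulrA; apply: ler_wpM2l => //.
    exact: (g3 i (ltn_ord i) (iZi i (ltn_ord i)) g6).
  have -> : B * (2 * s2 * (K + 1) / e) = delta / 4 / e.
    by rewrite /s2; field; rewrite !gt_eqF.
  move=> hBt; apply: (@le_trans _ _ (e * (delta / 4 / e))).
    by apply: ler_pM.
  by rewrite le_eqVlt; apply/orP; left; apply/eqP; field; rewrite gt_eqF.
have hC : `|e * t * c0| <= delta / 4.
  rewrite normrM (ger0_norm et0) (@le_trans _ _ (e * (`|c0| + 1)))//.
    by apply: ler_pM => //; rewrite lerDl.
  rewrite -ler_pdivlMr; last by rewrite ltr_wpDl.
  by apply: ltW; apply: lt_le_trans ec0 _; rewrite invfM mulrA.
have SG : \sum_(j < n) beta j * G j = \sum_(i < n) b i * X (T i.+1) w + c0.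
  rewrite -(hb (X ^~ w)) /c0 -big_split /=; apply: eq_bigr => j _.
  by rewrite GE mulrDr.
(* The four errors come from linearizing [X] after [T n], linearizing the [alpha_j], replacing
   integrals by Riemann sums, and the deterministic drift. *)
have key : CP n (T n + e * t) w - x n - e * t * D w =
    (X (T n + e * t) w - X (T n) w - e * t * Z (T n) w) - A - e * t * Bt - e * t * c0.
  rewrite cond_process_increment DE.
  have -> : \sum_(j < n) (al j.+1 (T n + e * t) - al j.+1 (T n)) * (CP j (T j.+1) w - x j.+1) =
      A + e * t * (\sum_(j < n) beta j * G j).
    rewrite /A mulr_sumr -big_split /=; apply: eq_bigr => j _.
    by rewrite -/(G j); ring.
  rewrite SG (_ : Bt = \sum_(i < n) b i * X (T i.+1) w -
    \sum_(i < n) b i * riemann_sum N.+1 (T i.+1) (Z ^~ w)); last first.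
    by rewrite -sumrB; apply: eq_bigr => i _; rewrite mulrBr.
  by ring.
by rewrite key; exact: ler_normB4.
Qed.

End conditioned_approximation.

(** * The large deviation principle *)

Section path_space.
Context {R : realType}.

Lemma C01_open_ball (G : set (C01 R)) (f : C01 R) : open G -> G f ->
  exists2 e : R, 0 < e & forall g : C01 R, (forall t : I01 R, `|f t - g t| < e) -> G g.
Proof.
move=> oG Gf; have : nbhs f G by exact: open_nbhs_nbhs.
rewrite -nbhs_ballE => -[e /= e0 h]; exists e => // g fg; exact: h.
Qed.

Lemma I01P (t : I01 R) : 0 <= \val t <= 1.
Proof. by have := valP t; rewrite inE /= in_itv. Qed.

Definition mkI01 (t : R) (t01 : 0 <= t <= 1) : I01 R :=
  exist _ t (mem_set (t01 : `[0, 1]%classic t)).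

Lemma to_C01E (f : R -> R) (t : I01 R) : {within `[0, 1], continuous f} ->
  to_C01 f t = f (\val t).
Proof. by move=> cf; rewrite /to_C01; case: pselect. Qed.

Definition step_fun (s : seq int) (m N : nat) (t : R) : R :=
  (nth 0 s (Num.truncn (t * N.+1%:R)))%:~R / m.+1%:R.

Lemma step_approx (f : R -> R) (m : nat) : {within `[0, 1], continuous f} ->
  exists (s : seq int) (N : nat), forall t, 0 <= t <= 1 ->
    `|f t - step_fun s m N t| <= 2 / m.+1%:R.
Proof.
move=> cf; have m0 : 0 < m.+1%:R^-1 :> R by rewrite invr_gt0 ltr0n.
have [del del0 hd] := compact_uniformly_continuous (@segment_compact R 0 1) cf m0.
have [N hN] : exists N : nat, N.+1%:R^-1 < del.
  exists (Num.truncn del^-1); rewrite invf_plt ?posrE ?ltr0n//.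
  by rewrite truncnS_gt.
have N0 : 0 < N.+1%:R :> R by rewrite ltr0n.
(* There are [N.+2] entries because [t = 1] has index [N.+1]. Half of the final error comes from
   sampling, half from rounding down to a multiple of [1 / m.+1]. *)
exists [seq Num.floor (f (i%:R / N.+1%:R) * m.+1%:R) | i <- iota 0 N.+2], N => t /andP[t0 t1].
rewrite /step_fun; set i := Num.truncn _.
have tN0 : 0 <= t * N.+1%:R by rewrite mulr_ge0// ltW.
have /andP[i1 i2] := truncn_itv tN0; rewrite -/i in i1 i2.
have iN : (i < N.+2)%N.
  rewrite ltnS -(ler_nat R); apply: le_trans i1 _.
  by rewrite ler_piMl// ltW.
rewrite (nth_map 0%N) ?size_iota// nth_iota// add0n.
set y := f (i%:R / N.+1%:R).
have h1 : `|f t - y| < m.+1%:R^-1.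
  apply: hd.
  - by rewrite /= in_itv/= t0.
  - by rewrite /= in_itv/= divr_ge0 ?(ltW N0)//= ler_pdivrMr// mul1r ler_nat.
  - rewrite /ball/= ger0_norm; last by rewrite subr_ge0 ler_pdivrMr.
    apply: lt_trans hN; rewrite ltrBlDr -[X in X < _](mulfK (lt0r_neq0 N0)).
    by rewrite -{2}[_^-1]mul1r -mulrDl ltr_pM2r ?invr_gt0// addrC natr1.
have M0 : 0 < m.+1%:R :> R by rewrite ltr0n.
have h2 : `|y - (Num.floor (y * m.+1%:R))%:~R / m.+1%:R| <= m.+1%:R^-1.
  have /andP[f1 f2] := mem_rg1_floor (y * m.+1%:R).
  rewrite ger0_norm; last by rewrite subr_ge0 ler_pdivrMr.
  rewrite lerBlDr -[X in X <= _](mulfK (lt0r_neq0 M0)).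
  rewrite -{2}[_^-1]mul1r -mulrDl ler_pM2r ?invr_gt0// addrC.
  by rewrite ltW// -[X in _ < _ + X]/(1%:~R) -intrD.
have := ler_normD (f t - y) (y - (Num.floor (y * m.+1%:R))%:~R / m.+1%:R).
rewrite addrA subrK => /le_trans; apply.
by rewrite mulr_natl mulr2n lerD// ltW.
Qed.

(* The open set is recovered from the countably many events that the path is
   close, at all rational times, to a step function with rational data. *)
Lemma measurable_to_C01 (d : measure_display) (Omega : measurableType d)
    (Y : Omega -> R -> R) (G : set (C01 R)) :
  (forall w, {within `[0, 1], continuous (Y w)}) ->
  (forall t, 0 <= t <= 1 -> measurable_fun [set: Omega] (Y ^~ t)) ->
  open G -> measurable ((fun w => to_C01 (Y w)) @^-1` G).
Proof.
move=> cY mY oG.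
pose near_step (g : R -> R) (i : nat * nat * seq int) :=
  forall r : rat, 0 <= (ratr r : R) <= 1 ->
    `|g (ratr r) - step_fun i.2 i.1.1 i.1.2 (ratr r)| <= 2 / i.1.1.+1%:R.
(* A step function is kept only if every continuous path near it belongs to [G]; this makes the
   union of the cells contained in the preimage. *)
pose good (i : nat * nat * seq int) := forall g : R -> R,
  {within `[0, 1], continuous g} -> near_step g i -> G (to_C01 g).
pose cell i := if `[< good i >] then [set w | near_step (Y w) i] else set0.
rewrite (_ : _ @^-1` G = \bigcup_i cell i); last first.
  apply/seteqP; split => [w /= Gw|w [i _]]; last first.
    by rewrite /cell; case: asboolP => // gi; exact: gi.
  have [e e0 he] := C01_open_ball oG Gw.
  (* Two paths near the same step function differ by at most [4 / m.+1], which must be less than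
     [e]. *)
  pose m := Num.truncn (4 / e).
  have hm : 4 / m.+1%:R < e.
    by rewrite ltr_pdivrMr ?ltr0n// mulrC -ltr_pdivrMr// truncnS_gt.
  have [s [N hs]] := step_approx m (cY w).
  exists (m, N, s) => //; rewrite /cell asboolT; first by move=> r r01; exact: hs.
  move=> g cg hg; apply: he => t; rewrite !to_C01E//.
  apply: le_lt_trans hm.
  have cB : {within `[0, 1], continuous (fun t => Y w t - g t)}.
    by move=> u; apply: cvgB; [exact: cY|exact: cg].
  apply: (within_le_rat cB _ (I01P t)) => r r01.
  have h1 := hs _ r01; have := hg r r01 => /= h2.
  have := ler_normB (Y w (ratr r) - step_fun s m N (ratr r)) (g (ratr r) - step_fun s m N (ratr r)).
  rewrite opprB addrA subrK => /le_trans; apply.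
  have -> : 4 / m.+1%:R = 2 / m.+1%:R + 2 / m.+1%:R :> R by rewrite -mulrDl; congr (_ / _); lra.
  exact: lerD.
apply: countable_bigcupT_measurable; first exact: countableP.
move=> i; rewrite /cell; case: asboolP => // _.
rewrite (_ : [set w | _] = \bigcap_(r in [set: rat])
  [set w | 0 <= (ratr r : R) <= 1 ->
    `|Y w (ratr r) - step_fun i.2 i.1.1 i.1.2 (ratr r)| <= 2 / i.1.1.+1%:R]); last first.
  apply/seteqP; split => w /= h r; first by move=> _ r01; exact: h.
  by move=> r01; exact: h.
rewrite -[X in measurable X]setCK setC_bigcap; apply: measurableC.
apply: bigcupT_measurable_rat => r; apply: measurableC.
have [r01|r01] := boolP (0 <= (ratr r : R) <= 1); last first.
  by rewrite (_ : [set w | _] = setT)//; apply/seteqP; split.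
rewrite (_ : [set w | _] = [set w | `|Y w (ratr r) - step_fun i.2 i.1.1 i.1.2 (ratr r)| <= 2 / i.1.1.+1%:R]); last first.
  by apply/seteqP; split => w /= h; [exact: h|move=> _].
rewrite -[X in measurable X]setTI; apply: measurable_fun_le => //.
by apply: measurableT_comp => //; apply: measurable_funB => //; exact: mY.
Qed.

Lemma line_continuous (x c : R) : continuous (fun t : I01 R => x + c * \val t).
Proof.
have cl : {within `[0, 1], continuous (fun t : R => x + c * t)}.
  apply: continuous_subspaceT => t.
  by apply: cvgD; [exact: cvg_cst|apply: cvgM; [exact: cvg_cst|exact: cvg_id]].
exact: restr01_continuous cl.
Qed.

Definition line (x c : R) : C01 R := mk_C01 (@line_continuous x c).

Lemma line_dist (x c c' : R) (t : I01 R) : `|line x c t - line x c' t| <= `|c - c'|.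
Proof.
rewrite /line /= opprD addrACA subrr add0r -mulrBl normrM ler_piMr//.
by have /andP[t0 t1] := I01P t; rewrite ger0_norm.
Qed.

Lemma continuous_line (x : R) : continuous (line x).
Proof.
move=> c; apply/cvg_ballP => e e0; near=> c'.
have cc' : `|c - c'| < e by near: c'; exact: (@cvgr_dist_lt _ _ _ _ _ id c).
by move=> t; exact: le_lt_trans (line_dist x c c' t) cc'.
Unshelve. all: end_near. Qed.

Lemma line_compact (x r : R) : compact (line x @` `[- r, r]).
Proof.
apply: continuous_compact; last exact: segment_compact.
by apply: continuous_subspaceT; exact: continuous_line.
Qed.

(** A compact set is at positive distance from a disjoint closed one; compactness is applied to the
    slopes, with half of the local radius absorbing a change of slope. *)
Lemma line_separated (x r : R) (F : set (C01 R)) : closed F ->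
  (forall c, - r <= c <= r -> ~ F (line x c)) ->
  exists2 rho : R, 0 < rho & forall c, - r <= c <= r -> forall f : C01 R,
    (forall t, `|f t - line x c t| < rho) -> ~ F f.
Proof.
move=> cF dF; have /compact_near_coveringP K := @segment_compact R (- r) r.
have oF : open (~` F) by rewrite openC.
pose Q (rho : R) (c : R) := forall f : C01 R,
    (forall t, `|f t - line x c t| < rho) -> ~ F f.
have cover c : `[- r, r]%classic c -> \forall c' \near c & i \near 0^'+, Q i c'.
  rewrite /= in_itv/= => /dF nF; have [e e0 he] := C01_open_ball oF nF.
  exists (ball c (e / 2), [set i | i < e / 2]) => /=.
    split; first by apply: nbhsx_ballx; rewrite divr_gt0.
    by apply: nbhs_right_lt; rewrite divr_gt0.
  move=> [c' i] [/= cc' ie] f hf; apply: he => t.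
  have h1 := hf t; have h2 := line_dist x c c' t.
  have h3 : `|c - c'| < e / 2 by exact: cc'.
  have := ler_normD (line x c t - line x c' t) (line x c' t - f t).
  by rewrite addrA subrK (distrC _ (f t)) (distrC (line x c' t) (f t)); lra.
have [del /= del0 h] := K R 0^'+ Q _ cover.
exists (del / 2); first by rewrite divr_gt0.
move=> c c_r; apply: (h (del / 2)) => //=; last by rewrite divr_gt0.
rewrite sub0r normrN gtr0_norm ?divr_gt0//.
by rewrite ltr_pdivrMr//; lra.
Qed.

End path_space.

(** * Logarithmic asymptotics as e tends to 0 *)

Section limits.
Context {R : realType}.

Lemma nbhs_right_itv (e0 : R) : 0 < e0 -> \forall e \near 0^'+, 0 < e < e0.
Proof.
by move=> e00; near=> e; apply/andP; split; near: e;
  [exact: nbhs_right_gt|exact: nbhs_right_lt].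
Unshelve. all: end_near. Qed.

Lemma limf_einf_ge (f : R -> \bar R) (a : \bar R) (e0 : R) : 0 < e0 ->
  (forall e, 0 < e < e0 -> (a <= f e)%E) -> (a <= limf_einf f 0^'+)%E.
Proof.
move=> e00 h; rewrite limf_einfE; apply: le_ereal_sup_tmp.
exists (ereal_inf (f @` [set e | 0 < e < e0])).
  by exists [set e | 0 < e < e0] => //; exact: nbhs_right_itv.
by apply: le_ereal_inf_tmp => _ [e /= he <-]; exact: h.
Qed.

Lemma limf_esup_le (f : R -> \bar R) (a : \bar R) (e0 : R) : 0 < e0 ->
  (forall e, 0 < e < e0 -> (f e <= a)%E) -> (limf_esup f 0^'+ <= a)%E.
Proof.
move=> e00 h; rewrite limf_esupE; apply: (@le_trans _ _ (ereal_sup (f @` [set e | 0 < e < e0]))).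
  by apply: ereal_inf_lbound; exists [set e | 0 < e < e0] => //; exact: nbhs_right_itv.
by apply: ge_ereal_sup => _ [e /= he <-]; exact: h.
Qed.

Lemma lee_lne_ge0 (p q : \bar R) : (0 <= p)%E -> (p <= q)%E -> (lne p <= lne q)%E.
Proof.
move=> p0 pq; have q0 := le_trans p0 pq.
by rewrite lee_lne// in_itv/= leey andbT.
Qed.

Lemma le_scaled_lne (e b : R) (p : \bar R) : 0 < e ->
  ((expR (- (b / e ^+ 2)))%:E <= p)%E -> ((- b)%:E <= (e ^+ 2)%:E * lne p)%E.
Proof.
move=> e0 hp; have e2 : 0 < e ^+ 2 by rewrite exprn_gt0.
have p0 : (0 <= p)%E by apply: le_trans hp; rewrite lee_fin expR_ge0.
have h : ((- (b / e ^+ 2))%:E <= lne p)%E.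
  by rewrite -[X in (X <= _)%E]expeRK lee_lne_ge0//= lee_fin expR_ge0.
have -> : (- b)%:E = ((e ^+ 2)%:E * (- (b / e ^+ 2))%:E)%E.
  by rewrite -EFinM mulrN mulrC divfK// gt_eqF.
by rewrite lee_wpmul2l// lee_fin ltW.
Qed.

Lemma scaled_lne_le (e b : R) (p : \bar R) : 0 < e -> (0 <= p)%E ->
  (p <= (expR (- (b / e ^+ 2)))%:E)%E -> ((e ^+ 2)%:E * lne p <= (- b)%:E)%E.
Proof.
move=> e0 p0 hp; have e2 : 0 < e ^+ 2 by rewrite exprn_gt0.
have h : (lne p <= (- (b / e ^+ 2))%:E)%E.
  by rewrite -[X in (_ <= X)%E]expeRK lee_lne_ge0.
have -> : (- b)%:E = ((e ^+ 2)%:E * (- (b / e ^+ 2))%:E)%E.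
  by rewrite -EFinM mulrN mulrC divfK// gt_eqF.
by rewrite lee_wpmul2l// lee_fin ltW.
Qed.

Lemma exp_small (C k y : R) : 0 < k -> 0 < y ->
  exists2 e0 : R, 0 < e0 & forall e, 0 < e < e0 -> C * expR (- (k / e ^+ 2)) <= y.
Proof.
move=> k0 y0; have C0 : 0 < `|C| + 1 by rewrite ltr_wpDl.
(* Comes from [exp (- z) <= 1 / z] at [z = k / e^2] and from [e^2 <= e]. *)
exists (Num.min 1 (k * y / (`|C| + 1))).
  by rewrite lt_min ltr01 divr_gt0// mulr_gt0.
move=> e /andP[e0]; rewrite lt_min => /andP[e1 ek].
have e2 : 0 < e ^+ 2 by rewrite exprn_gt0.
have ee : e ^+ 2 <= e by rewrite expr2 ler_piMr// ltW.
have z0 : 0 < k / e ^+ 2 by rewrite divr_gt0.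
have h : expR (- (k / e ^+ 2)) <= e ^+ 2 / k.
  rewrite expRN -[leRHS]invrK invf_div lef_pV2 ?posrE ?expR_gt0//.
  by apply: le_trans (expR_ge1Dx _); rewrite lerDr.
apply: (@le_trans _ _ (`|C| * (e ^+ 2 / k))).
  apply: (@le_trans _ _ (`|C| * expR (- (k / e ^+ 2)))).
    by rewrite ler_wpM2r ?expR_ge0// ler_norm.
  by rewrite ler_wpM2l.
rewrite mulrA ler_pdivrMr// mulrC.
rewrite ltr_pdivlMr// in ek.
apply: (@le_trans _ _ (e * (`|C| + 1))).
  by apply: ler_pM => //; [exact: ltW|rewrite lerDl].
by rewrite [leRHS]mulrC ltW.
Qed.

End limits.

(** * From approximation by normal lines to the large deviation principle *)

Section large_deviations.
Context {R : realType} {d : measure_display} {Omega : measurableType d}.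
Variable P : probability Omega R.
Variables (U : R -> Omega -> C01 R) (x v : R) (J : C01 R -> \bar R).
Hypothesis U_meas : forall e (G : set (C01 R)), 0 < e -> open G -> measurable (U e @^-1` G).
Hypothesis U_approx : forall K delta, 0 < K -> 0 < delta ->
  exists (D : Omega -> R) (sigma C e0 : R),
    [/\ normal_law P D sigma, `|sigma ^+ 2 - v| <= delta, 0 < e0 &
      forall e, 0 < e < e0 -> outside_event P (C * expR (- (K / e ^+ 2)))
        (fun w => forall t, `|U e w t - line x (e * D w) t| <= delta)].
(** For [v = 0] only the constant line has finite rate, and the formula gives it the right value 0
    since the inverse of 0 is 0. *)
Hypothesis J_line : forall c, (v = 0 -> c = 0) -> J (line x c) = (c ^+ 2 / (2 * v))%:E.
Hypothesis J_fin : forall h, J h <> +oo%E -> exists2 c, (v = 0 -> c = 0) & h = line x c.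

Lemma approx_var_ge0 : 0 <= v.
Proof.
apply/ler_addgt0Pr => e e0.
have [D [s [C [e1 [_ hs _ _]]]]] := U_approx ltr01 e0.
move: hs; rewrite ler_norml => /andP[_ h]; have := sqr_ge0 s; lra.
Qed.

Lemma rate_compact (a : R) : compact [set h | (J h <= a%:E)%E].
Proof.
have v0 := approx_var_ge0.
have [a0|a0] := ltP a 0.
  rewrite (_ : [set h | _] = set0); first exact: compact0.
  apply/seteqP; split => // h /= Jh.
  have [|c hc hE] := @J_fin h.
    by move=> Jy; rewrite Jy in Jh.
  rewrite hE J_line// lee_fin in Jh.
  have : 0 <= c ^+ 2 / (2 * v) by rewrite divr_ge0 ?sqr_ge0 ?mulr_ge0.
  by lra.
have va0 : 0 <= 2 * v * a by rewrite !mulr_ge0.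
rewrite (_ : [set h | _] = line x @` `[- Num.sqrt (2 * v * a), Num.sqrt (2 * v * a)]).
  exact: line_compact.
apply/seteqP; split => [h /= Jh|_ [c /= cr <-]].
  have [|c hc hE] := @J_fin h.
    by move=> Jy; rewrite Jy in Jh.
  exists c => //; rewrite hE J_line// lee_fin in Jh.
  rewrite /= in_itv/= -ler_norml -sqrtr_sqr ler_sqrt//.
  have [v00|vn0] := eqVneq v 0; first by rewrite hc// expr0n.
  have v0' : 0 < v by rewrite lt_def vn0.
  by rewrite ler_pdivrMr ?mulr_gt0// mulrC in Jh.
move: cr; rewrite in_itv/= -ler_norml -sqrtr_sqr ler_sqrt// => hc.
rewrite J_line; last first.
  move=> v00; move: hc; rewrite v00 mulr0 mul0r => hc; apply/eqP.
  by rewrite -sqrf_eq0 eq_le hc sqr_ge0.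
rewrite lee_fin; have [v00|vn0] := eqVneq v 0; first by rewrite v00 mulr0 invr0 mulr0.
have v0' : 0 < v by rewrite lt_def vn0.
by rewrite ler_pdivrMr ?mulr_gt0// mulrC.
Qed.

(** If [e D] is near [c] and the exceptional event does not occur, the path is near the line. The
    approximation is taken with [K] one unit above the target exponent, so that the exceptional
    event is negligible. *)
Lemma lower_estimate (c eta rho : R) : (v = 0 -> c = 0) -> 0 < eta -> 0 < rho ->
  exists2 e0 : R, 0 < e0 & forall e, 0 < e < e0 -> forall A : set Omega, measurable A ->
    (forall w, (forall t, `|line x c t - U e w t| < rho) -> A w) ->
    ((expR (- ((c ^+ 2 / (2 * v) + eta) / e ^+ 2)))%:E <= P A)%E.
Proof.
move=> hc eta0 rho0; have v0 := approx_var_ge0.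
set q := c ^+ 2 / (2 * v).
have q0 : 0 <= q by rewrite divr_ge0 ?sqr_ge0 ?mulr_ge0.
have K0 : 0 < q + eta + 1 by lra.
have near_path (D : R) e delta w : delta < rho / 2 -> `|e * D - c| < delta ->
    (forall t, `|U e w t - line x (e * D) t| <= delta) ->
    forall t, `|line x c t - U e w t| < rho.
  move=> hd hD hU t; have h1 := hU t; have h2 := line_dist x (e * D) c t.
  rewrite distrC; have := ler_normD (U e w t - line x (e * D) t) (line x (e * D) t - line x c t).
  by rewrite addrA subrK; lra.
(* Here [c = 0], and the law of [D] may be degenerate. The tail bound shows instead that [e D] is
   near 0 with probability at least [1/2] after removal of the exceptional event. *)
have [v00|vn0] := eqVneq v 0.
  have c0 := hc v00; have d0 : 0 < rho / 4 by rewrite divr_gt0.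
  have [D [s [C [e0 [law hs e00 hU]]]]] := U_approx K0 d0.
  pose sM := `|s| + 1; have sM0 : 0 < sM by rewrite ltr_wpDl.
  have ss : s ^+ 2 <= sM ^+ 2.
    by rewrite -(real_normK (num_real s)) ler_sqr ?nnegrE ?(ltW sM0)// lerDl.
  have [e1 e10 h1] := @exp_small R C (q + eta + 1) 4^-1 K0 ltac:(by rewrite invr_gt0).
  pose y := rho / 8; have y0 : 0 < y by rewrite divr_gt0.
  have ky0 : 0 < y ^+ 2 / (4 * sM ^+ 2) by rewrite divr_gt0 ?mulr_gt0 ?exprn_gt0.
  have [e2 e20 h2] := @exp_small R (gauss_bound 0) _ 4^-1 ky0 ltac:(by rewrite invr_gt0).
  have [e3 e30 h3] := @exp_small R 1 eta 4^-1 eta0 ltac:(by rewrite invr_gt0).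
  exists (Num.min (Num.min e0 e1) (Num.min e2 e3)); first by rewrite !lt_min e00 e10 e20.
  move=> e /andP[e_gt0]; rewrite !lt_min => /andP[/andP[ee0 ee1] /andP[ee2 ee3]] A mA hA.
  have ye0 : 0 <= y / e by rewrite divr_ge0 ?(ltW y0) ?(ltW e_gt0).
  have [B [mB PB] hB] := outside_event_and (hU e (introT andP (conj e_gt0 ee0)))
    (normal_outside law ss sM0 ye0).
  have AB : setT `<=` A `|` B.
    move=> w _; have [|nB] := pselect (B w); first by right.
    left; have [g1 g2] := hB w nB; apply: hA; apply: near_path g1; first by rewrite /=; lra.
    rewrite c0 subr0 normrM gtr0_norm//; rewrite ler_pdivlMr// in g2.
    by rewrite mulrC /y in g2 *; lra.
  have PAB : (1 <= P A + P B)%E.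
    rewrite -(@probability_setT _ _ _ P); apply: le_trans (measureU2 _ mA mB).
    by apply: le_measure; rewrite ?inE//; exact: measurableU.
  have PB' : (P B <= (2^-1)%:E)%E.
    apply: le_trans PB _; rewrite lee_fin.
    have g1 := h1 e (introT andP (conj e_gt0 ee1)); have g2 := h2 e (introT andP (conj e_gt0 ee2)).
    have -> : gauss_bound ((y / e) ^+ 2 / (4 * sM ^+ 2)) =
        gauss_bound 0 * expR (- (y ^+ 2 / (4 * sM ^+ 2) / e ^+ 2)).
      rewrite /gauss_bound oppr0 expR0 mulr1; congr (_ * expR (- _)).
      by field; rewrite !gt_eqF.
    by lra.
  have g3 := h3 e (introT andP (conj e_gt0 ee3)); rewrite mul1r in g3.
  have q00 : q = 0 by rewrite /q c0 expr0n mul0r.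
  rewrite q00 add0r; apply: (@le_trans _ _ (2^-1)%:E).
    by rewrite lee_fin; lra.
  have : (1 <= P A + (2^-1)%:E)%E by apply: le_trans PAB _; rewrite leeD2l.
  rewrite -leeBlDr// -EFinB => /(le_trans _); apply; rewrite lee_fin; lra.
have v0' : 0 < v by rewrite lt_def vn0.
have cq : c ^+ 2 = 2 * v * q by rewrite /q; field; rewrite gt_eqF.
(* Expanding [(|c| + delta)^2 <= (q + eta / 2) * 2 (v - delta)] with [delta^2 <= delta] and
   [c^2 = 2 v q] reduces it to [delta * S <= eta * v]. *)
pose S := 2 * `|c| + 1 + 2 * q + eta.
have S0 : 0 < S by rewrite /S; have := normr_ge0 c; lra.
pose delta := Num.min (Num.min 1 (v / 2)) (Num.min (rho / 4) (eta * v / S)).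
have [delta0 [d1 dv] [dr dS]] : [/\ 0 < delta, delta <= 1 /\ delta <= v / 2 &
    delta <= rho / 4 /\ delta <= eta * v / S].
  split; first by rewrite !lt_min ltr01 !divr_gt0// mulr_gt0.
  - by split; rewrite !ge_min lexx ?orbT.
  - by split; rewrite !ge_min lexx ?orbT.
have [D [s [C [e0 [law hs e00 hU]]]]] := U_approx K0 delta0.
have s2 : v - delta <= s ^+ 2 by move: hs; rewrite ler_norml; lra.
have s20 : 0 < s ^+ 2 by lra.
have sn0 : s != 0 by rewrite -sqrf_eq0 gt_eqF.
have ha : (`|c| + delta) ^+ 2 / (2 * s ^+ 2) <= q + eta / 2.
  have s22 : 0 < 2 * s ^+ 2 by rewrite pmulr_rgt0.
  have qe0 : 0 <= q + eta / 2 by lra.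
  rewrite (ler_pdivrMr _ _ s22).
  apply: (@le_trans _ _ ((q + eta / 2) * (2 * (v - delta)))); last first.
    by apply: ler_wpM2l => //; lra.
  rewrite (ler_pdivlMr _ _ S0) in dS.
  have c2 : `|c| ^+ 2 = 2 * v * q by rewrite real_normK ?num_real.
  have dd : delta ^+ 2 <= delta by rewrite expr2 ler_piMr// ltW.
  rewrite sqrrD c2 -mulr_natl; move: dS; rewrite /S; lra.
have pk0 := normal_peak_gt0 sn0.
have dpk : 0 < delta * normal_peak s by rewrite mulr_gt0.
have [e1 e10 h1] := @exp_small R C 1 1 ltr01 ltr01.
(* For [e] below [delta * normal_peak s] the prefactor of the normal estimate is at least 2: one
   unit absorbs the exceptional event, the other is the claimed bound. *)
exists (Num.min (Num.min e0 e1) (Num.min 1 (delta * normal_peak s))).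
  by rewrite !lt_min e00 e10 ltr01.
move=> e /andP[e_gt0]; rewrite !lt_min => /andP[/andP[ee0 ee1] /andP[e_lt1 epk]] A mA hA.
have e20 : 0 < e ^+ 2 by rewrite exprn_gt0.
have [B [mB PB] hB] := hU e (introT andP (conj e_gt0 ee0)).
pose E1 := [set w | `|D w - c / e| < delta / e].
have mE1 : measurable E1.
  rewrite (_ : E1 = (fun w => `|D w - c / e|) @^-1` `]-oo, delta / e[%classic).
    rewrite -[X in measurable X]setTI.
    have mf : measurable_fun [set: Omega] (fun w => `|D w - c / e|).
      by apply: measurableT_comp => //; apply: measurable_funB => //; exact: law.1.
    by apply: mf => //; exact: measurable_itv.
  by apply/seteqP; split => w /=; rewrite in_itv.
have PE1 := normal_law_interval (c / e) law sn0 (divr_gt0 delta0 e_gt0).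
have E1AB : E1 `<=` A `|` B.
  move=> w /= hD; have [|nB] := pselect (B w); first by right.
  left; apply: hA; apply: near_path (hB w nB); first by lra.
  have -> : e * D w - c = e * (D w - c / e) by field; rewrite gt_eqF.
  by rewrite normrM gtr0_norm// mulrC -ltr_pdivlMr.
have {}PE1 : ((2 * expR (- ((q + eta / 2) / e ^+ 2)))%:E <= P E1)%E.
  apply: le_trans PE1; rewrite lee_fin.
  apply: ler_pM; rewrite ?expR_ge0//.
    have : 1 <= delta / e * normal_peak s by rewrite mulrAC ler_pdivlMr// mul1r ltW.
    by rewrite -mulrA; lra.
  rewrite ler_expR lerN2 normrM normfV (gtr0_norm e_gt0) -mulrDl exprMn exprVn.
  by rewrite mulrAC ler_wpM2r// invr_ge0 ltW.
have PAB : (P E1 <= P A + (C * expR (- ((q + eta + 1) / e ^+ 2)))%:E)%E.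
  apply: (@le_trans _ _ (P (A `|` B))).
    by apply: le_measure; rewrite ?inE//; exact: measurableU.
  by apply: le_trans (measureU2 _ mA mB) _; rewrite leeD2l.
have := le_trans PE1 PAB; rewrite -leeBlDr// -EFinB; apply: le_trans; rewrite lee_fin.
set E := expR (- ((q + eta) / e ^+ 2)).
have hE : E <= expR (- ((q + eta / 2) / e ^+ 2)).
  rewrite ler_expR lerN2 ler_wpM2r ?invr_ge0 ?(ltW e20)//.
  by lra.
have -> : expR (- ((q + eta + 1) / e ^+ 2)) = E * expR (- (1 / e ^+ 2)).
  by rewrite -expRD; congr expR; ring.
have := h1 e (introT andP (conj e_gt0 ee1)).
have E0 : 0 < E := expR_gt0 _.
by rewrite -(ler_pM2l E0) mulr1 mulrCA; lra.
Qed.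

(** The lines of slope at most [r], which have rate at most [eta], avoid [F] by a margin [rho].
    Hence a path in [F] forces [|e D| >= r + delta] or the exceptional event. *)
Lemma upper_estimate (F : set (C01 R)) (eta : R) : closed F -> 0 <= eta ->
  (eta%:E < ereal_inf (J @` F))%E ->
  exists2 e0 : R, 0 < e0 & forall e, 0 < e < e0 ->
    (P (U e @^-1` F) <= (expR (- (eta / e ^+ 2)))%:E)%E.
Proof.
move=> cF eta0 hJ; have v0 := approx_var_ge0.
pose r := Num.sqrt (2 * v * eta).
have ve0 : 0 <= 2 * v * eta by rewrite !mulr_ge0.
have r0 : 0 <= r := sqrtr_ge0 _.
have r2 : r ^+ 2 = 2 * v * eta by rewrite sqr_sqrtr.
have [rho rho0 hrho] : exists2 rho : R, 0 < rho & forall c, - r <= c <= r ->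
    forall f : C01 R, (forall t, `|f t - line x c t| < rho) -> ~ F f.
  apply: line_separated => // c; rewrite -ler_norml -sqrtr_sqr ler_sqrt// => hc Fc.
  have vc : v = 0 -> c = 0.
    move=> v00; move: hc; rewrite v00 mulr0 mul0r => hc; apply/eqP.
    by rewrite -sqrf_eq0 eq_le hc sqr_ge0.
  have : (ereal_inf (J @` F) <= J (line x c))%E by apply: ereal_inf_lbound; exists (line x c).
  move=> /(lt_le_trans hJ); rewrite J_line// lte_fin ltNge => /negP; apply.
  have [v00|vn0] := eqVneq v 0; first by rewrite v00 mulr0 invr0 mulr0.
  have v0' : 0 < v by rewrite lt_def vn0.
  by rewrite ler_pdivrMr ?mulr_gt0// mulrC.
pose delta := rho / 4.
have delta0 : 0 < delta by rewrite divr_gt0.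
have dd0 : 0 < delta ^+ 2 by rewrite exprn_gt0.
(* Since [(r + delta)^2 >= Q = 2 v eta + delta^2], there is a surplus [delta^2]. The loss [r1], the
   extra exponent [kap] and the variance error [d'] each use at most a quarter of it, which gives
   [hexp]; [kap] then absorbs the constant [C']. *)
pose Q := r ^+ 2 + delta ^+ 2.
have Q0 : 0 < Q by rewrite ltr_wpDl ?sqr_ge0.
pose r1 := delta ^+ 2 / (4 * Q).
have r10 : 0 < r1 by rewrite divr_gt0// mulr_gt0.
have r1Q : r1 * Q = delta ^+ 2 / 4 by rewrite /r1; field; rewrite gt_eqF.
have r1_le1 : r1 <= 1.
  by rewrite /r1 ler_pdivrMr ?mulr_gt0// mul1r /Q; have := sqr_ge0 r; lra.
pose kap := delta ^+ 2 / (8 * (v + 1)).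
have kap0 : 0 < kap by rewrite divr_gt0// mulr_gt0//; lra.
have kapE : kap * (v + 1) = delta ^+ 2 / 8 by rewrite /kap; field; rewrite gt_eqF//; lra.
pose d' := Num.min delta (delta ^+ 2 / (8 * (eta + kap + 1))).
have ek0 : 0 < eta + kap + 1 by lra.
have d'0 : 0 < d' by rewrite lt_min delta0 divr_gt0// mulr_gt0.
have d'd : d' <= delta by rewrite ge_min lexx.
have d'E : d' * (eta + kap + 1) <= delta ^+ 2 / 8.
  rewrite -ler_pdivlMr//.
  have -> : delta ^+ 2 / 8 / (eta + kap + 1) = delta ^+ 2 / (8 * (eta + kap + 1)).
    by field; rewrite gt_eqF.
  by rewrite ge_min lexx orbT.
have K0 : 0 < eta + kap by lra.
have [D [sg [C [e0 [law hs e00 hU]]]]] := U_approx K0 d'0.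
pose s := Num.sqrt (v + d').
have vd0 : 0 < v + d' by lra.
have s0 : 0 < s by rewrite sqrtr_gt0.
have s2 : s ^+ 2 = v + d' by rewrite sqr_sqrtr// ltW.
have ss : sg ^+ 2 <= s ^+ 2 by rewrite s2; move: hs; rewrite ler_norml; lra.
have hexp : eta + kap <= (1 - r1) * (r + delta) ^+ 2 / (2 * s ^+ 2).
  rewrite ler_pdivlMr ?mulr_gt0 ?exprn_gt0// s2.
  apply: (@le_trans _ _ ((1 - r1) * Q)); last first.
    rewrite ler_wpM2l ?subr_ge0// /Q sqrrD.
    have : 0 <= r * delta *+ 2 by rewrite mulrn_wge0// mulr_ge0// ltW.
    by lra.
  have -> : (1 - r1) * Q = 2 * v * eta + delta ^+ 2 - delta ^+ 2 / 4.
    by rewrite mulrBl mul1r r1Q /Q r2.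
  by nra.
pose C' := C + (Num.sqrt r1)^-1.
have [e1 e10 h1] := @exp_small R C' kap 1 kap0 ltr01.
exists (Num.min e0 e1); first by rewrite lt_min e00.
move=> e /andP[e_gt0]; rewrite lt_min => /andP[ee0 ee1].
have e20 : 0 < e ^+ 2 by rewrite exprn_gt0.
have [B [mB PB] hB] := hU e (introT andP (conj e_gt0 ee0)).
have re0 : 0 <= (r + delta) / e by rewrite divr_ge0 ?(ltW e_gt0)// addr_ge0// ltW.
have r101 : 0 < r1 <= 1 by rewrite r10.
have PT := normal_tail law ss s0 r101 re0.
set A := [set w | _] in PT.
have mA : measurable A.
  rewrite -[X in measurable X]setTI; apply: measurable_fun_le => //.
  by apply: measurableT_comp => //; exact: law.1.
have mUF : measurable (U e @^-1` F).
  rewrite -[X in measurable X]setCK preimage_setC; apply: measurableC.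
  by apply: U_meas => //; rewrite openC.
have FAB : U e @^-1` F `<=` A `|` B.
  move=> w /= FU; have [|nB] := pselect (B w); first by right.
  left; rewrite /A /= leNgt; apply/negP => hD.
  have {}hD : `|e * D w| < r + delta.
    by rewrite normrM gtr0_norm// mulrC -ltr_pdivlMr.
  (* [c] is [e D] truncated to [[- r, r]]. *)
  have [c cr hc] : exists2 c, - r <= c <= r & `|e * D w - c| <= delta.
    move: hD; rewrite ltr_norml => /andP[hD1 hD2].
    have [h2|h2] := ltP (e * D w) (- r).
      exists (- r); first by rewrite lexx ge0_cp.
      rewrite distrC ger0_norm ?subr_ge0 ?(ltW h2)//.
      by rewrite lerBlDl -lerBlDr -opprD ltW.
    have [h3|h3] := ltP r (e * D w).
      exists r; first by rewrite lexx andbT ge0_cp.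
      by rewrite ger0_norm ?subr_ge0 ?(ltW h3)// lerBlDl ltW.
    by exists (e * D w); [rewrite h2 h3|rewrite subrr normr0 ltW].
  apply: (hrho c cr (U e w)) FU => t.
  have h2 := hB w nB t; have h3 := line_dist x (e * D w) c t.
  have := ler_normD (U e w t - line x (e * D w) t) (line x (e * D w) t - line x c t).
  by rewrite addrA subrK /delta in d'd hc *; rewrite /delta in d'd hc; lra.
apply: (@le_trans _ _ (P (A `|` B))).
  by apply: le_measure; rewrite ?inE//; exact: measurableU.
apply: le_trans (measureU2 _ mA mB) _; apply: le_trans (leeD PT PB) _.
rewrite -EFinD lee_fin.
have hk : expR (- ((1 - r1) * ((r + delta) / e) ^+ 2 / (2 * s ^+ 2))) <=
    expR (- ((eta + kap) / e ^+ 2)).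
  rewrite ler_expR lerN2.
  have -> : (1 - r1) * ((r + delta) / e) ^+ 2 / (2 * s ^+ 2) =
     (1 - r1) * (r + delta) ^+ 2 / (2 * s ^+ 2) / e ^+ 2.
    by field; rewrite !gt_eqF.
  by rewrite ler_wpM2r// invr_ge0 ltW.
apply: (@le_trans _ _ (C' * expR (- ((eta + kap) / e ^+ 2)))).
  have sr0 : 0 <= (Num.sqrt r1)^-1 by rewrite invr_ge0 sqrtr_ge0.
  by have := ler_wpM2l sr0 hk; rewrite /C' mulrDl; lra.
have -> : expR (- ((eta + kap) / e ^+ 2)) = expR (- (eta / e ^+ 2)) * expR (- (kap / e ^+ 2)).
  by rewrite -expRD; congr expR; ring.
rewrite mulrCA -[leRHS]mulr1; apply: ler_wpM2l; first exact: expR_ge0.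
by apply: h1; rewrite e_gt0.
Qed.

Lemma satisfies_LDP_of_approx : satisfies_LDP P U (fun e => e) J.
Proof.
split => //.
- by apply: cvg_at_right_filter; exact: cvg_id.
- exact: rate_compact.
- move=> G oG; rewrite leeNl; apply: le_ereal_inf_tmp => _ [h Gh <-].
  rewrite leeNl; have [->|Jh] := eqVneq (J h) +oo%E; first by rewrite /= leNye.
  have [|c hc hE] := @J_fin h; first exact/eqP.
  rewrite hE in Gh *; rewrite J_line//.
  have [rho rho0 hrho] := C01_open_ball oG Gh.
  apply/lee_subgt0Pr => eta eta0.
  have [e0 e00 h0] := lower_estimate hc eta0 rho0.
  apply: (limf_einf_ge e00) => e he; have e_gt0 : 0 < e by case/andP: he.
  rewrite -EFinN -EFinB -opprD; apply: le_scaled_lne => //.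
  apply: h0 => //; first exact: U_meas.
  by move=> w; exact: hrho.
- move=> F cF.
  have mUF e : 0 < e -> measurable (U e @^-1` F).
    move=> e0; rewrite -[X in measurable X]setCK preimage_setC; apply: measurableC.
    by apply: U_meas => //; rewrite openC.
  (* Real levels below the infimum suffice, also when the infimum is infinite: for [+oo], the upper
     limit is then below every real number. *)
  suff H eta : (eta%:E < ereal_inf (J @` F))%E ->
      (limf_esup (fun e : R => (e ^+ 2)%:E * lne (P (U e @^-1` F))) (0 : R)^'+ <= (- eta)%:E)%E.
    move: H; case: (ereal_inf _) => [i| |] H; last exact: leey.
      rewrite -EFinN; apply/lee_addgt0Pr => t t0.
      by have := H (i - t); rewrite lte_fin gtrBl opprB addrC -EFinD; exact.
    move: H; case: (limf_esup _ _) => [y| |] H //=.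
      by have := H (1 - y)%R; rewrite ltry lee_fin => /(_ isT) ?; exfalso; lra.
    by have := H 0%R; rewrite ltry leye_eq => /(_ isT).
  (* For a negative level it is enough that the logarithm of a probability is at most 0. *)
  move=> hJ; have [eta0|eta0] := leP 0 eta.
    have [e0 e00 h0] := upper_estimate cF eta0 hJ.
    apply: (limf_esup_le e00) => e he; have e_gt0 : 0 < e by case/andP: he.
    by apply: scaled_lne_le => //; exact: h0.
  apply: (limf_esup_le ltr01) => e /andP[e_gt0 _].
  apply: (@le_trans _ _ 0%E); last by rewrite lee_fin oppr_ge0 ltW.
  apply: mule_ge0_le0; first by rewrite lee_fin sqr_ge0.
  by rewrite lne_le0; exact: probability_le1 (mUF e e_gt0).
Qed.

End large_deviations.

(** * The kernel v t s *)

Section first_moment.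
Context {R : realType}.
Local Notation signed_measure := (charge (measurableTypeR R) R).

(** For the kernel [v t s], potential and energy depend on a charge through this number alone. *)
Definition moment1 (nu : signed_measure) : R := integral01 nu id.

Lemma integrable_id01 (mu : {finite_measure set (measurableTypeR R) -> \bar R}) :
  mu.-integrable `[0, 1]%classic (EFin \o (id : measurableTypeR R -> R)).
Proof.
apply: (@le_integrable _ _ _ _ _ _ _ (EFin \o cst 1)) => //.
- by apply/measurable_EFinP; apply: measurable_funTS.
- move=> t /=; rewrite in_itv/= lee_fin normr1 => /andP[t0 t1].
  by rewrite ger0_norm.
- apply: (@integrableS _ _ _ mu setT) => //.
  exact: finite_measure_integrable_cst.
Qed.

Lemma integral01Zl (nu : signed_measure) (a : R) (f : R -> R) :
  (forall t, f t = a * t) -> integral01 nu f = a * moment1 nu.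
Proof.
move=> fE; rewrite (funext fE) /moment1 /integral01 mulrBr.
by congr (_ - _); rewrite RintegralZl//; exact: integrable_id01.
Qed.

Lemma Rintegral_dirac1 (mu : {finite_measure set (measurableTypeR R) -> \bar R}) (p : R) :
  0 <= p ->
  (forall A, measurable A -> mu A = (p%:E * \d_(1%R : measurableTypeR R) A)%E) ->
  \int[mu]_(t in `[0, 1]) (t : R) = p.
Proof.
move=> p0 muE; rewrite /Rintegral.
rewrite (@eq_measure_integral _ _ _ _ (mscale (NngNum p0) (\d_(1%R : measurableTypeR R)))); last first.
  by move=> A mA _ /=; rewrite muE.
rewrite ge0_integral_mscale//=; last first.
  by move=> t /=; rewrite in_itv/= => /andP[t0 _]; rewrite lee_fin.
rewrite integral_dirac//.
by rewrite diracE mem_set ?mul1e ?mule1//= in_itv/= ler01 lexx.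
Qed.

(* A Hahn decomposition may put the atom 1 on either side when [a = 0]. *)
Lemma moment1_point (nu : signed_measure) (a : R) :
  (forall A, measurable A -> nu A = (a%:E * \d_(1%R : measurableTypeR R) A)%E) ->
  moment1 nu = a.
Proof.
move=> nuE; rewrite /moment1 /integral01.
have hd := hahn_pos_neg nu.
set Q := hahn_pos nu in hd *; set N := hahn_neg nu in hd *.
have [[mQ posQ] [mN negN] QN QN0] := hd.
have dI (A B : set (measurableTypeR R)) :
    (\d_(1%R : measurableTypeR R) (A `&` B) = \d_(1%R : measurableTypeR R) B * \d_(1%R : measurableTypeR R) A)%E.
  by rewrite !diracE in_setI; case: (_ \in A); case: (_ \in B); rewrite /= ?mule0 ?mul0e ?mule1 ?mul1e.
pose q := a * (1 \in Q)%:R; pose m := - (a * (1 \in N)%:R).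
have posE A : measurable A ->
    jordan_pos (hahn_pos_neg nu) A = (q%:E * \d_(1%R : measurableTypeR R) A)%E.
  move=> mA; rewrite jordan_posE cjordan_posE /crestr0 mem_set// /crestr nuE; last exact: measurableI.
  by rewrite dI muleA.
have negE A : measurable A ->
    jordan_neg (hahn_pos_neg nu) A = (m%:E * \d_(1%R : measurableTypeR R) A)%E.
  move=> mA; rewrite jordan_negE cjordan_negE /crestr0 mem_set// /crestr nuE; last exact: measurableI.
  by rewrite dI muleA /m EFinN mulNe.
have q0 : 0 <= q.
  have := posE setT measurableT; rewrite diracT mule1 -lee_fin => <-.
  exact: measure_ge0.
have m0 : 0 <= m.
  have := negE setT measurableT; rewrite diracT mule1 -lee_fin => <-.
  exact: measure_ge0.
rewrite (Rintegral_dirac1 q0 posE) (Rintegral_dirac1 m0 negE) /q /m opprK -mulrDr.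
rewrite -natrD (_ : ((1%R \in Q) + (1%R \in N))%N = 1%N) ?mulr1//.
have : (Q `|` N) 1%R by rewrite QN.
have : ~ (Q `&` N) 1%R by rewrite QN0.
move=> QNn [hQ|hN].
  by rewrite mem_set// memNset// => hN; apply: QNn.
by rewrite addnC mem_set// memNset// => hQ; apply: QNn.
Qed.

(** An atom at 1 has its mass as first moment, so these charges realize every potential of the
    kernel. *)
Definition point_charge (a : R) : signed_measure :=
  cscale a (charge_of_finite_measure (\d_(1%R : measurableTypeR R))).

Lemma moment1_point_charge (a : R) : moment1 (point_charge a) = a.
Proof. exact: moment1_point. Qed.

(** Needed for the Cauchy condition of a constant sequence of charges: the difference vanishes on
    measurable sets, which is the point charge case with mass 0. *)
Lemma moment1_diff (nu : signed_measure) : moment1 (cadd nu (copp nu)) = 0.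
Proof.
apply: moment1_point => A mA; rewrite mul0e.
by change (nu A - nu A = 0)%E; rewrite subee// fin_num_measure.
Qed.

End first_moment.

Section linear_kernel.
Context {R : realType}.
Variable v : R.
Let q (t s : R) : R := v * (t * s).
Local Notation signed_measure := (charge (measurableTypeR R) R).

Lemma potential_linear (nu : signed_measure) (t : I01 R) :
  potential q nu t = v * moment1 nu * \val t.
Proof.
by rewrite /potential (@integral01Zl _ nu (v * \val t)) => [|s]; rewrite /q; ring.
Qed.

Lemma energy_linear (nu : signed_measure) : energy q nu = v * moment1 nu ^+ 2.
Proof.
rewrite /energy (@integral01Zl _ nu (v * moment1 nu)) => [|s]; first by ring.
by rewrite (@integral01Zl _ nu (v * s)) => [|t]; rewrite /q; ring.
Qed.

(** Evaluating the potentials at [t = 1] shows that [v] times the first moments converges to the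
    slope [c]; for [v] nonzero the energies are the squares of these numbers divided by [v]. For
    [v = 0] potentials and energies vanish. *)
Lemma is_rkhs_sqnorm_linear (h : C01 R) (r : R) : is_rkhs_sqnorm q h r ->
  exists c, [/\ v = 0 -> c = 0, forall t : I01 R, h t = c * \val t & r = c ^+ 2 / v].
Proof.
move=> [lam [_ hu hr]].
have hp (t : I01 R) : (v * moment1 (lam m) * \val t) @[m --> \oo] --> h t.
  have := hu => /pointwise_uniform_cvg /pointwise_cvgP /(_ t).
  rewrite (_ : (fun m => _) = (fun m => potential q (lam m) t)) //.
  by apply/funext => m; rewrite potential_linear.
have h1 := hp (@mkI01 R 1 ltac:(by rewrite ler01 lexx)).
set c := h _ in h1; rewrite /= in h1.
have {}h1 : v * moment1 (lam m) @[m --> \oo] --> c.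
  by under eq_fun do rewrite -[v * _]mulr1.
rewrite (funext (fun m => energy_linear (lam m))) in hr.
have [v0|vn0] := eqVneq v 0.
  have l0 (u : nat -> R) : v * u m @[m --> \oo] --> (0 : R).
    by rewrite (_ : (fun m => _) = fun=> 0); [exact: cvg_cst|apply/funext => m; rewrite v0 mul0r].
  have c0 : c = 0 by apply: cvg_unique h1 (l0 _).
  exists c; split => // [t|].
    rewrite c0 mul0r; apply: cvg_unique (hp t) _ => //.
    rewrite (_ : (fun m => _) = fun m => v * (moment1 (lam m) * \val t)); first exact: l0.
    by apply/funext => m; rewrite mulrA.
  by rewrite v0 invr0 mulr0; apply: cvg_unique hr (l0 _).
exists c; split => [v0|t|]; first by rewrite v0 eqxx in vn0.
  apply: cvg_unique (hp t) _ => //.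
  by apply: cvgM h1 _; exact: cvg_cst.
apply: cvg_unique hr _ => //.
rewrite (_ : (fun m => _) = fun m => (v * moment1 (lam m)) * (v * moment1 (lam m)) / v).
  by rewrite expr2; apply: cvgM; [exact: cvgM|exact: cvg_cst].
by apply/funext => m; field.
Qed.

Lemma linear_is_rkhs_sqnorm (h : C01 R) (c : R) : (v = 0 -> c = 0) ->
  (forall t : I01 R, h t = c * \val t) -> is_rkhs_sqnorm q h (c ^+ 2 / v).
Proof.
move=> vc hE; exists (fun=> point_charge (c / v)).
have vcE : v * (c / v) = c.
  have [v0|vn0] := eqVneq v 0; first by rewrite vc// v0 mul0r.
  by rewrite mulrCA divff// mulr1.
split.
- move=> e e0; exists 0%N => m p _ _.
  by rewrite energy_linear moment1_diff expr0n mulr0.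
- rewrite (_ : (fun m : nat => _) = fun=> (h : I01 R -> R)).
    by move=> W /nbhs_singleton hW; exists 0%N => // m _.
  apply/funext => m; apply/funext => t.
  by rewrite potential_linear moment1_point_charge vcE hE.
- rewrite (_ : (fun m : nat => _) = fun=> c ^+ 2 / v); first exact: cvg_cst.
  apply/funext => m; rewrite energy_linear moment1_point_charge.
  by rewrite expr2 mulrA vcE mulrA -expr2.
Qed.

Lemma rkhs_sqnorm_linear (h : C01 R) (c : R) : (v = 0 -> c = 0) ->
  (forall t : I01 R, h t = c * \val t) -> rkhs_sqnorm q h = c ^+ 2 / v.
Proof.
move=> vc hE; rewrite /rkhs_sqnorm; case: xgetP => [r _ /= hr|/(_ (c ^+ 2 / v))]; last first.
  by move=> H; exfalso; apply: H; exact: linear_is_rkhs_sqnorm.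
have [c' [_ hE' ->]] := is_rkhs_sqnorm_linear hr.
have := hE (@mkI01 R 1 ltac:(by rewrite ler01 lexx)).
by rewrite hE' /= !mulr1 => ->.
Qed.

Lemma rkhs_rate_line (x c : R) : (v = 0 -> c = 0) ->
  rkhs_rate q x (line x c) = (c ^+ 2 / (2 * v))%:E.
Proof.
move=> vc; have hE t : sub_cst (line x c) x t = c * \val t by rewrite /= addrAC subrr add0r.
rewrite /rkhs_rate asboolT.
  rewrite (rkhs_sqnorm_linear vc hE); congr EFin.
  by rewrite invfM mulrCA.
split; first by rewrite /= mulr0 addr0.
by exists (c ^+ 2 / v); exact: linear_is_rkhs_sqnorm.
Qed.

Lemma rkhs_rate_fin (x : R) (h : C01 R) : rkhs_rate q x h <> +oo%E ->
  exists2 c, (v = 0 -> c = 0) & h = line x c.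
Proof.
rewrite /rkhs_rate; case: asboolP => // -[_ [r hr]] _.
have [c [vc hc _]] := is_rkhs_sqnorm_linear hr.
exists c => //; apply/continuousEP => t.
by have := hc t; rewrite /= => <-; rewrite addrC subrK.
Qed.

End linear_kernel.

Section conditioned_path_regularity.
Context {R : realType} (d : measure_display) (Omega : measurableType d).
Variable P : probability Omega R.
Variables (kappa : R -> R -> R) (X : R -> {RV P >-> R}) (n : nat) (T x : nat -> R).
Hypothesis kappa_cont : {within [set p : R * R | 0 <= p.1 /\ 0 <= p.2],
  continuous (fun p => kappa p.1 p.2)}.
Hypothesis Xcont : continuous_paths X.
Hypothesis T_ge0 : forall j, (1 <= j <= n)%N -> 0 <= T j.
Local Notation CP := (cond_process kappa T X x).

Lemma cond_process_continuous (w : Omega) : {within `[0, +oo[, continuous ((CP n)^~ w)}.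
Proof.
rewrite (_ : (CP n)^~ w = fun t => X t w -
    \sum_(i < n) alpha kappa T i.+1 t * (CP i (T i.+1) w - x i.+1)); last first.
  by apply/funext => t; exact: cond_processE.
move=> t; apply: cvgB; first exact: (@Xcont w).
apply: cvg_big => [|i _]; first exact: add_continuous.
by apply: cvgM; [exact: (alpha_continuous kappa_cont T_ge0 (ltn_ord i))|exact: cvg_cst].
Qed.

Lemma measurable_cond_process (j : nat) (t : R) : measurable_fun [set: Omega] (CP j t).
Proof.
elim: j t => [|j ih] t /=; first exact: measurable_funPT.
apply: measurable_funB; first exact: ih.
apply: measurable_funM; first exact: measurable_cst.
by apply: measurable_funB; [exact: ih|exact: measurable_cst].
Qed.

End conditioned_path_regularity.

Theorem theorem3p7 (R : realType) (d : measure_display)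
    (Omega : measurableType d) (P : probability Omega R)
    (kappa : R -> R -> R) (Z X : R -> {RV P >-> R})
    (n : nat) (T x : nat -> R)
    (kappa_continuous :
      {within [set p : R * R | 0 <= p.1 /\ 0 <= p.2],
        continuous (fun p => kappa p.1 p.2)})
    (Z_gaussian : centered_gaussian_process Z)
    (Z_covariance : has_covariance Z kappa)
    (Z_measurable : jointly_measurable Z)
    (X_continuous : continuous_paths X)
    (X_integrated : integrated_process Z X)
    (n_ge1 : (1 <= n)%N)
    (T1_gt0 : 0 < T 1%N)
    (T_increasing : forall j : nat, (1 <= j < n)%N -> T j < T j.+1)
    (cond_kernel_gt0 : forall j : nat, (1 <= j <= n)%N ->
      0 < cond_kernel kappa T j.-1 (T j) (T j)) :
  let Xn (e : R) (w : Omega) (t : R) : R :=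
    cond_process kappa T X x n (T n + e * t) w in
  (forall e w, 0 < e -> {within `[0, 1], continuous (Xn e w)}) /\
  satisfies_LDP P (fun e w => to_C01 (Xn e w)) (fun e => e)
    (rkhs_rate (kbar kappa T n) (x n)).
Proof.
move=> Xn; have T_ge0 j : (1 <= j <= n)%N -> 0 <= T j.
  by move=> jn; apply/ltW; exact: times_gt0 jn.
have Xn_continuous e w : 0 < e -> {within `[0, 1], continuous (Xn e w)}.
  move=> e0; have Tn0 : 0 <= T n by rewrite T_ge0// n_ge1 leqnn.
  apply: (@within_continuous_line _ (fun s => cond_process kappa T X x n s w)) => //.
    exact: ltW.
  exact: cond_process_continuous.
split=> //; apply: (@satisfies_LDP_of_approx _ _ _ _ _ (x n) (asq kappa T n)).
- move=> e G e0 oG; apply: (measurable_to_C01 (fun w => Xn_continuous e w e0)) => // t _.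
  exact: measurable_cond_process.
- move=> K delta K0 delta0.
  have [D [sigma [C [e0 [lawD hsigma e00 hD]]]]] := cond_exp_good_approx x kappa_continuous
    Z_gaussian Z_covariance Z_measurable X_continuous X_integrated n_ge1 T1_gt0 T_increasing
    cond_kernel_gt0 K0 delta0.
  exists D, sigma, C, e0; split => // e he; have e_gt0 : 0 < e by case/andP: he.
  have := hD e he; apply: outside_event_sub (lexx _) _ => w hw t.
  rewrite to_C01E; last exact: Xn_continuous.
  have := hw (\val t) (I01P t); rewrite /Xn /= opprD addrA.
  by rewrite (mulrAC e).
(* [kbar kappa T n] is by definition the linear kernel with [v = asq kappa T n]. *)
- move=> c; exact: rkhs_rate_line.
- move=> h; exact: rkhs_rate_fin.
Qed.
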